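(* Let $n\ge2$, let $\epsilon$ be a real constant, and let $f\colon M^n\to\widetilde M^n(4\epsilon)$ be a biharmonic Lagrangian $H$-umbilical (isometric) immersion of a connected $n$-dimensional Riemannian manifold $M^n$ into a complex space form of complex dimension $n$ and constant holomorphic sectional curvature $4\epsilon$. Then the mean curvature $|H|$ is constant on $M^n$, where $H$ is the mean curvature vector field of $f$.
   Context: Complex space forms. $\widetilde M^n(4\epsilon)$ denotes a Kähler manifold of complex dimension $n$, with metric $\langle\ ,\ \rangle$, complex structure $J$, and curvature tensor $$\widetilde R(X,Y)Z=\epsilon\{\langle Y,Z\rangle X-\langle X,Z\rangle Y+\langle JY,Z\rangle JX-\langle JX,Z\rangle JY+2\langle X,JY\rangle JZ\}.$$ Submanifolds. For an isometric immersion $f\colon M^n\to\widetilde M$, $h$ is the second fundamental form and $H=\frac1n\operatorname{trace} h$ is the mean curvature vector field; $f$ is totally geodesic if $h\equiv0$. An immersion of a real $n$-dimensional manifold into $\widetilde M^n(4\epsilon)$ is Lagrangian if $J$ interchanges the tangent and normal spaces at every point. A Lagrangian immersion of $M^n$ into $\widetilde M^n(4\epsilon)$ is called Lagrangian $H$-umbilical if it is not totally geodesic and every point of $M^n$ has a neighborhood $W$ on which there are an orthonormal frame field $\{e_1,\dots,e_n\}$ and functions $\lambda,\mu$ with $$h(e_1,e_1)=\lambda Je_1,\quad h(e_2,e_2)=\cdots=h(e_n,e_n)=\mu Je_1,\quad h(e_1,e_j)=\mu Je_j,\quad h(e_j,e_k)=0\quad(2\le j\ne k\le n).$$ Biharmonicity.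 For a smooth map $f\colon(M^n,g)\to(N,\overline g)$ of Riemannian manifolds, the tension field is $\tau(f)=\operatorname{trace}_g(\nabla df)$, and $f$ is biharmonic if it is a critical point of the bienergy $E_2(f;\Omega)=\frac12\int_\Omega|\tau(f)|^2dv_g$ under compactly supported variations for every relatively compact domain $\Omega\subset M^n$; equivalently, $$\tau_2(f)=\sum_{i=1}^n\left\{\nabla^f_{e_i}\nabla^f_{e_i}\tau(f)-\nabla^f_{\nabla_{e_i}e_i}\tau(f)+\overline R(\tau(f),df(e_i))df(e_i)\right\}=0,$$ where $\{e_i\}$ is a local orthonormal frame, $\nabla^f$ is the induced connection on $f^*TN$ and $\overline R$ is the curvature tensor of $N$, $\overline R(X,Y)=[\overline\nabla_X,\overline\nabla_Y]-\overline\nabla_{[X,Y]}$. For an isometric immersion, $\tau(f)=nH$. *)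

(* Defs.v *)
(* Differential geometry over an abstract R : realType, written in the charts
   of a smooth atlas.  A tangent vector at p is represented in a chart c by its
   row of components; a change of chart acts on rows by right multiplication by
   the library's jacobian.  A tensor field is a family of matrix fields, one
   for each chart, subject to the classical transformation law.  A bilinear
   form with matrix G is (u, v) |-> u G v^T, an endomorphism with matrix A is
   u |-> u A. *)
From HB Require Import structures.
From mathcomp Require Import all_boot all_order all_algebra.
From mathcomp Require Import all_classical all_reals all_analysis.

Set Implicit Arguments.
Unset Strict Implicit.
Unset Printing Implicit Defensive.

Import Order.TTheory GRing.Theory Num.Theory.
Import numFieldNormedType.Exports.

Local Open Scope classical_set_scope.
Local Open Scope ring_scope.

(* Class C^k on U, meant for open U only. *)
Fixpoint Ck (R : realType) (m : nat) (W : normedModType R) (k : nat)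
    (U : set 'rV[R]_m) (F : 'rV[R]_m -> W) : Prop :=
  (forall x, U x -> {for x, continuous F}) /\
  if k is k'.+1 then
    forall v : 'rV[R]_m,
      (forall x, U x -> derivable F x v) /\ Ck k' U (fun x => 'D_v F x)
  else True.

Definition smooth_on (R : realType) (m : nat) (W : normedModType R)
    (U : set 'rV[R]_m) (F : 'rV[R]_m -> W) : Prop :=
  forall k, Ck k U F.

(* coord and param are total; they are mutually inverse homeomorphisms between
   the open sets dom and coord @` dom, and arbitrary elsewhere. *)
Record chart (R : realType) (T : topologicalType) (n : nat) := Chart {
  dom : set T;
  coord : T -> 'rV[R]_n;
  param : 'rV[R]_n -> T;
  dom_open : open dom;
  image_open : open (coord @` dom);
  coordK : forall p, dom p -> param (coord p) = p;
  coord_continuous : forall p, dom p -> {for p, continuous coord};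
  param_continuous : forall p, dom p -> {for coord p, continuous param} }.

Definition transition (R : realType) (T : topologicalType) (n : nat)
    (c d : chart R T n) : 'rV[R]_n -> 'rV[R]_n :=
  fun x => coord d (param c x).

Record manifold (R : realType) (n : nat) := Manifold {
  carrier :> topologicalType;
  atlas : set (chart R carrier n);
  manifold_hausdorff : hausdorff_space carrier;
  manifold_second_countable : @second_countable carrier;
  atlas_cover : forall p : carrier, exists2 c, atlas c & dom c p;
  atlas_compatible : forall c d, atlas c -> atlas d ->
    smooth_on (coord c @` (dom c `&` dom d)) (transition c d) }.

Definition charts_at (R : realType) (n : nat) (M : manifold R n) (p : M) :
    set (chart R M n) :=
  [set c | atlas c /\ dom c p].

Definition inner (R : realType) (n : nat) (G : 'M[R]_n) (u v : 'rV[R]_n) : R :=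
  (u *m G *m v^T) 0 0.

(* metric c x is the Gram matrix of the coordinate fields of c at the point
   with coordinates x. *)
Record riemannian_manifold (R : realType) (n : nat) := RiemannianManifold {
  rman :> manifold R n;
  metric : chart R rman n -> 'rV[R]_n -> 'M[R]_n;
  metric_smooth : forall c, atlas c -> smooth_on (coord c @` dom c) (metric c);
  metric_sym : forall (p : rman) c, charts_at p c ->
    (metric c (coord c p))^T = metric c (coord c p);
  metric_pos : forall (p : rman) c, charts_at p c ->
    forall u : 'rV[R]_n, u != 0 -> 0 < inner (metric c (coord c p)) u u;
  metric_change : forall (p : rman) c d, charts_at p c -> charts_at p d ->
    let A := jacobian (transition c d) (coord c p) in
    metric c (coord c p) = A *m metric d (coord d p) *m A^T }.

(* Levi-Civita derivative in direction u of the field with constant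
   components v, for the metric matrix field G, from the Koszul formula. *)
Definition christoffel (R : realType) (n : nat) (G : 'rV[R]_n -> 'M[R]_n)
    (x u v : 'rV[R]_n) : 'rV[R]_n :=
  (2^-1 *: \row_(l < n)
     ('D_u (fun y => inner (G y) v (delta_mx 0 l)) x
      + 'D_v (fun y => inner (G y) u (delta_mx 0 l)) x
      - 'D_(delta_mx 0 l) (fun y => inner (G y) u v) x)) *m invmx (G x).

(* Induced connection on F^* TN, G being the metric of N: derivative in
   direction u of a field V along F. *)
Definition nabla_along (R : realType) (m n : nat) (G : 'rV[R]_n -> 'M[R]_n)
    (F : 'rV[R]_m -> 'rV[R]_n) (u : 'rV[R]_m) (V : 'rV[R]_m -> 'rV[R]_n)
    (x : 'rV[R]_m) : 'rV[R]_n :=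
  'D_u V x + christoffel G (F x) ('D_u F x) (V x).

Definition levi_civita (R : realType) (n : nat) (G : 'rV[R]_n -> 'M[R]_n)
    (X Y : 'rV[R]_n -> 'rV[R]_n) (x : 'rV[R]_n) : 'rV[R]_n :=
  'D_(X x) Y x + christoffel G x (X x) (Y x).

Definition lie_bracket (R : realType) (n : nat)
    (X Y : 'rV[R]_n -> 'rV[R]_n) (x : 'rV[R]_n) : 'rV[R]_n :=
  'D_(X x) Y x - 'D_(Y x) X x.

Definition curvature_fields (R : realType) (n : nat)
    (G : 'rV[R]_n -> 'M[R]_n) (X Y Z : 'rV[R]_n -> 'rV[R]_n)
    (x : 'rV[R]_n) : 'rV[R]_n :=
  levi_civita G X (levi_civita G Y Z) x
  - levi_civita G Y (levi_civita G X Z) x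
  - levi_civita G (lie_bracket X Y) Z x.

(* Being tensorial, curvature at x may be computed on any extensions of the
   vectors u, v, w; the ones with constant components are used. *)
Definition curvature (R : realType) (n : nat) (G : 'rV[R]_n -> 'M[R]_n)
    (x u v w : 'rV[R]_n) : 'rV[R]_n :=
  curvature_fields G (cst u) (cst v) (cst w) x.

(* Kaehler manifold of complex dimension n: almost Hermitian of real dimension
   2n with parallel complex structure.  cplx_parallel is the identity
   nabla_u (J W) = J (nabla_u W), which is tensorial in u and W and is
   therefore required for constant components only. *)
Record kaehler_manifold (R : realType) (n : nat) := KaehlerManifold {
  kman :> riemannian_manifold R (2 * n);
  cplx : chart R kman (2 * n) -> 'rV[R]_(2 * n) -> 'M[R]_(2 * n);
  cplx_smooth : forall c, atlas c -> smooth_on (coord c @` dom c) (cplx c);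
  cplx_square : forall (p : kman) c, charts_at p c ->
    cplx c (coord c p) *m cplx c (coord c p) = - 1%:M;
  cplx_isometry : forall (p : kman) c, charts_at p c ->
    forall u v : 'rV[R]_(2 * n),
    inner (metric c (coord c p)) (u *m cplx c (coord c p))
      (v *m cplx c (coord c p)) = inner (metric c (coord c p)) u v;
  cplx_parallel : forall (p : kman) c, charts_at p c ->
    forall u w : 'rV[R]_(2 * n),
    levi_civita (metric c) (cst u) (fun y => w *m cplx c y) (coord c p)
    = levi_civita (metric c) (cst u) (cst w) (coord c p)
        *m cplx c (coord c p);
  cplx_change : forall (p : kman) c d, charts_at p c -> charts_at p d ->
    let A := jacobian (transition c d) (coord c p) in
    cplx c (coord c p) *m A = A *m cplx d (coord d p) }.

(* Constant holomorphic sectional curvature 4 eps. *)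
Definition complex_space_form (R : realType) (n : nat) (eps : R)
    (N : kaehler_manifold R n) : Prop :=
  forall (q : N) d, charts_at q d ->
  forall X Y Z : 'rV[R]_(2 * n),
  let y := coord d q in
  let J := fun u : 'rV[R]_(2 * n) => u *m cplx d y in
  let ip := inner (metric d y) in
  curvature (metric d) y X Y Z
  = eps *: (ip Y Z *: X - ip X Z *: Y + ip (J Y) Z *: J X - ip (J X) Z *: J Y
            + (2 * ip X (J Y)) *: J Z).

Definition local_map (R : realType) (m n : nat) (M : manifold R m)
    (N : manifold R n) (f : M -> N) (c : chart R M m) (d : chart R N n) :
    'rV[R]_m -> 'rV[R]_n :=
  fun x => coord d (f (param c x)).

Definition local_dom (R : realType) (m n : nat) (M : manifold R m)
    (N : manifold R n) (f : M -> N) (c : chart R M m) (d : chart R N n) :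
    set 'rV[R]_m :=
  coord c @` (dom c `&` f @^-1` dom d).

Definition smooth_map (R : realType) (m n : nat) (M : manifold R m)
    (N : manifold R n) (f : M -> N) : Prop :=
  continuous f /\
  forall c d, atlas c -> atlas d ->
    smooth_on (local_dom f c d) (local_map f c d).

(* Injectivity of df follows from the preservation of the metric. *)
Definition isometric_immersion (R : realType) (m n : nat)
    (M : riemannian_manifold R m) (N : riemannian_manifold R n)
    (f : M -> N) : Prop :=
  smooth_map f /\
  forall (p : M) c d, charts_at p c -> charts_at (f p) d ->
  forall u v : 'rV[R]_m,
  inner (metric d (coord d (f p)))
    ('D_u (local_map f c d) (coord c p)) ('D_v (local_map f c d) (coord c p))
  = inner (metric c (coord c p)) u v.

(* (nabla df)(u, v) = nabla^f_u (df v) - df (nabla_u v), where v is extended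
   with constant components.  For an isometric immersion this is the second
   fundamental form h, by the Gauss formula. *)
Definition second_form (R : realType) (m n : nat)
    (M : riemannian_manifold R m) (N : riemannian_manifold R n) (f : M -> N)
    (c : chart R M m) (d : chart R N n) (x u v : 'rV[R]_m) : 'rV[R]_n :=
  nabla_along (metric d) (local_map f c d) u
    (fun y => 'D_v (local_map f c d) y) x
  - 'D_(christoffel (metric c) x u v) (local_map f c d) x.

Definition tension (R : realType) (m n : nat)
    (M : riemannian_manifold R m) (N : riemannian_manifold R n) (f : M -> N)
    (c : chart R M m) (d : chart R N n) (x : 'rV[R]_m) : 'rV[R]_n :=
  \sum_(i < m) \sum_(j < m)
    invmx (metric c x) i j *:
      second_form f c d x (delta_mx 0 i) (delta_mx 0 j).

Definition mean_curvature_vector (R : realType) (m n : nat)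
    (M : riemannian_manifold R m) (N : riemannian_manifold R n) (f : M -> N)
    (c : chart R M m) (d : chart R N n) (x : 'rV[R]_m) : 'rV[R]_n :=
  m%:R^-1 *: tension f c d x.

(* |H| at p, computed in the charts c around p and d around f p. *)
Definition mean_curvature (R : realType) (m n : nat)
    (M : riemannian_manifold R m) (N : riemannian_manifold R n) (f : M -> N)
    (c : chart R M m) (d : chart R N n) (p : M) : R :=
  let H := mean_curvature_vector f c d (coord c p) in
  Num.sqrt (inner (metric d (coord d (f p))) H H).

Definition totally_geodesic (R : realType) (m n : nat)
    (M : riemannian_manifold R m) (N : riemannian_manifold R n)
    (f : M -> N) : Prop :=
  forall (p : M) c d, charts_at p c -> charts_at (f p) d ->
  forall u v : 'rV[R]_m, second_form f c d (coord c p) u v = 0.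

Definition tangent_space (R : realType) (m n : nat)
    (M : riemannian_manifold R m) (N : riemannian_manifold R n) (f : M -> N)
    (c : chart R M m) (d : chart R N n) (p : M) : set 'rV[R]_n :=
  range (fun u : 'rV[R]_m => 'D_u (local_map f c d) (coord c p)).

Definition normal_space (R : realType) (m n : nat)
    (M : riemannian_manifold R m) (N : riemannian_manifold R n) (f : M -> N)
    (c : chart R M m) (d : chart R N n) (p : M) : set 'rV[R]_n :=
  [set w | forall t, tangent_space f c d p t ->
             inner (metric d (coord d (f p))) w t = 0].

Definition lagrangian (R : realType) (n : nat)
    (M : riemannian_manifold R n) (N : kaehler_manifold R n)
    (f : M -> N) : Prop :=
  forall (p : M) c d, charts_at p c -> charts_at (f p) d ->
  let J := fun w : 'rV[R]_(2 * n) => w *m cplx d (coord d (f p)) in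
  J @` tangent_space f c d p = normal_space f c d p /\
  J @` normal_space f c d p = tangent_space f c d p.

(* e i x is the row of components of the i-th field at the point with
   coordinates x; O is an open subset of the image of c. *)
Definition orthonormal_frame (R : realType) (n : nat)
    (M : riemannian_manifold R n) (c : chart R M n) (O : set 'rV[R]_n)
    (e : 'I_n -> 'rV[R]_n -> 'rV[R]_n) : Prop :=
  (forall i, smooth_on O (e i)) /\
  forall x, O x -> forall i j, inner (metric c x) (e i x) (e j x) = (i == j)%:R.

(* The neighborhood W is taken inside the domain of a chart, which is no loss
   since it may be shrunk.  The field e_1 is the one with index 0 : 'I_n. *)
Definition H_umbilical_at (R : realType) (n : nat)
    (M : riemannian_manifold R n) (N : kaehler_manifold R n) (f : M -> N)
    (p : M) : Prop :=
  exists (c : chart R M n) (W : set M) (e : 'I_n -> 'rV[R]_n -> 'rV[R]_n)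
    (lam mu : M -> R),
  [/\ charts_at p c, open W, W p, W `<=` dom c &
  orthonormal_frame c (coord c @` W) e /\
  forall (q : M) d, W q -> charts_at (f q) d ->
  let x := coord c q in
  let h := fun i j => second_form f c d x (e i x) (e j x) in
  let Je := fun i =>
    'D_(e i x) (local_map f c d) x *m cplx d (coord d (f q)) in
  forall i1 : 'I_n, i1 = 0%N :> nat ->
  [/\ h i1 i1 = lam q *: Je i1,
      forall j, j != i1 -> h j j = mu q *: Je i1,
      forall j, j != i1 -> h i1 j = mu q *: Je j &
      forall j k, j != i1 -> k != i1 -> j != k -> h j k = 0]].

Definition lagrangian_H_umbilical (R : realType) (n : nat)
    (M : riemannian_manifold R n) (N : kaehler_manifold R n)
    (f : M -> N) : Prop :=
  [/\ isometric_immersion f, lagrangian f, ~ totally_geodesic f &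
      forall p : M, H_umbilical_at f p].

Definition bitension (R : realType) (m n : nat)
    (M : riemannian_manifold R m) (N : riemannian_manifold R n) (f : M -> N)
    (c : chart R M m) (d : chart R N n) (e : 'I_m -> 'rV[R]_m -> 'rV[R]_m)
    (x : 'rV[R]_m) : 'rV[R]_n :=
  let F := local_map f c d in
  let tau := tension f c d in
  \sum_(i < m)
    (nabla_along (metric d) F (e i x)
       (fun y => nabla_along (metric d) F (e i y) tau y) x
     - nabla_along (metric d) F (levi_civita (metric c) (e i) (e i) x) tau x
     + curvature (metric d) (F x) (tau x) ('D_(e i x) F x) ('D_(e i x) F x)).

(* Vanishing of the bitension field, the Euler-Lagrange equation of the
   bienergy, in every local orthonormal frame. *)
Definition biharmonic (R : realType) (m n : nat)
    (M : riemannian_manifold R m) (N : riemannian_manifold R n)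
    (f : M -> N) : Prop :=
  smooth_map f /\
  forall (c : chart R M m) (d : chart R N n) (O : set 'rV[R]_m)
    (e : 'I_m -> 'rV[R]_m -> 'rV[R]_m),
  atlas c -> atlas d -> open O -> O `<=` local_dom f c d ->
  orthonormal_frame c O e ->
  forall x, O x -> bitension f c d e x = 0.

(* Main.v *)
(** Write [h(e_1, e_1) = la J e_1], [h(e_j, e_j) = mu J e_1] and [a = la + (n - 1) mu], so that the tension
field is [a J e_1] and [n |H| = |a|].  Where [a <> 0], the Codazzi equations and the tangential part of the
biharmonic equation show that the integral curves of [e_1] are geodesics, that [nabla_(e_j) e_1 = b e_j] for
[j > 1], and that [a] and [mu] vary only along [e_1]; the Gauss equation and the biharmonic equation then
form an overdetermined system of ordinary differential equations for [a], [mu], [b] along [e_1].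

Put [t = mu / a].  Where [e_1 a <> 0], the system yields a relation [A(t) b^2 + B(t) a^2 + C(t) eps = 0] with
polynomial coefficients.  Two differentiations along [e_1] give two more relations of the same shape, and the
determinant of the three is a nonzero polynomial in [t].  Hence [t] is constant along [e_1], a root of the
polynomial [N] for which [e_1 t] is a multiple of [N(t)], and for such a [t] the relations are contradictory.
So [a^2] is locally constant; as [|H|] does not depend on the charts, connectedness concludes. *)
Require Import Defs.
From HB Require Import structures.
From mathcomp Require Import all_boot all_order all_algebra.
From mathcomp Require Import all_classical all_reals all_analysis.
From mathcomp Require Import ring lra.
Set Implicit Arguments.
Unset Strict Implicit.
Unset Printing Implicit Defensive.
Import Order.TTheory GRing.Theory Num.Theory.
Import numFieldNormedType.Exports.
Local Open Scope classical_set_scope.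
Local Open Scope ring_scope.

(** * Smooth functions and directional derivatives *)

(** The three relations are linear and homogeneous in (b^2, a^2, eps), which is nonzero since a is;
    hence three of them, and a determinant. Its coefficients depend on the dimension, so it is not
    expanded but evaluated at the roots of N. There the derivatives of the coefficients drop out
    when a relation is differentiated along e_1, so each step is purely algebraic and the
    determinant factors. With m = n - 1, it vanishes at the root 1 / m only for m = 2, 4 and at the
    other root only for m = 3, so it is never the zero polynomial.

    No differential equation is solved. Every equation holds on an open set and may be
    differentiated there, and a derivative that is nonzero at one point stays nonzero nearby; the
    contradictions arise on such open sets.

    The functions la and mu are given without regularity. They are smooth because they are
    components, in a smooth orthonormal frame, of covariant derivatives of that frame. Only charts
    of M have to be compared, since the umbilical equations are given in all charts of the
    target. *)

Lemma Ck_le (R : realType) m (W : normedModType R) k (U : set 'rV[R]_m)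
  (f : 'rV[R]_m -> W) : Ck k.+1 U f -> Ck k U f.
Proof.
elim: k f => [|k IH] f [cf df]; split => // v; have [dv Hv] := df v.
by split=> //; exact: IH.
Qed.

Lemma Ck_congr (R : realType) m (W : normedModType R) k (U : set 'rV[R]_m)
  (f g : 'rV[R]_m -> W) : open U -> (forall x, U x -> f x = g x) ->
  Ck k U f -> Ck k U g.
Proof.
move=> oU; elim: k f g => [|k IH] f g fg [cf df].
  split=> // x Ux; have nfg : \near x, f x = g x.
    by near=> y; apply: fg; near: y; exact: open_nbhs_nbhs.
  rewrite /prop_for /continuous_at -fg //.
  apply: cvg_trans (cf x Ux); exact: near_eq_cvg nfg.
have nfg x : U x -> \near x, f x = g x.
  by move=> Ux; near=> y; apply: fg; near: y; exact: open_nbhs_nbhs.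
split=> [x Ux|v].
  rewrite /prop_for /continuous_at -fg //.
  apply: cvg_trans (cf x Ux); exact: near_eq_cvg (nfg x Ux).
have [dv Hv] := df v; split=> [x Ux|].
  exact: near_eq_derivable (nfg x Ux) (dv x Ux).
apply: IH Hv => x Ux; exact: near_eq_derive (nfg x Ux).
Unshelve. all: by end_near. Qed.

Lemma Ck_sub (R : realType) m (W : normedModType R) k (U V : set 'rV[R]_m)
  (f : 'rV[R]_m -> W) : V `<=` U -> Ck k U f -> Ck k V f.
Proof.
move=> VU; elim: k f => [|k IH] f [cf df].
  by split=> // x /VU; exact: cf.
split=> [x /VU|v]; first exact: cf.
by have [dv Hv] := df v; split=> [x /VU|]; [exact: dv|exact: IH].
Qed.

Lemma Ck_cst (R : realType) m (W : normedModType R) k (U : set 'rV[R]_m) (w : W) :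
  Ck k U (cst w).
Proof.
elim: k w => [|k IH] w; split; try by move=> x _; exact: cst_continuous.
  by [].
move=> v; split=> [x _|]; first exact: derivable_cst.
by rewrite (_ : (fun x => _) = cst 0) // funeqE => x; rewrite derive_cst.
Qed.

Lemma Ck_add (R : realType) m (W : normedModType R) k (U : set 'rV[R]_m)
  (f g : 'rV[R]_m -> W) : open U -> Ck k U f -> Ck k U g ->
  Ck k U (fun x => f x + g x).
Proof.
move=> oU; elim: k f g => [|k IH] f g [cf df] [cg dg].
  by split=> // x Ux; apply: continuousD; [exact: cf|exact: cg].
split=> [x Ux|v]; first by apply: continuousD; [exact: cf|exact: cg].
have [dfv Hf] := df v; have [dgv Hg] := dg v; split=> [x Ux|].
  by apply: derivableD; [exact: dfv|exact: dgv].
apply: Ck_congr (IH _ _ Hf Hg) => // x Ux.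
by rewrite -[RHS]/('D_v (f + g) x) deriveD //; [exact: dfv|exact: dgv].
Qed.

Lemma Ck_mul (R : realType) m k (U : set 'rV[R]_m)
  (f g : 'rV[R]_m -> R) : open U -> Ck k U f -> Ck k U g ->
  Ck k U (fun x => f x * g x).
Proof.
move=> oU; elim: k f g => [|k IH] f g Cf Cg; have [cf df] := Cf; have [cg dg] := Cg.
  by split=> // x Ux; apply: continuousM; [exact: cf|exact: cg].
split=> [x Ux|v]; first by apply: continuousM; [exact: cf|exact: cg].
have [dfv Hf] := df v; have [dgv Hg] := dg v; split=> [x Ux|].
  by apply: derivableM; [exact: dfv|exact: dgv].
apply: Ck_congr (Ck_add oU (IH _ _ (Ck_le Cf) Hg) (IH _ _ (Ck_le Cg) Hf)) => // x Ux.
by rewrite -[RHS]/('D_v (f * g) x) deriveM //; [exact: dfv|exact: dgv].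
Qed.

Lemma Ck_inv (R : realType) m k (U : set 'rV[R]_m) (f : 'rV[R]_m -> R) :
  open U -> (forall x, U x -> f x != 0) -> Ck k U f ->
  Ck k U (fun x => (f x)^-1).
Proof.
move=> oU f0; elim: k => [|k IH] Cf; have [cf df] := Cf.
  by split=> // x Ux; apply: continuousV; [exact: f0|exact: cf].
split=> [x Ux|v]; first by apply: continuousV; [exact: f0|exact: cf].
have [dfv Hf] := df v; split=> [x Ux|].
  by apply: derivableV; [exact: f0|exact: dfv].
have IHk := IH (Ck_le Cf).
apply: Ck_congr (Ck_mul oU (Ck_cst k U (-1 : R)) (Ck_mul oU (Ck_mul oU IHk IHk) Hf)) => //.
move=> x Ux; rewrite deriveV ?f0 //; last exact: dfv.
by rewrite /cst /= -expr2 mulN1r exprVn -mulNr.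
Qed.

Lemma continuous_mxP (R : realType) (T : topologicalType) m n (M : T -> 'M[R]_(m, n)) t :
  {for t, continuous M} <-> forall i j, {for t, continuous (fun x => M x i j)}.
Proof.
split=> [cM i j|cM].
  apply: (@continuous_comp _ _ _ M (fun A : 'M[R]_(m, n) => A i j)) => //.
  exact: coord_continuous.
apply/cvgrPdist_le => /= e e0; near=> x.
rewrite /Num.Def.normr/= mx_normrE (bigmax_le _ (ltW e0))//= => i _.
rewrite !mxE; move: i; near: x; apply: filter_forall => /= i.
exact: ((cvgrPdist_le _ _).1 (cM i.1 i.2)).
Unshelve. all: by end_near. Qed.

Lemma Ck_mxP (R : realType) m k (U : set 'rV[R]_m) p q (M : 'rV[R]_m -> 'M[R]_(p, q)) :
  open U ->
  Ck k U M <-> forall i j, Ck k U (fun x => M x i j).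
Proof.
move=> oU; elim: k M => [|k IH] M; split.
- by move=> [cM _] i j; split=> // x Ux; move/continuous_mxP: (cM x Ux); apply.
- by move=> H; split=> // x Ux; apply/continuous_mxP => i j; case: (H i j) => + _; apply.
- move=> [cM dM] i j; split=> [x Ux|v].
    by move/continuous_mxP: (cM x Ux); apply.
  have [dv Hv] := dM v; split=> [x Ux|].
    by move/derivable_mxP: (dv x Ux); apply.
  apply: (Ck_congr oU _ ((IH _).1 Hv i j)) => x Ux.
  by rewrite derive_mx ?mxE //; exact: dv.
- move=> H; split=> [x Ux|v].
    by apply/continuous_mxP => i j; case: (H i j) => + _; apply.
  have dv x : U x -> derivable M x v.
    move=> Ux; apply/derivable_mxP => i j; case: (H i j) => _ /(_ v)[+ _]; exact.
  split=> //; apply/IH => i j; case: (H i j) => _ /(_ v)[_].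
  by apply: Ck_congr => // x Ux; rewrite derive_mx ?mxE //; exact: dv.
Qed.

(** * The mean value theorem along lines, and differentiability of functions of class C^1 *)

Lemma near_line (R : realType) (V : normedModType R) (x v : V)
  (P : V -> Prop) : (\forall y \near x, P y) -> \forall t \near (0 : R), P (t *: v + x).
Proof.
move=> Px; have : (fun t : R => t *: v + x) @ (0 : R) --> x.
  rewrite -[X in _ --> X]add0r -(scale0r v); apply: cvgD; last exact: cvg_cst.
  apply: cvgZr_tmp; exact: cvg_id.
exact.
Qed.

Lemma is_derive_line (R : realType) (V W : normedModType R) (f : V -> W) (x v : V) (t : R) :
  derivable f (t *: v + x) v ->
  is_derive t 1 (fun s : R => f (s *: v + x)) ('D_v f (t *: v + x)).
Proof.
set y := t *: v + x => dv; set g := fun s : R => _.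
have E : (fun h => h^-1 *: ((g \o shift t) (h *: 1) - g t))
       = (fun h => h^-1 *: ((f \o shift y) (h *: v) - f y)).
  by rewrite funeqE => h; rewrite /g /y /= [h *: 1]mulr1 scalerDl addrA.
by apply: DeriveDef; rewrite /derivable /derive E.
Qed.

(** On the line through x the factor a is a linear change of parameter, so the chain rule in one
    variable applies; the case a = 0 is included. *)
Lemma derivable_scale (R : realType) (V : normedModType R) (f : V -> R) (x v : V) (a : R) :
  derivable f x v -> is_derive x (a *: v) f (a * 'D_v f x).
Proof.
move=> dv; have := @is_derive_line _ _ _ f x v 0.
rewrite scale0r add0r => /(_ dv) H1.
have H2 : is_derive (0 : R) (1 : R) (fun s : R => s * a) a.
  have := @is_deriveM _ _ (@id R) (cst a) 0 1 _ _ (is_derive_id _ _) (is_derive_cst _ _ _).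
  by rewrite scaler0 add0r /cst [a *: 1]mulr1.
have H3 : is_derive (0 : R) (1 : R) (fun s : R => f (s *: (a *: v) + x)) (a * 'D_v f x).
  rewrite mulrC; have := @is_derive1_comp _ (fun s => f (s *: v + x)) (fun s => s * a) 0 ('D_v f x) a.
  rewrite mul0r => /(_ H1 H2); congr (is_derive _ _ _ _).
  by rewrite funeqE => s /=; rewrite scalerA.
have E : (fun h : R => h^-1 *: (((fun s : R => f (s *: (a *: v) + x)) \o shift 0) (h *: 1) - f (0 *: (a *: v) + x)))
       = (fun h => h^-1 *: ((f \o shift x) (h *: (a *: v)) - f x)).
  by rewrite funeqE => h; rewrite /= [h *: 1]mulr1 addr0 scale0r add0r.
case: H3; rewrite /derivable /derive E => H3 H4.
exact: DeriveDef.
Qed.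

Lemma MVT_line (R : realType) (V : normedModType R) (f : V -> R) (x v : V) :
  (forall t, t \in `[0, 1] -> derivable f (t *: v + x) v) ->
  exists2 t : R, t \in `[0, 1] & f (v + x) - f x = 'D_v f (t *: v + x).
Proof.
move=> dv; pose g (t : R) := f (t *: v + x).
have dg (t : R) : t \in `[0, 1] -> is_derive t 1 g ('D_v f (t *: v + x)).
  by move=> /dv; exact: is_derive_line.
have cg : {within `[0, 1], continuous g}.
  apply: continuous_in_subspaceT => t; rewrite inE /= => /dg[+ _].
  by move=> /derivable1_diffP /differentiable_continuous.
have dg' (t : R) : t \in `]0, 1[ -> is_derive t 1 g ('D_v f (t *: v + x)).
  by move=> t01; apply: dg; exact: subset_itv_oo_cc t01.
have [t t01 E] := MVT_segment ler01 dg' cg.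
exists t => //; move: E.
by rewrite /g scale1r scale0r add0r subr0 mulr1.
Qed.

Lemma segment_ball (R : realType) (V : normedModType R) (x v : V) (r t : R) :
  `|v| < r -> t \in `[0, 1] -> ball x r (t *: v + x).
Proof.
move=> vr; rewrite in_itv /= => /andP[t0 t1].
rewrite -ball_normE /= opprD addrCA subrr addr0 normrN normrZ ger0_norm //.
apply: le_lt_trans vr; exact: ler_piMl.
Qed.

Lemma Ck1_ball (R : realType) m (U : set 'rV[R]_m) (f : 'rV[R]_m -> R) x v (e : R) :
  open U -> Ck 1 U f -> U x -> 0 < e ->
  exists2 r : R, 0 < r & forall y, ball x r y -> U y /\ `|'D_v f x - 'D_v f y| < e.
Proof.
move=> oU [_ /(_ v)[_ [cD _]]] Ux e0.
have H : \forall y \near x, U y /\ `|'D_v f x - 'D_v f y| < e.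
  near=> y; split; first by near: y; exact: open_nbhs_nbhs.
  by near: y; have /cvgrPdist_lt := cD x Ux; apply.
by have /nbhs_ballP[r r0 rP] := H; exists r.
Unshelve. all: by end_near. Qed.

(* The increment of [f] from [x + t u] to [x + t (u + v)] is given by the mean value theorem. *)
Lemma Ck1_deriveD (R : realType) m (U : set 'rV[R]_m) (f : 'rV[R]_m -> R) x u v :
  open U -> Ck 1 U f -> U x ->
  'D_(u + v) f x = 'D_u f x + 'D_v f x.
Proof.
move=> oU Cf Ux; have [_ df] := Cf.
apply/eqP; rewrite -subr_eq0 -normr_le0; apply/ler_addgt0Pl => e e0.
rewrite addr0; have e3 : 0 < e / 3 by rewrite divr_gt0.
have [r r0 rP] := Ck1_ball v oU Cf Ux e3.
have duv : derivable f x (u + v) by apply: (df _).1.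
have du : derivable f x u by apply: (df _).1.
(* One small t keeps both increments within r / 2 and brings two difference quotients within e / 3
   of their limits; the last e / 3 comes from the continuity of the derivative along v. *)
have [t tP] : exists t : R, [/\ t != 0, `|t *: u| < r / 2, `|t *: v| < r / 2,
   `|'D_(u+v) f x - t^-1 * (f (t *: (u+v) + x) - f x)| < e / 3 &
   `|'D_u f x - t^-1 * (f (t *: u + x) - f x)| < e / 3].
  have nz (w : 'rV[R]_m) : \forall t \near 0^', `|t *: w| < r / 2.
    have H : \forall t \near (0 : R), `|t *: w + 0| < r / 2.
      apply: (@near_line R _ 0 w (fun y => `|y| < r / 2)).
      by apply: nbhs0_lt; rewrite divr_gt0.
    apply: nbhs_dnbhs; apply: filterS H => t; by rewrite addr0.
  have dw (w : 'rV[R]_m) : derivable f x w ->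
     \forall t \near 0^', `|'D_w f x - t^-1 * (f (t *: w + x) - f x)| < e / 3.
    by move=> dw; have /cvgrPdist_lt := dw; apply.
  apply: (@filter_ex _ (0^' : set_system R)).
  near=> t; split.
  - by near: t; exact: nbhs_dnbhs_neq.
  - by near: t; exact: nz.
  - by near: t; exact: nz.
  - by near: t; exact: dw.
  - by near: t; exact: dw.
case: tP => t0 tu tv H1 H2.
have tux : ball x r (t *: u + x).
  have := @segment_ball _ _ x (t *: u) r 1; rewrite scale1r; apply.
    by apply: lt_trans tu _; rewrite ltr_pdivrMr // mulr_natr mulr2n ltrDl.
  by rewrite in_itv /= ler01 lexx.
have sB (s : R) : s \in `[0, 1] -> ball x r (s *: (t *: v) + (t *: u + x)).
  rewrite in_itv /= => /andP[s0 s1]; rewrite -ball_normE /=.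
  rewrite distrC addrA addrK; apply: le_lt_trans (ler_normD _ _) _.
  rewrite (splitr r) ltr_leD // ?(ltW tu) //.
  apply: le_lt_trans tv; rewrite normrZ ger0_norm //; exact: ler_piMl.
have dtv s : s \in `[0, 1] -> derivable f (s *: (t *: v) + (t *: u + x)) (t *: v).
  by move=> /sB /rP [Us _]; have [] := derivable_scale t ((df v).1 _ Us).
have [s s01 Es] := MVT_line dtv.
have [Us H3] := rP _ (sB _ s01).
move: Es; have [_ ->] := derivable_scale t ((df v).1 _ Us).
rewrite addrA -scalerDr (addrC v) => Es.
move: H1; rewrite (_ : t^-1 * _ = 'D_v f (s *: (t *: v) + (t *: u + x)) + t^-1 * (f (t *: u + x) - f x)); last first.
  by rewrite -['D_v f _](mulKf t0) -Es -mulrDr subrKA.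
move: H2 H3; set a := 'D_u f x; set b := t^-1 * _; set c := 'D_v f x; set d := 'D_v f _; set g := 'D_(u+v) f x.
rewrite !ltr_norml ler_norml => /andP[? ?] /andP[? ?] /andP[? ?]; lra.
Unshelve. all: by end_near. Qed.

Lemma Ck1_deriveZ (R : realType) m (U : set 'rV[R]_m) (f : 'rV[R]_m -> R) x a v :
  Ck 1 U f -> U x -> 'D_(a *: v) f x = a * 'D_v f x.
Proof. by move=> [_ df] Ux; have [_ ->] := derivable_scale a ((df v).1 _ Ux). Qed.

Lemma Ck1_derive_sum (R : realType) m (U : set 'rV[R]_m) (f : 'rV[R]_m -> R) x v :
  open U -> Ck 1 U f -> U x ->
  'D_v f x = \sum_i v 0 i * 'D_(delta_mx 0 i) f x.
Proof.
move=> oU Cf Ux; rewrite {1}[v]row_sum_delta.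
rewrite (big_morph (fun w => 'D_w f x) (id1 := 0) (op1 := +%R)) //; last exact: derive0.
  by apply: eq_bigr => i _; rewrite (Ck1_deriveZ _ _ Cf).
by move=> u w; rewrite (Ck1_deriveD _ _ oU Cf).
Qed.

Lemma le_mx_coord (R : realType) m (h : 'rV[R]_m) i : `|h 0 i| <= `|h|.
Proof. by rewrite [leRHS]/Num.Def.normr/= mx_normrE; exact: (le_bigmax _ _ (0, i)). Qed.

Lemma Ck1_near_all (R : realType) m (U : set 'rV[R]_m) (f : 'rV[R]_m -> R) x (e : R) :
  open U -> Ck 1 U f -> U x -> 0 < e ->
  exists2 r : R, 0 < r & forall y, ball x r y -> U y /\
    forall i, `|'D_(delta_mx 0 i) f y - 'D_(delta_mx 0 i) f x| < e.
Proof.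
move=> oU Cf Ux e0.
have H : \forall y \near x, U y /\ forall i, `|'D_(delta_mx 0 i) f y - 'D_(delta_mx 0 i) f x| < e.
  near=> y; split; first by near: y; exact: open_nbhs_nbhs.
  near: y; apply: filter_forall => i.
  have [r r0 rP] := Ck1_ball (delta_mx 0 i) oU Cf Ux e0.
  by apply/nbhs_ballP; exists r => // y /rP [_]; rewrite distrC.
by have /nbhs_ballP[r r0 rP] := H; exists r.
Unshelve. all: by end_near. Qed.

(** The differential must be h |-> 'D_h f x, which is linear by the additivity above. The mean value
    theorem turns the remainder into a difference of derivatives along h at two nearby points,
    bounded through the partial derivatives. *)
Lemma Ck1_differentiable (R : realType) m (U : set 'rV[R]_m) (f : 'rV[R]_m -> R) x :
  open U -> Ck 1 U f -> U x -> differentiable f x.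
Proof.
move=> oU Cf Ux; pose Lf (h : 'rV[R]_m) : R := 'D_h f x.
have linL : linear Lf.
  by move=> a u v; rewrite /Lf (Ck1_deriveD _ _ oU Cf) // (Ck1_deriveZ _ _ Cf).
pose L : {linear 'rV[R]_m -> R} := HB.pack Lf (GRing.isLinear.Build _ _ _ _ _ linL).
have cL : continuous L.
  move=> h; apply: differentiable_continuous.
  rewrite (_ : (L : _ -> _) = \sum_(i < m) (fun h : 'rV[R]_m => h 0 i * 'D_(delta_mx 0 i) f x)).
    apply: differentiable_sum => i; apply: differentiableM => //.
    exact: differentiable_coord.
  by rewrite funeqE => k; rewrite fct_sumE; exact: Ck1_derive_sum Cf Ux.
have E : f \o shift x = cst (f x) + L +o_ (0 : 'rV[R]_m) id.
  apply/eqaddoP => e e0.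
  (* The share of each of the m partial derivatives; the successor keeps the quotient meaningful
     when m = 0. *)
  have em : 0 < e / m.+1%:R by rewrite divr_gt0 ?ltr0n.
  have [r r0 rP] := Ck1_near_all oU Cf Ux em.
  have H0 : \forall h \near (0 : 'rV[R]_m), `|h| < r by exact: nbhs0_lt.
  near=> h; have hr : `|h| < r by near: h.
  have dh t : t \in `[0, 1] -> derivable f (t *: h + x) h.
    by move=> /(segment_ball x hr) /rP [Uy _]; exact: (Cf.2 h).1.
  have [t t01 Et] := MVT_line dh.
  have [Uy Hy] := rP _ (segment_ball x hr t01).
  rewrite (_ : (_ - _) h = f (h + x) - f x - Lf h); last by rewrite [LHS]/= opprD addrA.
  rewrite Et /Lf (Ck1_derive_sum h oU Cf Uy) (Ck1_derive_sum h oU Cf Ux) -sumrB.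
  apply: le_trans (ler_norm_sum _ _ _) _.
  apply: (@le_trans _ _ (\sum_(i < m) (e / m.+1%:R * `|h|))).
    apply: ler_sum => i _; rewrite -mulrBr normrM mulrC.
    by apply: ler_pM => //; [exact/ltW/Hy|exact: le_mx_coord].
  rewrite sumr_const card_ord -[leLHS]mulr_natl [leLHS]mulrA ler_wpM2r //.
  by rewrite mulrCA ler_piMr ?(ltW e0) // ler_pdivrMr ?ltr0n // mul1r ler_nat.
have dE := diff_unique cL E.
by apply/diff_locallyP; rewrite dE.
Unshelve. all: by end_near. Qed.

Lemma differentiable_mx (R : realType) (V : normedModType R) p q (f : V -> 'M[R]_(p, q)) x :
  (forall i j, differentiable (fun y => f y i j : R) x) -> differentiable f x.
Proof.
move=> df; rewrite (_ : f = \sum_(i < p) (fun y => \sum_(j < q) f y i j *: delta_mx i j)).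
  apply: differentiable_sum => i.
  rewrite (_ : (fun y => _) = \sum_(j < q) (fun y => f y i j *: delta_mx i j)).
    by apply: differentiable_sum => j; apply: differentiableZl.
  by rewrite funeqE => y; rewrite fct_sumE.
by rewrite funeqE => y; rewrite fct_sumE -matrix_sum_delta.
Qed.

Lemma Ck_sum (R : realType) m (W : normedModType R) k (U : set 'rV[R]_m)
  (I : Type) (r : seq I) (P : pred I) (f : I -> 'rV[R]_m -> W) :
  open U -> (forall i, P i -> Ck k U (f i)) ->
  Ck k U (fun x => \sum_(i <- r | P i) f i x).
Proof.
move=> oU Cf; elim: r => [|i r IH].
  by apply: Ck_congr (Ck_cst k U (0 : W)) => // x _; rewrite big_nil.
have [Pi|nPi] := boolP (P i).
  by apply: Ck_congr (Ck_add oU (Cf i Pi) IH) => // x _; rewrite big_cons Pi.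
by apply: Ck_congr IH => // x _; rewrite big_cons (negbTE nPi).
Qed.

Lemma Ck_prod (R : realType) m k (U : set 'rV[R]_m)
  (I : Type) (r : seq I) (P : pred I) (f : I -> 'rV[R]_m -> R) :
  open U -> (forall i, P i -> Ck k U (f i)) ->
  Ck k U (fun x => \prod_(i <- r | P i) f i x).
Proof.
move=> oU Cf; elim: r => [|i r IH].
  by apply: Ck_congr (Ck_cst k U (1 : R)) => // x _; rewrite big_nil.
have [Pi|nPi] := boolP (P i).
  by apply: Ck_congr (Ck_mul oU (Cf i Pi) IH) => // x _; rewrite big_cons Pi.
by apply: Ck_congr IH => // x _; rewrite big_cons (negbTE nPi).
Qed.

(** Directional derivability is not stable under composition, so the chain rule goes through
    differentiability, available from class C^1 on. The derivative of the composite is a sum of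
    products with partial derivatives of g taken along F, to which the induction applies. *)
Lemma Ck_comp (R : realType) m n k (U : set 'rV[R]_m) (V : set 'rV[R]_n)
  (F : 'rV[R]_m -> 'rV[R]_n) (g : 'rV[R]_n -> R) :
  open U -> open V -> (forall x, U x -> V (F x)) ->
  Ck k U F -> Ck k V g -> Ck k U (fun x => g (F x)).
Proof.
move=> oU oV FUV; elim: k g => [|k IH] g CF Cg.
  split=> // x Ux; apply: (@continuous_comp _ _ _ F g).
    by case: CF => + _; exact.
  by case: Cg => + _; apply; exact: FUV.
have CF1 : Ck 1 U F.
  by move: CF; clear IH Cg; elim: k => // k IH /Ck_le.
have Cg1 : Ck 1 V g.
  by move: Cg; clear IH CF CF1; elim: k => // k IH /Ck_le.
have dF x : U x -> differentiable F x.
  move=> Ux; apply: differentiable_mx => i j; apply: (Ck1_differentiable oU) => //.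
  exact: (Ck_mxP 1 F oU).1.
have dg x : U x -> differentiable g (F x).
  by move=> Ux; apply: (Ck1_differentiable oV) => //; exact: FUV.
have cg : forall x, U x -> {for x, continuous (fun x => g (F x))}.
  by move=> x Ux; apply: (@continuous_comp _ _ _ F g); [case: CF1 => + _; exact|
    case: Cg1 => + _; apply; exact: FUV].
split=> // v; split=> [x Ux|].
  apply: diff_derivable; apply: (@differentiable_comp _ _ _ _ F g); [exact: dF|exact: dg].
have H : Ck k U (fun x => \sum_i ('D_v F x) 0 i * 'D_(delta_mx 0 i) g (F x)).
  apply: Ck_sum => // i _; apply: Ck_mul => //; last exact: IH (Ck_le CF) (Cg.2 _).2.
  exact: ((Ck_mxP k ('D_v F) oU).1 (CF.2 v).2).
apply: Ck_congr H => // x Ux.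
rewrite [RHS]deriveE; last by apply: (@differentiable_comp _ _ _ _ F g); [exact: dF|exact: dg].
rewrite (diff_comp (dF x Ux) (dg x Ux)) /= -deriveE; last exact: dg.
rewrite -deriveE; last exact: dF.
by rewrite -(Ck1_derive_sum _ oV Cg1) //; exact: FUV.
Qed.

(** * Stability of smooth functions under the usual operations *)

Section smooth.
Variables (R : realType) (m : nat) (U : set 'rV[R]_m).
Hypothesis oU : open U.

Lemma smooth_mxP p q (F : 'rV[R]_m -> 'M[R]_(p, q)) :
  smooth_on U F <-> forall i j, smooth_on U (fun x => F x i j).
Proof.
split=> [H i j k|H k]; first exact: (Ck_mxP k F oU).1 (H k) i j.
by apply/Ck_mxP => // i j; exact: H.
Qed.

Lemma smooth_congr (W : normedModType R) (f g : 'rV[R]_m -> W) :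
  (forall x, U x -> f x = g x) -> smooth_on U f -> smooth_on U g.
Proof. by move=> fg sf k; exact: Ck_congr (sf k). Qed.

Lemma smooth_cst (W : normedModType R) (w : W) : smooth_on U (fun _ => w).
Proof. by move=> k; exact: Ck_cst. Qed.

Lemma smooth_derive (W : normedModType R) (f : 'rV[R]_m -> W) v :
  smooth_on U f -> smooth_on U (fun x => 'D_v f x).
Proof. by move=> sf k; exact: ((sf k.+1).2 v).2. Qed.

Lemma smooth_derivable (W : normedModType R) (f : 'rV[R]_m -> W) x v :
  smooth_on U f -> U x -> derivable f x v.
Proof. by move=> sf; exact: ((sf 1%N).2 v).1. Qed.

Lemma smooth_add (W : normedModType R) (f g : 'rV[R]_m -> W) :
  smooth_on U f -> smooth_on U g -> smooth_on U (fun x => f x + g x).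
Proof. by move=> sf sg k; exact: Ck_add. Qed.

Lemma smooth_sum (W : normedModType R) (I : Type) (r : seq I) (P : pred I)
  (f : I -> 'rV[R]_m -> W) :
  (forall i, P i -> smooth_on U (f i)) ->
  smooth_on U (fun x => \sum_(i <- r | P i) f i x).
Proof.
by move=> sf k; apply: Ck_sum => // i Pi; exact: sf.
Qed.

Lemma smooth_mul (f g : 'rV[R]_m -> R) :
  smooth_on U f -> smooth_on U g -> smooth_on U (fun x => f x * g x).
Proof. by move=> sf sg k; exact: Ck_mul. Qed.

Lemma smooth_opp (f : 'rV[R]_m -> R) : smooth_on U f -> smooth_on U (fun x => - f x).
Proof.
move=> sf; apply: smooth_congr (smooth_mul (smooth_cst (-1 : R)) sf) => x _.
by rewrite mulN1r.
Qed.

Lemma smooth_sub (f g : 'rV[R]_m -> R) :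
  smooth_on U f -> smooth_on U g -> smooth_on U (fun x => f x - g x).
Proof. by move=> sf sg; apply: smooth_add => //; exact: smooth_opp. Qed.

Lemma smooth_prod (I : Type) (r : seq I) (P : pred I) (f : I -> 'rV[R]_m -> R) :
  (forall i, P i -> smooth_on U (f i)) ->
  smooth_on U (fun x => \prod_(i <- r | P i) f i x).
Proof.
by move=> sf k; apply: Ck_prod => // i Pi; exact: sf.
Qed.

Lemma smooth_inv (f : 'rV[R]_m -> R) :
  (forall x, U x -> f x != 0) -> smooth_on U f -> smooth_on U (fun x => (f x)^-1).
Proof. by move=> f0 sf k; exact: Ck_inv. Qed.

Lemma smooth_mulmx p q r (A : 'rV[R]_m -> 'M[R]_(p, q)) (B : 'rV[R]_m -> 'M[R]_(q, r)) :
  smooth_on U A -> smooth_on U B -> smooth_on U (fun x => A x *m B x).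
Proof.
move=> /smooth_mxP sA /smooth_mxP sB; apply/smooth_mxP => i j.
have H : smooth_on U (fun x => \sum_k A x i k * B x k j).
  by apply: smooth_sum => k _; exact: smooth_mul.
by apply: smooth_congr H => x _; rewrite mxE.
Qed.

Lemma smooth_scale p q (f : 'rV[R]_m -> R) (A : 'rV[R]_m -> 'M[R]_(p, q)) :
  smooth_on U f -> smooth_on U A -> smooth_on U (fun x => f x *: A x).
Proof.
move=> sf /smooth_mxP sA; apply/smooth_mxP => i j.
by apply: smooth_congr (smooth_mul sf (sA i j)) => x _; rewrite mxE.
Qed.

Lemma smooth_trmx p q (A : 'rV[R]_m -> 'M[R]_(p, q)) :
  smooth_on U A -> smooth_on U (fun x => (A x)^T).
Proof.
move=> /smooth_mxP sA; apply/smooth_mxP => i j.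
by apply: smooth_congr (sA j i) => x _; rewrite mxE.
Qed.

Lemma smooth_det p (A : 'rV[R]_m -> 'M[R]_p) :
  smooth_on U A -> smooth_on U (fun x => \det (A x)).
Proof.
move=> /smooth_mxP sA; rewrite /determinant; apply: smooth_sum => s _.
by apply: smooth_mul; [exact: smooth_cst|apply: smooth_prod => i _; exact: sA].
Qed.

Lemma smooth_invmx p (A : 'rV[R]_m -> 'M[R]_p) :
  (forall x, U x -> A x \in unitmx) ->
  smooth_on U A -> smooth_on U (fun x => invmx (A x)).
Proof.
move=> uA sA.
have H : smooth_on U (fun x => (\det (A x))^-1 *: \adj (A x)).
  apply: smooth_scale.
    apply: smooth_inv; last exact: smooth_det.
    by move=> x /uA; rewrite unitmxE unitfE.
  apply/smooth_mxP => i j.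
  have Hc : smooth_on U (fun x => cofactor (A x) j i).
    apply: smooth_mul; first exact: smooth_cst.
    apply: smooth_det; apply/smooth_mxP => k l.
    by move/smooth_mxP: sA => /(_ (lift j k) (lift i l)); apply: smooth_congr => x _; rewrite !mxE.
  by apply: smooth_congr Hc => x _; rewrite mxE.
by apply: smooth_congr H => x Ux; rewrite /invmx uA.
Qed.

Lemma smooth_differentiable p q (F : 'rV[R]_m -> 'M[R]_(p, q)) x :
  smooth_on U F -> U x -> differentiable F x.
Proof.
move=> /smooth_mxP sF Ux; apply: differentiable_mx => i j.
by apply: (Ck1_differentiable oU) => //; exact: sF.
Qed.

Lemma smooth_differentiableR (f : 'rV[R]_m -> R) x :
  smooth_on U f -> U x -> differentiable f x.
Proof. by move=> sf; exact: (Ck1_differentiable oU (sf 1%N)). Qed.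

(** The direction moves with the point, so the derivative is expanded over the fixed coordinate
    directions. *)
Lemma smooth_dir p q (F : 'rV[R]_m -> 'M[R]_(p, q)) (V : 'rV[R]_m -> 'rV[R]_m) :
  smooth_on U F -> smooth_on U V -> smooth_on U (fun x => 'D_(V x) F x).
Proof.
move=> sF sV.
have H : smooth_on U (fun x => \sum_i (V x 0 i) *: 'D_(delta_mx 0 i) F x).
  apply: smooth_sum => i _; apply: smooth_scale; last exact: smooth_derive.
  exact: (smooth_mxP V).1.
apply: smooth_congr H => x Ux; rewrite [in RHS]deriveE; last exact: smooth_differentiable.
rewrite {2}[V x]row_sum_delta linear_sum; apply: eq_bigr => i _.
by rewrite linearZ -deriveE //; exact: smooth_differentiable.
Qed.

Lemma smooth_dirR (f : 'rV[R]_m -> R) (V : 'rV[R]_m -> 'rV[R]_m) :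
  smooth_on U f -> smooth_on U V -> smooth_on U (fun x => 'D_(V x) f x).
Proof.
move=> sf sV.
have H : smooth_on U (fun x => \sum_i (V x 0 i) * 'D_(delta_mx 0 i) f x).
  apply: smooth_sum => i _; apply: smooth_mul; last exact: smooth_derive.
  exact: (smooth_mxP V).1.
apply: smooth_congr H => x Ux.
by rewrite -(Ck1_derive_sum _ oU (sf 1%N)).
Qed.

Lemma smooth_comp n p q (V : set 'rV[R]_n) (F : 'rV[R]_m -> 'rV[R]_n)
  (G : 'rV[R]_n -> 'M[R]_(p, q)) :
  open V -> (forall x, U x -> V (F x)) ->
  smooth_on U F -> smooth_on V G -> smooth_on U (fun x => G (F x)).
Proof.
move=> oV FUV sF sG; apply/smooth_mxP => i j k.
exact: (Ck_comp (g := fun y => G y i j) oU oV FUV (sF k) ((Ck_mxP k G oV).1 (sG k) i j)).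
Qed.

End smooth.

(** * Product and chain rules for directional derivatives *)

Section derivative_rules.
Variables (R : realType) (m : nat).

Lemma derivable_mulmx p q r (A : 'rV[R]_m -> 'M[R]_(p, q)) (B : 'rV[R]_m -> 'M[R]_(q, r)) x v :
  derivable A x v -> derivable B x v -> 
  is_derive x v (fun y => A y *m B y) ('D_v A x *m B x + A x *m 'D_v B x).
Proof.
move=> dA dB; have dAe := (derivable_mxP _ _ _).1 dA; have dBe := (derivable_mxP _ _ _).1 dB.
have He i j : is_derive x v (fun y => (A y *m B y) i j)
    (\sum_k (A x i k *: 'D_v (fun y => B y k j) x + B x k j *: 'D_v (fun y => A y i k) x)).
  rewrite (_ : (fun y => _) = \sum_k ((fun y => A y i k) * (fun y => B y k j))).
    apply: is_derive_sum => k; apply: is_deriveM; exact: derivableP.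
  by rewrite funeqE => y; rewrite fct_sumE mxE.
have dAB : derivable (fun y => A y *m B y) x v.
  by apply/derivable_mxP => i j; exact: (@ex_derive _ _ _ _ _ _ _ (He i j)).
apply: DeriveDef => //; rewrite derive_mx //; apply/matrixP => i j; rewrite !mxE.
rewrite (@derive_val _ _ _ _ _ _ _ (He i j)) -big_split; apply: eq_bigr => k _ /=.
by rewrite (derive_mx dA) (derive_mx dB) !mxE addrC [B x k j *: _]mulrC.
Qed.

Lemma derive_mulmx p q r (A : 'rV[R]_m -> 'M[R]_(p, q)) (B : 'rV[R]_m -> 'M[R]_(q, r)) x v :
  derivable A x v -> derivable B x v -> 
  'D_v (fun y => A y *m B y) x = 'D_v A x *m B x + A x *m 'D_v B x.
Proof. by move=> dA dB; have [_ ->] := derivable_mulmx dA dB. Qed.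

Lemma derive_mulmxl p q r (A : 'rV[R]_m -> 'M[R]_(p, q)) (B : 'M[R]_(q, r)) x v :
  derivable A x v -> 'D_v (fun y => A y *m B) x = 'D_v A x *m B.
Proof.
move=> dA; have := @derive_mulmx _ _ _ A (cst B) x v dA (derivable_cst _ _ _).
by rewrite derive_cst mulmx0 addr0.
Qed.

Lemma derive_mulmxr p q r (A : 'M[R]_(p, q)) (B : 'rV[R]_m -> 'M[R]_(q, r)) x v :
  derivable B x v -> 'D_v (fun y => A *m B y) x = A *m 'D_v B x.
Proof.
move=> dB; have := @derive_mulmx _ _ _ (cst A) B x v (derivable_cst _ _ _) dB.
by rewrite derive_cst mul0mx add0r.
Qed.

Lemma derive_trmx p q (A : 'rV[R]_m -> 'M[R]_(p, q)) x v :
  derivable A x v -> 'D_v (fun y => (A y)^T) x = ('D_v A x)^T.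
Proof.
move=> dA; have dAe := (derivable_mxP _ _ _).1 dA.
have dT : derivable (fun y => (A y)^T) x v.
  apply/derivable_mxP => i j; rewrite (_ : (fun y => _) = (fun y => A y j i)) //.
  by rewrite funeqE => y; rewrite mxE.
rewrite (derive_mx dT) (derive_mx dA); apply/matrixP => i j; rewrite !mxE.
by congr ('D_v _ x); rewrite funeqE => y; rewrite mxE.
Qed.

Lemma derive_coord p q (A : 'rV[R]_m -> 'M[R]_(p, q)) x v i j :
  derivable A x v -> 'D_v (fun y => A y i j) x = ('D_v A x) i j.
Proof. by move=> dA; rewrite (derive_mx dA) mxE. Qed.

Lemma derive_scale p q (f : 'rV[R]_m -> R) (A : 'rV[R]_m -> 'M[R]_(p, q)) x v :
  derivable f x v -> derivable A x v ->
  'D_v (fun y => f y *: A y) x = 'D_v f x *: A x + f x *: 'D_v A x.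
Proof.
move=> df dA; have dAe := (derivable_mxP _ _ _).1 dA.
have He i j : is_derive x v (fun y => (f y *: A y) i j)
    (f x *: 'D_v (fun y => A y i j) x + A x i j *: 'D_v f x).
  rewrite (_ : (fun y => _) = f * (fun y => A y i j)).
    apply: is_deriveM; exact: derivableP.
  by rewrite funeqE => y; rewrite mxE.
have dfA : derivable (fun y => f y *: A y) x v.
  by apply/derivable_mxP => i j; exact: (@ex_derive _ _ _ _ _ _ _ (He i j)).
rewrite derive_mx //; apply/matrixP => i j; rewrite !mxE.
by rewrite (@derive_val _ _ _ _ _ _ _ (He i j)) (derive_mx dA) !mxE addrC [A x i j *: _]mulrC.
Qed.

Lemma derive_comp n (W : normedModType R) (F : 'rV[R]_m -> 'rV[R]_n)
  (G : 'rV[R]_n -> W) x v :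
  differentiable F x -> differentiable G (F x) ->
  'D_v (fun y => G (F y)) x = 'D_('D_v F x) G (F x).
Proof.
move=> dF dG; rewrite [LHS]deriveE; last exact: (@differentiable_comp _ _ _ _ F G).
by rewrite (diff_comp dF dG) /= -deriveE // -deriveE.
Qed.

Lemma derive_is_linear (W : normedModType R) (F : 'rV[R]_m -> W) x :
  differentiable F x -> linear (fun v => 'D_v F x).
Proof. by move=> dF a u v; rewrite !deriveE // linearP. Qed.

Lemma derive_lincomb (W : normedModType R) (F : 'rV[R]_m -> W) x
  (I : Type) (r : seq I) (P : pred I) (a : I -> R) (v : I -> 'rV[R]_m) :
  differentiable F x ->
  'D_(\sum_(i <- r | P i) a i *: v i) F x = \sum_(i <- r | P i) a i *: 'D_(v i) F x.
Proof.
move=> dF; rewrite deriveE // linear_sum; apply: eq_bigr => i _.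
by rewrite linearZ -deriveE.
Qed.

End derivative_rules.

(** * Symmetry of second derivatives *)

Lemma is_derive_translate (R : realType) (V W : normedModType R) (f : V -> W) (a x v : V) :
  derivable f (a + x) v -> is_derive x v (fun y => f (a + y)) ('D_v f (a + x)).
Proof.
move=> df.
have E : (fun h : R => h^-1 *: (((fun y => f (a + y)) \o shift x) (h *: v) - f (a + x)))
       = (fun h => h^-1 *: ((f \o shift (a + x)) (h *: v) - f (a + x))).
  by rewrite funeqE => h /=; rewrite addrCA.
by apply: DeriveDef; rewrite /derivable /derive E.
Qed.

(** The mean value theorem is used twice: in direction u for the difference y |-> f (t v + y) - f y,
    then in direction v for the derivative of f along u. *)
Lemma second_difference (R : realType) m (U : set 'rV[R]_m) (f : 'rV[R]_m -> R) (x u v : 'rV[R]_m) (t r : R) :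
  Ck 2 U f -> ball x r `<=` U -> 0 < t ->
  `|t *: u| < r / 2 -> `|t *: v| < r / 2 ->
  exists2 y, ball x r y &
    f (t *: v + (t *: u + x)) - f (t *: u + x) - (f (t *: v + x) - f x)
    = t * (t * 'D_v (fun z => 'D_u f z) y).
Proof.
move=> [cf df] xrU t0 tu tv.
have dil (s : R) w : s \in `[0, 1] -> `|t *: w| < r / 2 -> `|s *: (t *: w)| < r / 2.
  rewrite in_itv /= => /andP[s0 s1]; apply: le_lt_trans.
  by rewrite normrZ ger0_norm //; exact: ler_piMl.
have one : (1 : R) \in `[0, 1] by rewrite in_itv /= ler01 lexx.
have zero : (0 : R) \in `[0, 1] by rewrite in_itv /= ler01 lexx.
have sB (s s' : R) : s \in `[0, 1] -> s' \in `[0, 1] ->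
    ball x r (s' *: (t *: v) + (s *: (t *: u) + x)).
  move=> s01 s01'; rewrite -ball_normE /= distrC addrA addrK.
  by apply: le_lt_trans (ler_normD _ _) _; rewrite (splitr r) ltrD // dil.
pose phi y := f (t *: v + y) - f y.
have dphi s : s \in `[0, 1] -> is_derive (s *: (t *: u) + x) (t *: u) phi
    (t * ('D_u f (t *: v + (s *: (t *: u) + x)) - 'D_u f (s *: (t *: u) + x))).
  move=> s01; rewrite mulrBr.
  have B1 := sB _ _ s01 one; have B0 := sB _ _ s01 zero.
  rewrite scale1r in B1; rewrite scale0r add0r in B0.
  have d1 := derivable_scale t ((df u).1 _ (xrU _ B1)).
  have d0 := derivable_scale t ((df u).1 _ (xrU _ B0)).
  have [d1' <-] := d1; have d1'' := is_derive_translate d1'.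
  exact: (is_deriveB d1'' d0).
have dphi' s : s \in `[0, 1] -> derivable phi (s *: (t *: u) + x) (t *: u).
  by move=> /dphi [].
have [s s01] := MVT_line dphi'; have [_ ->] := dphi _ s01.
set z := s *: (t *: u) + x => E1.
have d2 s' : s' \in `[0, 1] -> derivable (fun y => 'D_u f y) (s' *: (t *: v) + z) (t *: v).
  move=> s01'; have B := xrU _ (sB _ _ s01 s01').
  by have [_ [_ /(_ v)[/(_ _ B) H _]]] := df u; have [] := derivable_scale t H.
have [s' s01' E2] := MVT_line d2.
have B := sB _ _ s01 s01'.
exists (s' *: (t *: v) + z) => //.
have [_ [_ /(_ v)[/(_ _ (xrU _ B)) H _]]] := df u.
have [_ H2] := derivable_scale t H.
by rewrite -H2 -E2 -E1.
Qed.

Lemma dist_le_split (R : realType) (a b c e : R) :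
  `|a - c| < e / 2 -> `|b - c| < e / 2 -> `|a - b| <= e.
Proof. rewrite !ltr_norml ler_norml => /andP[? ?] /andP[? ?]; lra. Qed.

(** The second difference is symmetric in u and v, so the two mixed derivatives agree at two points
    of a small ball around x; both are continuous at x. *)
Lemma Ck2_derive_comm (R : realType) m (U : set 'rV[R]_m) (f : 'rV[R]_m -> R) (x u v : 'rV[R]_m) :
  open U -> Ck 2 U f -> U x ->
  'D_u (fun z => 'D_v f z) x = 'D_v (fun z => 'D_u f z) x.
Proof.
move=> oU Cf Ux; apply/eqP; rewrite -subr_eq0 -normr_le0; apply/ler_addgt0Pl => e e0.
rewrite addr0; have e2 : 0 < e / 2 by rewrite divr_gt0.
have [r1 r10 r1P] := Ck1_ball u oU (Cf.2 v).2 Ux e2.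
have [r2 r20 r2P] := Ck1_ball v oU (Cf.2 u).2 Ux e2.
pose r := Num.min r1 r2.
have r0 : 0 < r by rewrite lt_min r10.
have rP1 y : ball x r y -> ball x r1 y by apply: le_ball; rewrite ge_min lexx.
have rP2 y : ball x r y -> ball x r2 y by apply: le_ball; rewrite ge_min lexx orbT.
have rU : ball x r `<=` U by move=> y /rP1 /r1P [].
pose t := r / 2 / (1 + `|u| + `|v|).
have den : 0 < 1 + `|u| + `|v| by rewrite -addrA ltr_pwDl // addr_ge0.
have t0 : 0 < t by rewrite !divr_gt0.
have small w : `|w| < 1 + `|u| + `|v| -> `|t *: w| < r / 2.
  move=> wD; rewrite normrZ gtr0_norm // /t mulrAC ltr_pdivrMr // ltr_pM2l //.
  by rewrite divr_gt0.
have tu : `|t *: u| < r / 2.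
  by apply: small; rewrite addrAC ltr_pwDl // ltr_pwDl.
have tv : `|t *: v| < r / 2 by apply: small; rewrite ltr_pwDl // ltr_pwDl.
have [y1 B1 E1] := second_difference Cf rU t0 tu tv.
have [y2 B2 E2] := second_difference Cf rU t0 tv tu.
have E : 'D_v (fun z => 'D_u f z) y1 = 'D_u (fun z => 'D_v f z) y2.
  apply: (mulfI (lt0r_neq0 t0)); apply: (mulfI (lt0r_neq0 t0)).
  have E3 : t *: u + (t *: v + x) = t *: v + (t *: u + x) by exact: addrCA.
  rewrite E3 in E2; apply: (etrans (esym E1)); apply: (etrans _ E2).
  by ring.
have [_ H1] := r1P _ (rP1 _ B2); have [_ H2] := r2P _ (rP2 _ B1).
rewrite E in H2; exact: dist_le_split H1 H2.
Qed.

Lemma smooth_derive_comm (R : realType) m (U : set 'rV[R]_m) p q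
  (F : 'rV[R]_m -> 'M[R]_(p, q)) (x u v : 'rV[R]_m) :
  open U -> smooth_on U F -> U x ->
  'D_u (fun z => 'D_v F z) x = 'D_v (fun z => 'D_u F z) x.
Proof.
move=> oU sF Ux; have sFe := (smooth_mxP oU F).1 sF.
have H (w w' : 'rV[R]_m) : 'D_w (fun z => 'D_w' F z) x
    = \matrix_(i, j) 'D_w (fun z => 'D_w' (fun y => F y i j) z) x.
  rewrite derive_mx; last exact: (smooth_derivable (smooth_derive _ sF)).
  apply/matrixP => i j; rewrite !mxE; apply: near_eq_derive.
  near=> y; rewrite derive_coord //; apply: (smooth_derivable sF).
  by near: y; exact: open_nbhs_nbhs.
apply: etrans (H u v) _; apply: etrans _ (esym (H v u)).
apply/matrixP => i j; rewrite [LHS]mxE [RHS]mxE.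
exact: (Ck2_derive_comm u v oU (sFe i j 2%N)).
Unshelve. all: by end_near. Qed.

Lemma derive_congr (R : realType) m (U : set 'rV[R]_m) (W : normedModType R)
  (f g : 'rV[R]_m -> W) x v :
  open U -> U x -> (forall y, U y -> f y = g y) -> 'D_v f x = 'D_v g x.
Proof.
move=> oU Ux fg; apply: near_eq_derive; near=> y; apply: fg.
by near: y; exact: open_nbhs_nbhs.
Unshelve. all: by end_near. Qed.

Lemma smooth_sub_set (R : realType) m (U V : set 'rV[R]_m) (W : normedModType R)
  (f : 'rV[R]_m -> W) : V `<=` U -> smooth_on U f -> smooth_on V f.
Proof. by move=> VU sf k; exact: Ck_sub VU (sf k). Qed.

Lemma derive0_ball (R : realType) m (f : 'rV[R]_m -> R) x (r : R) :
  (forall y, ball x r y -> forall v, derivable f y v /\ 'D_v f y = 0) ->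
  forall y, ball x r y -> f y = f x.
Proof.
move=> H y xry.
have yx : `|y - x| < r by move: xry; rewrite -ball_normE /= distrC.
have d t : t \in `[0, 1] -> derivable f (t *: (y - x) + x) (y - x).
  by move=> t01; have [] := H _ (segment_ball x yx t01) (y - x).
have [t t01] := MVT_line d; rewrite subrK (H _ (segment_ball x yx t01) _).2.
by move/eqP; rewrite subr_eq0 => /eqP.
Qed.

(** * The ordinary differential system *)

Section relations.
Variables (R : realType) (m : nat).

(* With [m = n - 1] and [t = mu / a], the derivatives along [e_1] are
   [t' = b N(t) / q(t)], [a' = - 2 m t a b / q(t)] and [b' = - b^2 - eps - a^2 s(t)]. *)
Definition qpol : {poly R} := 3%:P - (2 * m%:R)%:P * 'X.
Definition Npoly : {poly R} := (1 - m%:R%:P * 'X) * (3%:P - (2 * (m%:R + 3))%:P * 'X).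
Definition spoly : {poly R} := (1 - (m%:R + 1)%:P * 'X) * 'X.

(* Coefficients of a relation [A(t) b^2 + B(t) a^2 + C(t) eps = 0]. *)
Definition relation3 : Type := ({poly R} * {poly R} * {poly R})%type.

Definition rel_val (r : relation3) (t b a eps : R) : R :=
  r.1.1.[t] * b ^+ 2 + r.1.2.[t] * a ^+ 2 + r.2.[t] * eps.

(* The derivative along [e_1] of the tangential part [(3 a - 2 m mu) a' = - 2 m a mu b] of the
   biharmonic equation, where [a''] is eliminated by the normal part. *)
Definition rel0 : relation3 :=
  (- (6 * m%:R)%:P * Npoly + (2 * m%:R)%:P * 'X * qpol ^+ 2
   + (4 * m%:R ^+ 2)%:P * 'X ^+ 2 * qpol
   - (2 * m%:R ^+ 2)%:P * 'X * qpol ^+ 2 - m%:R%:P * qpol ^+ 3,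
   ((2 * m%:R)%:P * 'X * spoly
    - qpol * ((1 - m%:R%:P * 'X) ^+ 2 + m%:R%:P * 'X ^+ 2)) * qpol ^+ 2,
   ((2 * m%:R)%:P * 'X + (m%:R + 4)%:P * qpol) * qpol ^+ 2).

(* [q / b] times the derivative of a relation along [e_1]. *)
Definition next_rel (r : relation3) : relation3 :=
  (Npoly * r.1.1^`() - 2%:P * qpol * r.1.1,
   Npoly * r.1.2^`() - (4 * m%:R)%:P * 'X * r.1.2 - 2%:P * qpol * spoly * r.1.1,
   Npoly * r.2^`() - 2%:P * qpol * r.1.1).

Definition rel_det (r r' r'' : relation3) : {poly R} :=
  r.1.1 * (r'.1.2 * r''.2 - r''.1.2 * r'.2)
  - r'.1.1 * (r.1.2 * r''.2 - r''.1.2 * r.2)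
  + r''.1.1 * (r.1.2 * r'.2 - r'.1.2 * r.2).

(** Cramer's rule for the a^2 coordinate of the solution (b^2, a^2, eps): expansion along the second
    column gives the determinant times a^2. *)
Lemma rel_det_mul (r r' r'' : relation3) (t b a eps : R) :
  rel_val r t b a eps = 0 -> rel_val r' t b a eps = 0 ->
  rel_val r'' t b a eps = 0 -> a != 0 -> (rel_det r r' r'').[t] = 0.
Proof.
rewrite /rel_val /rel_det => H H' H'' a0.
apply: (mulIf (expf_neq0 2 a0)); rewrite mul0r !(hornerD, hornerN, hornerM).
move: H H' H''.
set x1 := _.[t]; set x2 := _.[t]; set x3 := _.[t].
set y1 := _.[t]; set y2 := _.[t]; set y3 := _.[t].
set z1 := _.[t]; set z2 := _.[t]; set z3 := _.[t].
move=> H H' H''.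
transitivity (- (y1 * z3 - z1 * y3) * (x1 * b ^+ 2 + x2 * a ^+ 2 + x3 * eps)
  + (x1 * z3 - z1 * x3) * (y1 * b ^+ 2 + y2 * a ^+ 2 + y3 * eps)
  - (x1 * y3 - y1 * x3) * (z1 * b ^+ 2 + z2 * a ^+ 2 + z3 * eps)); last first.
  by rewrite H H' H''; ring.
ring.
Qed.

Lemma qpolE (t : R) : qpol.[t] = 3 - 2 * m%:R * t.
Proof. by rewrite /qpol !hornerE. Qed.

Lemma NpolyE (t : R) : Npoly.[t] = (1 - m%:R * t) * (3 - 2 * (m%:R + 3) * t).
Proof. by rewrite /Npoly !hornerE. Qed.

Lemma spolyE (t : R) : spoly.[t] = (1 - (m%:R + 1) * t) * t.
Proof. by rewrite /spoly !hornerE. Qed.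

Lemma next_relE r (t : R) :
  [/\ (next_rel r).1.1.[t] = Npoly.[t] * r.1.1^`().[t] - 2 * qpol.[t] * r.1.1.[t],
  (next_rel r).1.2.[t] = Npoly.[t] * r.1.2^`().[t] - 4 * m%:R * t * r.1.2.[t]
     - 2 * qpol.[t] * spoly.[t] * r.1.1.[t] &
  (next_rel r).2.[t] = Npoly.[t] * r.2^`().[t] - 2 * qpol.[t] * r.1.1.[t]].
Proof. by split; rewrite !hornerE. Qed.

Lemma rel0E (t : R) : let q := qpol.[t] in let M := m%:R in
  [/\ rel0.1.1.[t] = - (6 * M) * Npoly.[t] + 2 * M * t * q ^+ 2
   + 4 * M ^+ 2 * t ^+ 2 * q - 2 * M ^+ 2 * t * q ^+ 2 - M * q ^+ 3,
   rel0.1.2.[t] = (2 * M * t * spoly.[t] - q * ((1 - M * t) ^+ 2 + M * t ^+ 2)) * q ^+ 2 &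
   rel0.2.[t] = (2 * M * t + (M + 4) * q) * q ^+ 2].
Proof. by split; rewrite /rel0 /= !(hornerE, horner_exp). Qed.

(** At a root of N, adding 2 q times a relation (A, B, C) to the next one eliminates b^2. Up to sign
    and nonzero constants, the last factor is the remaining coefficient of a^2, and q (C - A) is
    that of eps. *)
Definition resultant_value (A B C q s M t : R) : R :=
  (C - A) * A * (q * s * A - (q - 2 * M * t) * B).

Lemma rel_detE (r r' r'' : relation3) (t : R) :
  (rel_det r r' r'').[t] =
  r.1.1.[t] * (r'.1.2.[t] * r''.2.[t] - r''.1.2.[t] * r'.2.[t])
  - r'.1.1.[t] * (r.1.2.[t] * r''.2.[t] - r''.1.2.[t] * r.2.[t])
  + r''.1.1.[t] * (r.1.2.[t] * r'.2.[t] - r'.1.2.[t] * r.2.[t]).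
Proof. by rewrite /rel_det !(hornerD, hornerN, hornerM). Qed.

(** Where N vanishes, [next_rel] acts on the three values A, B, C without their derivatives, so all
    rows are explicit in the first one. *)
Lemma rel_det_root (r : relation3) (t : R) : Npoly.[t] = 0 ->
  let q := qpol.[t] in
  (rel_det r (next_rel r) (next_rel (next_rel r))).[t]
  = - (16 * m%:R * t * q) *
    resultant_value r.1.1.[t] r.1.2.[t] r.2.[t] q spoly.[t] m%:R t.
Proof.
move=> N0 /=; rewrite /resultant_value rel_detE.
have [-> -> ->] := next_relE (next_rel r) t.
have [-> -> ->] := next_relE r t.
rewrite N0; move: r.1.1.[t] r.1.2.[t] r.2.[t] qpol.[t] spoly.[t] => A B C q s; ring.
Qed.
End relations.

(** * The first relation at the two roots of N *)

Section root_values.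
Variables (R : realType) (m : nat).
Hypothesis m0 : (0 < m)%N.
Local Notation M := (m%:R : R).
Local Notation r0 := (rel0 R m).

Let Mpos : 0 < M. Proof. by rewrite ltr0n. Qed.
Let M0 : M != 0. Proof. exact: lt0r_neq0. Qed.
Let M3 : M + 3 != 0. Proof. by rewrite lt0r_neq0 // addr_gt0. Qed.

Lemma root_cases (t : R) : (Npoly R m).[t] = 0 -> t = M^-1 \/ t = 3 / (2 * (M + 3)).
Proof.
rewrite NpolyE => /eqP; rewrite mulf_eq0 => /orP[|] /eqP H; [left|right].
  by apply: (mulfI M0); rewrite mulfV //; lra.
have M32 : 2 * (M + 3) != 0 by rewrite mulf_neq0.
apply: (mulfI M32); rewrite mulrCA mulfV //; lra.
Qed.

Lemma values_first_root : let t := M^-1 in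
  [/\ (Npoly R m).[t] = 0, (qpol R m).[t] = 1, r0.1.1.[t] = 6 - 3 * M,
     r0.1.2.[t] = - ((M + 2) / M ^+ 2) /\ r0.2.[t] = M + 6 &
  (qpol R m).[t] * (spoly R m).[t] * r0.1.1.[t]
    - ((qpol R m).[t] - 2 * M * t) * r0.1.2.[t] = 2 * (M - 4) / M ^+ 2].
Proof.
have q1 : (qpol R m).[M^-1] = 1 by rewrite qpolE -mulrA mulfV //; ring.
have N0 : (Npoly R m).[M^-1] = 0 by rewrite NpolyE mulfV // subrr mul0r.
have [E1 E2 E3] := rel0E m M^-1.
rewrite /= q1 N0 in E1 E2 E3 *; split=> //.
- by rewrite E1; field.
- by rewrite E2 E3 spolyE; split; field.
- by rewrite E1 E2 spolyE; field.
Qed.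

Lemma values_second_root : let t := 3 / (2 * (M + 3)) in let q := 9 / (M + 3) in
  [/\ (Npoly R m).[t] = 0, (qpol R m).[t] = q, r0.1.1.[t] = - (18 * M * q / (M + 3)),
     r0.1.2.[t] = - (9 / 2 * (M ^+ 2 - 3 * M + 18) / (M + 3) ^+ 3 * q ^+ 2) &
     r0.2.[t] = (12 * M + 36) / (M + 3) * q ^+ 2].
Proof.
move=> t q; have qE : (qpol R m).[t] = q by rewrite qpolE /t /q; field.
have N0 : (Npoly R m).[t] = 0 by rewrite NpolyE /t; field.
have [E1 E2 E3] := rel0E m t.
rewrite /= qE N0 in E1 E2 E3 *; split=> //.
- by rewrite E1 /t /q; field.
- by rewrite E2 spolyE /t /q; field.
- by rewrite E3 /t /q; field.
Qed.

(* The determinant is nonzero at the root [1 / m] of [N], except for [m = 2, 4], when it is nonzero at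
   the other root. *)
Lemma rel_det_neq0 :
  rel_det r0 (next_rel m r0) (next_rel m (next_rel m r0)) != 0.
Proof.
have [H1 H2 H3 [_ H4] H5] := values_first_root.
have [m24|m24] := boolP ((m == 2) || (m == 4))%N; last first.
  apply/eqP => /(congr1 (horner^~ M^-1)); rewrite rel_det_root // horner0.
  rewrite /resultant_value H5 H3 H4 H2 => /eqP; apply/negP.
  rewrite !(mulf_eq0, oppr_eq0, invr_eq0, expf_eq0) -!orbA !pnatr_eq0 oner_eq0 /=.
  rewrite (gtn_eqF m0) /= orbF !negb_or.
  move: m24; rewrite negb_or => /andP[m2 m4]; apply/and3P; split.
  - by apply: lt0r_neq0; move: Mpos; move: M => x; lra.
  - have : M != 2 by rewrite (eqr_nat _ _ 2).
    by apply: contra_neq; move: M => x; lra.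
  - have : M != 4 by rewrite (eqr_nat _ _ 4).
    by apply: contra_neq; move: M => x; lra.
have [N0 qE AE BE CE] := values_second_root.
set t := 3 / _ in N0 qE AE BE CE.
(* At the second root the only factor of the determinant that can vanish is (3 - m)^2. *)
have m3 : M != 3 by rewrite (eqr_nat _ _ 3); case/orP: m24 => /eqP ->.
apply/eqP => /(congr1 (horner^~ t)); rewrite rel_det_root // horner0 /resultant_value.
rewrite qE AE BE CE spolyE /t => /eqP; apply/negP.
move: M Mpos M0 M3 m3 => x x0 xn0 x3 x3'.
have x3'' : 3 - x != 0 by rewrite subr_eq0 eq_sym.
have x6 : 108 + 18 * x != 0 by apply: lt0r_neq0; lra.
have n (k : nat) : (k.+1%:R : R) != 0 by rewrite pnatr_eq0.
rewrite (_ : - _ * _ = 16 * x * (3 / (2 * (x + 3))) * (9 / (x + 3)) *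
  ((9 / (x + 3)) * (108 + 18 * x) / (x + 3)) * (18 * x * (9 / (x + 3)) / (x + 3)) *
  (6561 * (3 - x) ^+ 2 / (x + 3) ^+ 6)); last by field.
by rewrite !(mulf_neq0, invr_neq0, expf_neq0) ?n.
Qed.

(** At the root 1 / m the vanishing coefficient of a^2 forces m = 4. At both roots C - A is then
    positive, so eps = 0, and the relation becomes a sum of a nonpositive multiple of b^2 and a
    negative multiple of a^2. *)
Lemma no_stationary_root (t b a eps : R) : (Npoly R m).[t] = 0 -> a != 0 ->
  rel_val r0 t b a eps = 0 ->
  (qpol R m).[t] * (spoly R m).[t] * r0.1.1.[t]
    - ((qpol R m).[t] - 2 * M * t) * r0.1.2.[t] = 0 ->
  (r0.2.[t] - r0.1.1.[t]) * eps = 0 -> False.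
Proof.
move=> N0 a0; rewrite /rel_val.
have a2 : 0 < a ^+ 2 by rewrite exprn_even_gt0.
have b2 : 0 <= b ^+ 2 by rewrite sqr_ge0.
have [->|->] := root_cases N0.
  have [_ _ -> [-> ->] ->] := values_first_root.
  move=> + /eqP; rewrite mulf_eq0 invr_eq0 expf_eq0 (negbTE M0) andbF orbF.
  rewrite mulf_eq0 pnatr_eq0 subr_eq0 /= => + /eqP M4; rewrite M4.
  move=> H /eqP; rewrite mulf_eq0 => /orP[/eqP|/eqP eps0]; first by move=> ?; lra.
  by move: H; rewrite eps0 => H; lra.
have [_ _ -> -> ->] := values_second_root.
move: M Mpos M0 M3 => x x0 xn0 x3.
have [y y0 <-] : exists2 y : R, 0 < y & y = (x + 3)^-1.
  by exists (x + 3)^-1 => //; rewrite invr_gt0; lra.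
move=> H _ /eqP; rewrite mulf_eq0 => /orP[/eqP K|/eqP eps0].
  have : 0 < (12 * x + 36) * y * (9 * y) ^+ 2 - - (18 * x * (9 * y) * y).
    by rewrite opprK addr_gt0 // !mulr_gt0 // ?exprn_gt0 ?mulr_gt0 // addr_gt0 // mulr_gt0.
  by rewrite K ltxx.
move: H; rewrite eps0 mulr0 addr0 => /eqP; apply/negP/ltr0_neq0.
rewrite -oppr_gt0 opprD; apply: ltr_wpDl.
  by rewrite -mulNr opprK mulr_ge0 // !mulr_ge0 // ltW.
rewrite -mulNr opprK mulr_gt0 // mulr_gt0 ?exprn_gt0 ?mulr_gt0 //.
  by have : 0 <= (x - 3 / 2) ^+ 2; [rewrite sqr_ge0|nra].
by rewrite invr_gt0 exprn_gt0 // addr_gt0.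
Qed.
End root_values.

(** * Derivatives of scalar functions and of polynomials in them *)

Section scalar_rules.
Variables (R : realType) (n : nat).
Implicit Types (f g : 'rV[R]_n -> R) (x v : 'rV[R]_n).

Lemma derive_mulR f g x v : derivable f x v -> derivable g x v ->
  'D_v (fun y => f y * g y) x = 'D_v f x * g x + f x * 'D_v g x.
Proof.
move=> df dg; apply: etrans (deriveM df dg) _.
by rewrite addrC; congr (_ + _); exact: mulrC.
Qed.

Lemma derive_addR f g x v : derivable f x v -> derivable g x v ->
  'D_v (fun y => f y + g y) x = 'D_v f x + 'D_v g x.
Proof. by move=> df dg; exact: (deriveD df dg). Qed.

Lemma derive_scaleR (c : R) f x v : derivable f x v ->
  'D_v (fun y => c * f y) x = c * 'D_v f x.
Proof.
move=> df; have := derive_mulR (derivable_cst c x v) df.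
by rewrite derive_cst mul0r add0r.
Qed.

Lemma derivable_mulR f g x v : derivable f x v -> derivable g x v ->
  derivable (fun y => f y * g y) x v.
Proof. by move=> df dg; exact: derivableM df dg. Qed.

Lemma derivable_addR f g x v : derivable f x v -> derivable g x v ->
  derivable (fun y => f y + g y) x v.
Proof. by move=> df dg; exact: derivableD df dg. Qed.

Lemma derivable_scaleR (c : R) f x v : derivable f x v -> derivable (fun y => c * f y) x v.
Proof. by move=> df; exact: derivable_mulR (derivable_cst c x v) df. Qed.

Lemma derivable_sqr f x v : derivable f x v ->
  is_derive x v (fun y => f y ^+ 2) (2 * f x * 'D_v f x).
Proof.
move=> df; have E : 'D_v (fun y => f y ^+ 2) x = 2 * f x * 'D_v f x.
  by apply: etrans (derive_mulR df df) _; ring.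
exact: DeriveDef (derivable_mulR df df) E.
Qed.

Lemma derivable_horner_comp (p : {poly R}) f x v : derivable f x v ->
  is_derive x v (fun y => p.[f y]) (p^`().[f x] * 'D_v f x).
Proof.
move=> df; elim/poly_ind: p => [|p c IH].
  rewrite deriv0 horner0 mul0r (_ : (fun y => _) = cst 0); first exact: is_derive_cst.
  by rewrite funeqE => y; rewrite horner0.
have [dp Ep] := IH.
have d1 : derivable (fun y => p.[f y] * f y) x v := derivableM dp df.
have d2 : derivable (fun y => p.[f y] * f y + c) x v := derivableD d1 (derivable_cst c x v).
have E : 'D_v (fun y => p.[f y] * f y + c) x = (p * 'X + c%:P)^`().[f x] * 'D_v f x.
  rewrite (derive_addR d1 (derivable_cst c x v)) derive_cst addr0 (derive_mulR dp df) Ep.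
  by rewrite derivMXaddC hornerD hornerM hornerX; ring.
rewrite (_ : (fun y => _) = (fun y => p.[f y] * f y + c)); first exact: DeriveDef d2 E.
by rewrite funeqE => y; rewrite hornerMXaddC.
Qed.

Lemma open_neq0 (U : set 'rV[R]_n) f : open U -> smooth_on U f ->
  open (U `&` [set x | f x != 0]).
Proof.
move=> oU sf; rewrite openE => x [Ux fx]; rewrite /interior.
near=> y; split; first by near: y; exact: open_nbhs_nbhs.
near: y; have [cf _] := sf 0%N.
have := cf x Ux; move/cvgrPdist_lt => /(_ `|f x|); rewrite normr_gt0 => /(_ fx).
apply: filterS => y; rewrite /=; apply: contraPneq => ->.
by rewrite subr0 ltxx.
Unshelve. all: by end_near. Qed.

Lemma deriv_eq0 (p : {poly R}) : p^`() = 0 -> p = (p`_0)%:P.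
Proof.
move=> p0; apply/polyP => -[|i]; rewrite coefC //=.
have := congr1 (fun r : {poly R} => r`_i) p0; rewrite coef_deriv coef0 => /eqP.
by rewrite mulrn_eq0 /= => /eqP.
Qed.

(** Differentiating p.[t] = 0 along e and cancelling the derivative of t shows that p^[() vanishes
    on the same values. By induction on the size p^]() = 0, and p is a constant that is zero at
    x0. *)
Lemma poly_vanish (U : set 'rV[R]_n) (e : 'rV[R]_n -> 'rV[R]_n) (t : 'rV[R]_n -> R)
  (p : {poly R}) x0 : open U -> U x0 -> smooth_on U t ->
  (forall x, U x -> 'D_(e x) t x != 0) -> (forall x, U x -> p.[t x] = 0) -> p = 0.
Proof.
move=> oU Ux0 st Dt; move: {2}(size p) (leqnn (size p)) => k.
elim: k p => [|k IH] p; first by rewrite leqn0 size_poly_eq0 => /eqP.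
move=> sp pt; have [->//|pn0] := eqVneq p 0.
have dp0 : p^`() = 0.
  apply: IH; first by rewrite -ltnS; apply: leq_trans (lt_size_deriv pn0) sp.
  move=> x Ux; apply: (mulIf (Dt x Ux)); rewrite mul0r.
  have [_ <-] := derivable_horner_comp p (smooth_derivable (v := e x) st Ux).
  rewrite (derive_congr (g := cst 0) _ oU Ux pt); exact: derive_cst.
by have := pt x0 Ux0; rewrite (deriv_eq0 dp0) hornerC => ->.
Qed.

End scalar_rules.

Lemma derive_vanishing (R : realType) n (U : set 'rV[R]_n) (e : 'rV[R]_n -> 'rV[R]_n) 
  (g : 'rV[R]_n -> R) : open U ->
  (forall x, U x -> g x = 0) -> forall x, U x -> 'D_(e x) g x = 0.
Proof.
by move=> oU g0 x Ux; rewrite (derive_congr (g := cst 0) _ oU Ux g0); exact: derive_cst.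
Qed.

(** * From the differential system to a contradiction *)

Section ode.
Variables (R : realType) (n m : nat) (eps : R) (e : 'rV[R]_n -> 'rV[R]_n).
Hypothesis m0 : (0 < m)%N.
Local Notation M := (m%:R : R).
Local Notation D f x := ('D_(e x) f x).

Section logarithmic.
Variables (U : set 'rV[R]_n) (a t b : 'rV[R]_n -> R).
Hypotheses (oU : open U) (se : smooth_on U e) (sa : smooth_on U a) (st : smooth_on U t) (sb : smooth_on U b).
Hypotheses (a0 : forall x, U x -> a x != 0) (b0 : forall x, U x -> b x != 0)
  (t0 : forall x, U x -> t x != 0) (q0 : forall x, U x -> (qpol R m).[t x] != 0).
Hypothesis Dt : forall x, U x -> D t x = b x * (Npoly R m).[t x] / (qpol R m).[t x].
Hypothesis Da : forall x, U x -> D a x = - 2 * M * t x * a x * b x / (qpol R m).[t x].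
Hypothesis Db : forall x, U x ->
  D b x = - b x ^+ 2 - eps - a x ^+ 2 * (spoly R m).[t x].

Lemma rel_val_next (r : relation3 R) :
  (forall x, U x -> rel_val r (t x) (b x) (a x) eps = 0) ->
  forall x, U x -> rel_val (next_rel m r) (t x) (b x) (a x) eps = 0.
Proof.
move=> H x Ux.
have := derive_vanishing e oU H Ux.
have dt := smooth_derivable (v := e x) st Ux.
have [dA EA] := derivable_horner_comp r.1.1 dt.
have [dB EB] := derivable_horner_comp r.1.2 dt.
have [dC EC] := derivable_horner_comp r.2 dt.
have [db Eb] := derivable_sqr (smooth_derivable (v := e x) sb Ux).
have [da Ea] := derivable_sqr (smooth_derivable (v := e x) sa Ux).
have dAb := derivable_mulR dA db; have dBa := derivable_mulR dB da.
have dCe := derivable_mulR dC (derivable_cst eps x (e x)).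
rewrite /rel_val (derive_addR (derivable_addR dAb dBa) dCe) (derive_addR dAb dBa).
rewrite (derive_mulR dA db) (derive_mulR dB da) (derive_mulR dC (derivable_cst eps x (e x))).
rewrite derive_cst EA EB EC Ea Eb.
have [-> -> ->] := next_relE m r (t x).
rewrite Dt // Da // Db // /cst => Dv.
have bq : b x / (qpol R m).[t x] != 0 by rewrite mulf_neq0 ?invr_neq0 ?b0 ?q0.
apply: (mulfI bq); rewrite mulr0 -[RHS]Dv.
by field; exact: q0.
Qed.

Hypothesis DDa : forall x, U x ->
  D (fun y => D a y) x = a x * (M * b x ^+ 2
    + a x ^+ 2 * ((1 - M * t x) ^+ 2 + M * t x ^+ 2) - (M + 4) * eps) - M * b x * D a x.

Lemma rel0_val_eq0 x : U x -> rel_val (rel0 R m) (t x) (b x) (a x) eps = 0.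
Proof.
move=> Ux.
have H y : U y -> (3 + (- (2 * M)) * t y) * D a y + (2 * M) * (t y * a y * b y) = 0.
  move=> Uy; have := q0 Uy; rewrite Da // qpolE => qn.
  by field.
have dt := smooth_derivable (v := e x) st Ux.
have da := smooth_derivable (v := e x) sa Ux.
have db := smooth_derivable (v := e x) sb Ux.
have dDa := smooth_derivable (v := e x) (smooth_dirR oU sa se) Ux.
have dct := derivable_scaleR (c := - (2 * M)) dt.
have dq := derivable_addR (derivable_cst (3 : R) x (e x)) dct.
have dta := derivable_mulR dt da; have dtab := derivable_mulR dta db.
have := derive_vanishing e oU H Ux.
rewrite (derive_addR (derivable_mulR dq dDa) (derivable_scaleR (c := 2 * M) dtab)).
rewrite (derive_mulR dq dDa) (derive_addR (derivable_cst (3 : R) x (e x)) dct).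
rewrite derive_cst add0r (derive_scaleR _ dt) (derive_scaleR _ dtab).
rewrite (derive_mulR dta db) (derive_mulR dt da) /cst.
rewrite DDa // Da // Dt // Db // => Dv.
have [A0 B0 C0] := rel0E m (t x); rewrite /rel_val A0 B0 C0.
(* The differentiated identity is this factor times the relation [rel0]. *)
have aq : - (a x / (qpol R m).[t x] ^+ 2) != 0.
  by rewrite oppr_eq0 mulf_neq0 ?invr_neq0 ?expf_neq0 ?a0 ?q0.
apply: (mulfI aq); rewrite mulr0 -[RHS]Dv.
have qn := q0 Ux; have qE := qpolE m (t x).
rewrite (_ : 3 + - (2 * M) * t x = (qpol R m).[t x]); last by rewrite qE mulNr.
by rewrite qE in qn *; field.
Qed.

(* The determinant of the three relations vanishes at [t], so that [t] is constant along [e_1] and [N(t) = 0].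
   Then [K(t) a^2 + L(t) eps = 0] with [a] not constant along [e_1], whence [K(t) = L(t) eps = 0]. *)
Lemma logarithmic_system_false x0 : U x0 -> False.
Proof.
move=> Ux0; have R0 := rel0_val_eq0; have R1 := rel_val_next R0; have R2 := rel_val_next R1.
have P0 x : U x ->
    (rel_det (rel0 R m) (next_rel m (rel0 R m)) (next_rel m (next_rel m (rel0 R m)))).[t x] = 0.
  by move=> Ux; exact: rel_det_mul (R0 x Ux) (R1 x Ux) (R2 x Ux) (a0 Ux).
have N0 x : U x -> (Npoly R m).[t x] = 0.
  (* If N(t) is nonzero at a point, so is the derivative of t; then [poly_vanish] near that point
     makes the determinant the zero polynomial. *)
  move=> Ux; apply/eqP/negPn/negP => Nx.
  have sDt := smooth_dirR oU st se.
  have oV := open_neq0 oU sDt.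
  have Vx : (U `&` [set y | D t y != 0]) x.
    by split=> //=; rewrite Dt // !mulf_neq0 ?invr_neq0 ?b0 ?q0.
  have sV : smooth_on (U `&` [set y | D t y != 0]) t by apply: smooth_sub_set st => y [].
  have := poly_vanish (e := e) oV Vx sV (fun y => @proj2 _ _) (fun y H => P0 y (proj1 H)).
  by apply/eqP; exact: rel_det_neq0.
have Dt0 x : U x -> D t x = 0 by move=> Ux; rewrite Dt // N0 // mulr0 mul0r.
pose r := rel0 R m.
(* [K] and [L] are half the coefficients of a^2 and eps in the next relation plus 2 q times the
   first one, where b^2 cancels because N(t) = 0. *)
pose K := (qpol R m - (2 * M)%:P * 'X) * r.1.2 - qpol R m * spoly R m * r.1.1.
pose L := qpol R m * (r.2 - r.1.1).
have KE y : K.[t y] = ((qpol R m).[t y] - 2 * M * t y) * r.1.2.[t y]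
    - (qpol R m).[t y] * (spoly R m).[t y] * r.1.1.[t y].
  by rewrite /K !(hornerD, hornerN, hornerM, hornerC, hornerX).
have LE y : L.[t y] = (qpol R m).[t y] * (r.2.[t y] - r.1.1.[t y]).
  by rewrite /L !(hornerD, hornerN, hornerM).
have KL y : U y -> K.[t y] * a y ^+ 2 + L.[t y] * eps = 0.
  move=> Uy; have := R0 y Uy; have := R1 y Uy; rewrite /rel_val.
  have [-> -> ->] := next_relE m r (t y); rewrite N0 // KE LE -/r.
  move: (r.1.1.[t y]) (r.1.2.[t y]) (r.2.[t y]) ((qpol R m).[t y]) ((spoly R m).[t y]).
  move=> A B C q s H1 H0; apply: (mulfI (_ : (2 : R) != 0)); first by rewrite pnatr_eq0.
  rewrite mulr0 -[RHS](addr0 (0 : R)) -{1}(mulr0 (2 * q)) -{1}H0 -H1 !mul0r; ring.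
have K0 : K.[t x0] = 0.
  have dt := smooth_derivable (v := e x0) st Ux0.
  have [dK EK] := derivable_horner_comp K dt.
  have [dL EL] := derivable_horner_comp L dt.
  have [da Ea] := derivable_sqr (smooth_derivable (v := e x0) sa Ux0).
  have := derive_vanishing e oU KL Ux0.
  have dc := derivable_cst eps x0 (e x0).
  rewrite (derive_addR (derivable_mulR dK da) (derivable_mulR dL dc)).
  rewrite (derive_mulR dK da) (derive_mulR dL dc) derive_cst EK EL Ea Dt0 //.
  rewrite !(mulr0, mul0r, add0r, addr0) => /eqP; rewrite mulf_eq0 => /orP[/eqP //|].
  rewrite Da // !(mulf_eq0, oppr_eq0, invr_eq0, pnatr_eq0) /=.
  by rewrite (negbTE (a0 Ux0)) (negbTE (b0 Ux0)) (negbTE (t0 Ux0)) (negbTE (q0 Ux0)) (gtn_eqF m0).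
have L0 : (r.2.[t x0] - r.1.1.[t x0]) * eps = 0.
  have := KL x0 Ux0; rewrite K0 mul0r add0r LE -mulrA => /eqP.
  by rewrite mulf_eq0 (negbTE (q0 Ux0)) => /eqP.
apply: (no_stationary_root m0 (N0 _ Ux0) (a0 Ux0) (R0 _ Ux0) _ L0).
by apply/eqP; rewrite -oppr_eq0 opprB -KE K0.
Qed.

End logarithmic.

(** Near a point with D a nonzero, the third equation makes mu nonzero as well. The unknown t = mu /
    a requires dividing by a and by 3 a - 2 m mu, hence the passage to a smaller open set. *)
Theorem umbilical_ode (U : set 'rV[R]_n) (a mu b : 'rV[R]_n -> R) :
  open U -> smooth_on U e -> smooth_on U a -> smooth_on U mu -> smooth_on U b ->
  (forall x, U x -> a x != 0) ->
  (forall x, U x -> D mu x = (a x - (M + 2) * mu x) * b x) ->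
  (forall x, U x -> D b x = - b x ^+ 2 - eps - (a x - (M + 1) * mu x) * mu x) ->
  (forall x, U x -> (3 * a x - 2 * M * mu x) * D a x = - 2 * M * a x * mu x * b x) ->
  (forall x, U x -> D (fun y => D a y) x + M * b x * D a x
    = a x * (M * b x ^+ 2 + (a x - M * mu x) ^+ 2 + M * mu x ^+ 2 - (M + 4) * eps)) ->
  forall x, U x -> D a x = 0.
Proof.
move=> oU se sa smu sb a0 Dmu Db Da DDa x0 Ux0.
apply/eqP/negPn/negP => Dax0.
have M0 : M != 0 by rewrite pnatr_eq0 -lt0n.
have sDa := smooth_dirR oU sa se.
pose U1 := U `&` [set x | D a x != 0].
have oU1 : open U1 := open_neq0 oU sDa.
have U1x0 : U1 x0 by split.
have U1U : U1 `<=` U by move=> x [].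
pose p x := 3 * a x + (- (2 * M)) * mu x.
have sp : smooth_on U1 p.
  apply: smooth_sub_set U1U _; apply: smooth_add => //; apply: smooth_mul => //; exact: smooth_cst.
have mu0 x : U1 x -> mu x != 0.
  move=> [Ux Dax]; apply/eqP => mux; move: (Da x Ux); rewrite mux !(mulr0, mul0r) subr0.
  by move/eqP; rewrite !mulf_eq0 pnatr_eq0 (negbTE (a0 x Ux)) (negbTE Dax).
(* If 3 a - 2 m mu vanished on all of [U1], the third equation would give b = 0 and the first D mu =
   0 at x0; differentiating would then give 3 D a = 0. *)
have [x1 [U1x1 px1]] : exists x1, U1 x1 /\ p x1 != 0.
  apply: contrapT => H.
  have p0 x : U1 x -> p x = 0.
    by move=> U1x; apply/eqP/negPn/negP => px; apply: H; exists x.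
  have := derive_vanishing e oU1 p0 U1x0.
  have da := smooth_derivable (v := e x0) sa Ux0.
  have dmu := smooth_derivable (v := e x0) smu Ux0.
  rewrite /p (derive_addR (derivable_scaleR da) (derivable_scaleR dmu)).
  rewrite (derive_scaleR _ da) (derive_scaleR _ dmu) Dmu //.
  have b0 : b x0 = 0.
    have := p0 x0 U1x0; rewrite /p mulNr => px0.
    have := Da x0 Ux0; rewrite px0 mul0r => /esym/eqP.
    rewrite !mulf_eq0 oppr_eq0 pnatr_eq0 (negbTE (mu0 x0 U1x0)) (negbTE (a0 x0 Ux0)) (negbTE M0) /=.
    by move=> /eqP.
  rewrite b0 !mulr0 addr0 => /eqP; rewrite mulf_eq0 pnatr_eq0 (negbTE Dax0) //.
pose U2 := U1 `&` [set x | p x != 0].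
have oU2 : open U2 := open_neq0 oU1 sp.
have U2U x : U2 x -> U x by move=> [[]].
pose t x := mu x * (a x)^-1.
have s2 (f : 'rV[R]_n -> R) : smooth_on U f -> smooth_on U2 f by apply: smooth_sub_set => x /U2U.
have st : smooth_on U t by apply: smooth_mul => //; exact: smooth_inv.
have muE x : U x -> mu x = t x * a x by move=> Ux; rewrite /t divfK ?a0.
have pE x : U x -> p x = a x * (qpol R m).[t x].
  by move=> Ux; rewrite /p muE // qpolE; ring.
have q0 x : U2 x -> (qpol R m).[t x] != 0.
  move=> U2x; have := U2x.2; rewrite /= pE; last exact: U2U.
  by rewrite mulf_eq0 negb_or => /andP[].
have t0 x : U2 x -> t x != 0.
  move=> U2x; rewrite /t mulf_neq0 ?invr_neq0 //; first exact: mu0 x U2x.1.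
  exact: a0 x (U2U x U2x).
have Da' x : U2 x -> D a x = - 2 * M * t x * a x * b x / (qpol R m).[t x].
  move=> U2x; have Ux := U2U _ U2x; have H := Da x Ux.
  have pn : p x != 0 := U2x.2.
  have E : p x * D a x = - 2 * M * a x * mu x * b x by rewrite -H /p mulNr.
  apply: (mulfI pn); rewrite E muE // pE //.
  by field; exact: q0.
have b0 x : U2 x -> b x != 0.
  move=> U2x; apply: contraNneq U2x.1.2 => bx; rewrite /= Da' // bx !(mulr0, mul0r) //.
have Dt x : U2 x -> D t x = b x * (Npoly R m).[t x] / (qpol R m).[t x].
  move=> U2x; have Ux := U2U _ U2x.
  have dt := smooth_derivable (v := e x) st Ux; have da := smooth_derivable (v := e x) sa Ux.
  have H : D mu x = D t x * a x + t x * D a x.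
    by rewrite (derive_congr _ oU Ux muE) (derive_mulR dt da).
  have qn := q0 _ U2x; have an := a0 _ Ux.
  apply: (mulIf an); apply: (addIr (t x * D a x)); rewrite -H Dmu // Da' // NpolyE muE //.
  by move: qn; rewrite qpolE => qn; field.
apply: (@logarithmic_system_false U2 a t b oU2 _ _ _ _ _ b0 t0 q0 Dt Da' _ _ x1); last by split.
- by apply: smooth_sub_set se => x /U2U.
- exact: s2.
- exact: s2.
- exact: s2.
- by move=> x /U2U /a0.
- by move=> x /U2U Ux; rewrite Db // muE // spolyE; ring.
- move=> x /U2U Ux; apply: (addIr (M * b x * D a x)); rewrite DDa // muE //; ring.
Qed.
End ode.

(** * Structure equations in an umbilical frame *)

Section cubic_form.
Variables (R : realType) (n : nat).
Implicit Types (i j k l : 'I_n.+1) (la mu : R).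

Definition dl i j : R := (i == j)%:R.

(* The components <h(e_i, e_j), J e_k> of the second fundamental form. *)
Definition cub la mu i j k : R :=
  (la - 3 * mu) * (dl i ord0 * dl j ord0 * dl k ord0)
  + mu * (dl i ord0 * dl j k + dl j ord0 * dl i k + dl k ord0 * dl i j).

Lemma dlC i j : dl i j = dl j i.
Proof. by rewrite /dl eq_sym. Qed.

Lemma dl1 i : dl i i = 1.
Proof. by rewrite /dl eqxx. Qed.

Lemma dl0 i j : i != j -> dl i j = 0.
Proof. by rewrite /dl => /negbTE ->. Qed.

(** Read from right to left, it turns an isolated term into a sum over the frame, so that identities
    between sums can be checked summand by summand. *)
Lemma sum_dl (f : 'I_n.+1 -> R) i : \sum_m f m * dl m i = f i.
Proof.
rewrite (bigD1 i) //= dl1 mulr1 big1 ?addr0 // => m mi.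
by rewrite dl0 // mulr0.
Qed.

Lemma cubC12 la mu i j k : cub la mu i j k = cub la mu j i k.
Proof. by rewrite /cub (dlC i j); ring. Qed.

Lemma cubC23 la mu i j k : cub la mu i j k = cub la mu i k j.
Proof. by rewrite /cub (dlC j k); ring. Qed.

Lemma sum_cub (f : 'I_n.+1 -> R) la mu i l :
  \sum_m f m * cub la mu i m l
  = (la - 3 * mu) * (dl i ord0 * dl l ord0) * f ord0
    + mu * (dl i ord0 * f l + dl i l * f ord0 + dl l ord0 * f i).
Proof.
rewrite -[f l]sum_dl -[f i]sum_dl -[f ord0]sum_dl.
rewrite !mulr_sumr -!big_split mulr_sumr -big_split; apply: eq_bigr => m _ /=.
by rewrite /cub (dlC i m); ring.
Qed.
End cubic_form.

(** * Codazzi, Gauss and biharmonic equations in a frame of a manifold of dimension n + 1 *)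

Section umbilical_structure.
Variables (R : realType) (n p : nat) (eps : R) (U : set 'rV[R]_p).
Variables (e : 'I_n.+1 -> 'rV[R]_p -> 'rV[R]_p) (la mu : 'rV[R]_p -> R).
(* [Gam i j k] stands for [<nabla_(e_i) e_j, e_k>]; as [J] is parallel, these functions and [C] govern
   the derivatives of both [e_j] and [J e_j] along the immersion. *)
Variable Gam : 'I_n.+1 -> 'I_n.+1 -> 'I_n.+1 -> 'rV[R]_p -> R.
Local Notation D i f x := ('D_(e i x) f x).
Local Notation C i j k := (fun x => cub (la x) (mu x) i j k).
Local Notation o := (@ord0 n).
Let a x := la x + n%:R * mu x.
Hypotheses (n0 : (0 < n)%N) (oU : open U) (se : forall i, smooth_on U (e i))
  (sla : smooth_on U la) (smu : smooth_on U mu)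
  (sGam : forall i j k, smooth_on U (Gam i j k)).
Hypothesis anti : forall x, U x -> forall i j k, Gam i j k x = - Gam i k j x.
(** The component on [J e_l] of the ambient curvature applied to [e_i], [e_j], [e_k]. It is zero
    because the tangent spaces are totally real; [gauss] is the component on [e_l]. *)
Hypothesis codazzi : forall x, U x -> forall i j k l,
  D i (C j k l) x + \sum_m (Gam j k m x * C i m l x + C j k m x * Gam i m l x)
  - (D j (C i k l) x + \sum_m (Gam i k m x * C j m l x + C i k m x * Gam j m l x))
  - \sum_m (Gam i j m x - Gam j i m x) * C m k l x = 0.
Hypothesis gauss : forall x, U x -> forall i j k l,
  D i (Gam j k l) x + \sum_m (Gam j k m x * Gam i m l x - C j k m x * C i m l x)
  - (D j (Gam i k l) x + \sum_m (Gam i k m x * Gam j m l x - C i k m x * C j m l x))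
  - \sum_m (Gam i j m x - Gam j i m x) * Gam m k l x
  = eps * (dl R j k * dl R i l - dl R i k * dl R j l).

Lemma derive_cub x i j k l : U x ->
  D i (C j k l) x = (D i la x - 3 * D i mu x) * (dl R j o * dl R k o * dl R l o)
    + D i mu x * (dl R j o * dl R k l + dl R k o * dl R j l + dl R l o * dl R j k).
Proof.
move=> Ux; set A := dl R j o * dl R k o * dl R l o; set B := _ + dl R l o * dl R j k.
have dla := smooth_derivable (v := e i x) sla Ux.
have dmu := smooth_derivable (v := e i x) smu Ux.
have E y : U y -> cub (la y) (mu y) j k l = A * la y + (B - 3 * A) * mu y.
  by move=> _; rewrite /cub -/A -/B; ring.
rewrite (derive_congr _ oU Ux E).
rewrite (derive_addR (derivable_scaleR dla) (derivable_scaleR dmu)).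
by rewrite (derive_scaleR _ dla) (derive_scaleR _ dmu); ring.
Qed.

(** As [cub] is built from Kronecker symbols, every sum collapses, and each choice of indices
    becomes a linear equation that [lra] can use. *)
Lemma codazzi_expanded x i j k l : U x ->
  D i (C j k l) x + ((la x - 3 * mu x) * (dl R i o * dl R l o) * Gam j k o x
    + mu x * (dl R i o * Gam j k l x + dl R i l * Gam j k o x + dl R l o * Gam j k i x)
    + ((la x - 3 * mu x) * (dl R j o * dl R k o) * Gam i o l x
    + mu x * (dl R j o * Gam i k l x + dl R j k * Gam i o l x + dl R k o * Gam i j l x)))
  - (D j (C i k l) x + ((la x - 3 * mu x) * (dl R j o * dl R l o) * Gam i k o x
    + mu x * (dl R j o * Gam i k l x + dl R j l * Gam i k o x + dl R l o * Gam i k j x)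
    + ((la x - 3 * mu x) * (dl R i o * dl R k o) * Gam j o l x
    + mu x * (dl R i o * Gam j k l x + dl R i k * Gam j o l x + dl R k o * Gam j i l x))))
  - ((la x - 3 * mu x) * (dl R k o * dl R l o) * (Gam i j o x - Gam j i o x)
    + mu x * (dl R k o * (Gam i j l x - Gam j i l x) + dl R k l * (Gam i j o x - Gam j i o x)
      + dl R l o * (Gam i j k x - Gam j i k x))) = 0.
Proof.
move=> Ux; have := codazzi Ux i j k l.
have S1 i' j' : \sum_m (Gam j' k m x * C i' m l x + C j' k m x * Gam i' m l x)
  = \sum_m Gam j' k m x * cub (la x) (mu x) i' m l
    + \sum_m Gam i' m l x * cub (la x) (mu x) j' m k.
  rewrite -big_split; apply: eq_bigr => m _ /=.
  by rewrite (cubC23 _ _ j' k m) [X in _ + X]mulrC.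
have S2 : \sum_m (Gam i j m x - Gam j i m x) * C m k l x
  = \sum_m (Gam i j m x - Gam j i m x) * cub (la x) (mu x) k m l.
  by apply: eq_bigr => m _; rewrite cubC12.
by rewrite !S1 S2 !sum_cub.
Qed.

(** * Choices of indices in the Codazzi equation *)

Section pointwise.
Variables (x : 'rV[R]_p) (Ux : U x).
Local Notation L := (la x).
Local Notation M := (mu x).
Local Notation G i j k := (Gam i j k x).

Lemma Gam_diag i j : G i j j = 0.
Proof. have := anti Ux i j j; lra. Qed.

Lemma cod_lambda j : j != o -> D j la x = (L - 2 * M) * G o o j.
Proof.
move=> jo; have := codazzi_expanded o j o o Ux.
rewrite !derive_cub // !dl1 ?(dlC R o j) ?(dl0 R jo) !Gam_diag ?(anti Ux o j o); lra.
Qed.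

Lemma cod_mu0 j : j != o -> D o mu x = (L - 2 * M) * G j o j.
Proof.
move=> jo; have := codazzi_expanded o j o j Ux.
rewrite !derive_cub // !dl1 ?(dlC R o j) ?(dl0 R jo) !Gam_diag ?(anti Ux j j o); lra.
Qed.

Lemma cod_off j k : j != o -> k != o -> j != k -> (L - 2 * M) * G j o k = 0.
Proof.
move=> jo ko jk; have := codazzi_expanded o j o k Ux.
rewrite !derive_cub // !dl1 ?(dlC R o j) ?(dlC R o k) ?(dl0 R jo) ?(dl0 R ko) ?(dl0 R jk) !Gam_diag.
rewrite ?(anti Ux o k j); lra.
Qed.

Lemma cod_mu j : j != o -> D j mu x = 3 * M * G o o j.
Proof.
move=> jo; have := codazzi_expanded o j j j Ux.
rewrite !derive_cub // !dl1 ?(dlC R o j) ?(dl0 R jo) !Gam_diag ?(anti Ux o j o); lra.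
Qed.

(** It takes two distinct directions besides e_1, so it says nothing when M is a surface. *)
Lemma cod_mu_other j k : j != o -> k != o -> j != k -> D k mu x = 0.
Proof.
move=> jo ko jk; have := codazzi_expanded j k o j Ux.
rewrite !derive_cub // !dl1 ?(dlC R o j) ?(dlC R o k) ?(dl0 R jo) ?(dl0 R ko) ?(dlC R k j) ?(dl0 R jk) !Gam_diag.
rewrite ?(anti Ux k j o) ?(anti Ux j k j); lra.
Qed.

(** Together with its copy where j and k are exchanged it gives 9 z = z for z = mu <nabla_(e_j) e_1,
    e_k>, hence z = 0. *)
Lemma cod_cross j k : j != o -> k != o -> j != k -> 3 * M * G k o j = M * G j o k.
Proof.
move=> jo ko jk; have := codazzi_expanded k j j j Ux.
rewrite !derive_cub // !dl1 ?(dlC R o j) ?(dlC R o k) ?(dl0 R jo) ?(dl0 R ko) ?(dlC R k j) ?(dl0 R jk) !Gam_diag.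
rewrite ?(anti Ux k j o) ?(anti Ux j j o) ?(anti Ux j k o); lra.
Qed.

Lemma cod_diag j k : j != o -> k != o -> j != k -> M * G k o k = M * G j o j.
Proof.
move=> jo ko jk; have := codazzi_expanded j k j k Ux.
rewrite !derive_cub // !dl1 ?(dlC R o j) ?(dlC R o k) ?(dl0 R jo) ?(dl0 R ko) ?(dlC R k j) ?(dl0 R jk) !Gam_diag.
rewrite ?(anti Ux k j o) ?(anti Ux j j o) ?(anti Ux k k o) ?(anti Ux j k o); lra.
Qed.
End pointwise.

Lemma smooth_a : smooth_on U a.
Proof.
by apply: smooth_add => //; apply: smooth_mul => //; exact: smooth_cst.
Qed.

Lemma derive_a x i : U x -> D i a x = D i la x + n%:R * D i mu x.
Proof.
move=> Ux; have dla := smooth_derivable (v := e i x) sla Ux.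
have dmu := smooth_derivable (v := e i x) smu Ux.
by rewrite (derive_addR dla (derivable_scaleR dmu)) (derive_scaleR _ dmu).
Qed.

(* The components on [e_k] and [J e_k] of the derivative along [e_i] of the tension field [a J e_1]. *)
Definition dtauE i k (y : 'rV[R]_p) : R := - (a y * cub (la y) (mu y) i o k).
Definition dtauY i k (y : 'rV[R]_p) : R := dl R k o * D i a y + a y * Gam i o k y.

Hypothesis biharmE : forall x, U x -> forall k,
  \sum_i (D i (dtauE i k) x
    + \sum_j (dtauE i j x * Gam i j k x - dtauY i j x * C i j k x)
    - \sum_m Gam i i m x * dtauE m k x) = 0.
(** The constant n + 4 is the trace of the curvature term on [J e_1]: one eps for each of the n + 1
    directions, and three more from e_1 itself. *)
Hypothesis biharmY : forall x, U x -> forall k,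
  \sum_i (D i (dtauY i k) x
    + \sum_j (dtauY i j x * Gam i j k x + dtauE i j x * C i j k x)
    - \sum_m Gam i i m x * dtauY m k x) + eps * (n%:R + 4) * a x * dl R k o = 0.

Lemma cub_first (l m : R) i k :
  cub l m i o k = (l - m) * (dl R i o * dl R k o) + m * dl R i k.
Proof. by rewrite /cub dl1 (dlC R o k); ring. Qed.

Lemma derive_dtauE x i k : U x -> D i (dtauE i k) x
  = - ((D i a x * (la x - mu x) + a x * (D i la x - D i mu x)) * (dl R i o * dl R k o)
       + (D i a x * mu x + a x * D i mu x) * dl R i k).
Proof.
move=> Ux; have dla := smooth_derivable (v := e i x) sla Ux.
have dmu := smooth_derivable (v := e i x) smu Ux.
have da := smooth_derivable (v := e i x) smooth_a Ux.
pose A : R := - (dl R i o * dl R k o); pose B : R := dl R i o * dl R k o - dl R i k.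
have E y : U y -> dtauE i k y = A * (a y * la y) + B * (a y * mu y).
  by move=> _; rewrite /dtauE cub_first /A /B; ring.
rewrite (derive_congr _ oU Ux E).
rewrite (derive_addR (derivable_scaleR (derivable_mulR da dla)) (derivable_scaleR (derivable_mulR da dmu))).
rewrite (derive_scaleR _ (derivable_mulR da dla)) (derive_scaleR _ (derivable_mulR da dmu)).
by rewrite (derive_mulR da dla) (derive_mulR da dmu) /A /B; ring.
Qed.

Lemma sum_dtauE (f : 'I_n.+1 -> R) x i :
  \sum_j dtauE i j x * f j
  = - a x * ((la x - mu x) * dl R i o * f o + mu x * f i).
Proof.
rewrite -[f o]sum_dl -[f i]sum_dl !mulr_sumr -big_split mulr_sumr.
apply: eq_bigr => j _ /=.
by rewrite /dtauE cub_first (dlC R i j); ring.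
Qed.

(** The products of C with the derivative of a in [dtauY] repeat the terms in D a coming from
    [dtauE], whence the doubled coefficient of mu. The terms in [Gam i i k] cancel against the
    correction by nabla_(e_i) e_i, up to the trace of [Gam i o i]. *)
Lemma biharmE_expanded x k : U x ->
  - ((D o a x * (la x - mu x) + a x * (D o la x - D o mu x)) * dl R k o)
  - a x * la x * Gam o o k x - (la x - mu x) * dl R k o * D o a x
  - (2 * D k a x * mu x + a x * D k mu x)
  - a x * la x * dl R k o * (\sum_i Gam i o i x) = 0.
Proof.
move=> Ux; rewrite -[RHS](biharmE Ux k).
set L := la x; set M := mu x; set A := a x.
pose f1 i := - ((D i a x * (L - M) + A * (D i la x - D i mu x)) * dl R k o)
  - A * L * Gam i o k x - (L - M) * dl R k o * D i a x.
pose f2 i := - (2 * D i a x * M + A * D i mu x).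
pose c := - (A * L * dl R k o).
rewrite (_ : _ - _ = f1 o + f2 k + c * \sum_i Gam i o i x); last by rewrite /f1 /f2 /c; ring.
rewrite -[f1 o]sum_dl -[f2 k]sum_dl mulr_sumr -!big_split; apply: eq_bigr => i _ /=.
rewrite derive_dtauE // sumrB sum_dtauE.
have -> : \sum_j dtauY i j x * cub L M i j k
    = D i a x * cub L M i o k + A * (\sum_j Gam i o j x * cub L M i j k).
  rewrite -(sum_dl (fun j => cub L M i j k) o) !mulr_sumr -big_split.
  by apply: eq_bigr => j _ /=; rewrite /dtauY -/A; ring.
have -> : \sum_m Gam i i m x * dtauE m k x
    = - A * ((L - M) * dl R k o * Gam i i o x + M * Gam i i k x).
  rewrite -(sum_dl (fun m => Gam i i m x) o) -(sum_dl (fun m => Gam i i m x) k).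
  rewrite !mulr_sumr -big_split mulr_sumr; apply: eq_bigr => m _ /=.
  by rewrite /dtauE cub_first -/A -/L -/M; ring.
rewrite sum_cub cub_first !Gam_diag // (anti Ux i i o) /f1 /f2 /c -/A -/L -/M; ring.
Qed.

Lemma sum_dtauY (f : 'I_n.+1 -> R) x i :
  \sum_j dtauY i j x * f j = D i a x * f o + a x * \sum_j Gam i o j x * f j.
Proof.
rewrite -(sum_dl f o) !mulr_sumr -big_split.
by apply: eq_bigr => j _ /=; rewrite /dtauY; ring.
Qed.

Lemma biharmY_expanded x : U x ->
  \sum_i (D i (fun y => D i a y) x - a x * \sum_j Gam i o j x ^+ 2
     - \sum_m Gam i i m x * D m a x)
  - a x * (la x ^+ 2 + n%:R * mu x ^+ 2) + eps * (n%:R + 4) * a x = 0.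
Proof.
move=> Ux; rewrite -[RHS](biharmY Ux o) dl1 mulr1; congr (_ + _).
set L := la x; set M := mu x; set A := a x.
have -> : A * (L ^+ 2 + n%:R * M ^+ 2)
    = \sum_i (A * (L ^+ 2 - M ^+ 2) * dl R i o + A * M ^+ 2).
  rewrite big_split (sum_dl (fun=> A * (L ^+ 2 - M ^+ 2))) sumr_const card_ord /=.
  by rewrite -[_ *+ n.+1]mulr_natl -natr1; ring.
rewrite -sumrB; apply: eq_bigr => i _.
have -> : D i (dtauY i o) x = D i (fun y => D i a y) x.
  apply: derive_congr oU Ux _ => y Uy.
  by rewrite /dtauY dl1 Gam_diag // mulr0 addr0 mul1r.
have -> : \sum_m Gam i i m x * dtauY m o x = \sum_m Gam i i m x * D m a x.
  by apply: eq_bigr => m _; rewrite /dtauY dl1 Gam_diag // mulr0 addr0 mul1r.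
rewrite big_split sum_dtauE sum_dtauY Gam_diag // mulr0 add0r.
have -> : \sum_j Gam i o j x * Gam i j o x = - \sum_j Gam i o j x ^+ 2.
  by rewrite -sumrN; apply: eq_bigr => j _; rewrite (anti Ux i j o); ring.
rewrite (cubC23 _ _ i i) !cub_first !dl1 -/A -/L -/M.
have [->|->] : dl R i o = 1 \/ dl R i o = 0 by rewrite /dl; case: (i == o); [left|right].
  by rewrite /=; ring.
by rewrite /=; ring.
Qed.

Let i1 : 'I_n.+1 := lift o (Ordinal n0).

Let i1o : i1 != o. Proof. by rewrite eq_sym neq_lift. Qed.

(* In dimension at least 3 the Codazzi equation with a third direction gives [D_k mu = 0].  In dimension 2
   one gets [la + 5 mu = 0] where the claim fails, and differentiating this gives [la + 13 mu = 0]. *)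
Lemma curvature_line_geodesic x k : U x -> a x != 0 -> k != o -> Gam o o k x = 0.
Proof.
move=> Ux ax ko; apply/eqP/negPn/negP => Gx.
have bi y : U y -> 2 * D k a y * mu y + a y * D k mu y + a y * la y * Gam o o k y = 0.
  move=> Uy; have := biharmE_expanded k Uy; rewrite (dl0 R ko) !(mulr0, mul0r).
  by move: (D k a y * mu y) => ?; lra.
have [n1|n1] := eqVneq n 1%N; last first.
  have [j jo jk] : exists2 j : 'I_n.+1, j != o & j != k.
    have n2 : (1 < n)%N by rewrite ltn_neqAle eq_sym n1.
    have [->|i1k] := eqVneq k i1; last by exists i1 => //; rewrite eq_sym.
    exists (lift o (Ordinal n2)); first by rewrite eq_sym neq_lift.
    by rewrite (inj_eq (@lift_inj _ o)).
  have M3 := cod_mu Ux ko; have M0 := cod_mu_other Ux jo ko jk.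
  have Mx : mu x = 0.
    move: M3; rewrite M0 => /esym/eqP; rewrite !mulf_eq0 pnatr_eq0 (negbTE Gx) orbF /=.
    by move/eqP.
  have := bi x Ux; rewrite M0 Mx !mulr0 !add0r => /eqP.
  rewrite !mulf_eq0 (negbTE Gx) (negbTE ax) orbF /= => /eqP Lx.
  by move: ax; rewrite /a Lx Mx mulr0 addr0 eqxx.
have nR : (n%:R : R) = 1 := congr1 (fun k => k%:R) n1.
have aE y : a y = la y + mu y by rewrite /a nR mul1r.
have oW := open_neq0 oU (sGam o o k).
have sW (f : 'rV[R]_p -> R) : smooth_on U f -> smooth_on (U `&` [set y | Gam o o k y != 0]) f.
  by apply: smooth_sub_set => y [].
have oW' := open_neq0 oW (sW _ smooth_a).
set W := _ `&` [set y | a y != 0] in oW'.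
have WU y : W y -> U y by move=> [[]].
have Wx : W x by [].
(* On a surface the Codazzi equations give D_k a = a G and D_k mu = 3 mu G with G = [Gam o o k], so
   the tangential biharmonic equation factors as G a (la + 5 mu) = 0. *)
have s5 y : W y -> la y + 5 * mu y = 0.
  move=> Wy; have Uy := WU y Wy; have := bi y Uy; rewrite derive_a // nR mul1r.
  rewrite cod_lambda // cod_mu // => H.
  have : Gam o o k y * a y * (la y + 5 * mu y) = 0 by rewrite -H aE; ring.
  move/eqP; rewrite !mulf_eq0; case: Wy => [[_ Gy] ay].
  by rewrite (negbTE (Gy : Gam o o k y != 0)) (negbTE (ay : a y != 0)) => /eqP.
have := derive_vanishing (e k) oW' s5 Wx.
have dla := smooth_derivable (v := e k x) sla Ux.
have dmu := smooth_derivable (v := e k x) smu Ux.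
rewrite (derive_addR dla (derivable_scaleR dmu)) (derive_scaleR _ dmu).
rewrite cod_lambda // cod_mu // => H.
have L13 : la x + 13 * mu x = 0.
  have : Gam o o k x * (la x + 13 * mu x) = 0 by rewrite -H; ring.
  by move/eqP; rewrite mulf_eq0 (negbTE Gx) => /eqP.
have := s5 x Wx; move: ax; rewrite aE; move: L13 => L13 + L5.
by rewrite (_ : la x + mu x = 0) ?eqxx //; lra.
Qed.

(** The Codazzi equations constrain the derivatives of e_1 only after multiplication by la - 2 mu or
    by mu; at least one of these factors can be cancelled. *)
Lemma second_form_neq0 x : a x != 0 -> la x - 2 * mu x != 0 \/ mu x != 0.
Proof.
move=> ax; have [M0|] := eqVneq (mu x) 0; last by right.
by left; move: ax; rewrite /a M0 !mulr0 subr0 addr0.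
Qed.

Lemma Gam_scalar x : U x -> a x != 0 -> forall j k,
  Gam j o k x = dl R j k * (j != o)%:R * Gam i1 o i1 x.
Proof.
move=> Ux ax j k.
have [->|ko] := eqVneq k o.
  rewrite Gam_diag //; have [->|jo] := eqVneq j o; first by rewrite mulr0 mul0r.
  by rewrite (dl0 R jo) !mul0r.
have [->|jo] := eqVneq j o.
  by rewrite curvature_line_geodesic // mulr0 mul0r.
rewrite mulr1; have [<-|jk] := eqVneq j k; last first.
  rewrite (dl0 R jk) mul0r.
  have H1 := cod_off Ux jo ko jk; have H2 := cod_cross Ux jo ko jk.
  have kj : k != j by rewrite eq_sym.
  have H3 := cod_cross Ux ko jo kj.
  have H4 : mu x * Gam j o k x = 0 by lra.
  case: (second_form_neq0 ax) => nz; apply: (mulfI nz); rewrite mulr0 //.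
rewrite dl1 mul1r; have [->//|ji] := eqVneq j i1.
have H1 := cod_mu0 Ux jo; have H2 := cod_mu0 Ux i1o; have H3 := cod_diag Ux i1o jo.
case: (second_form_neq0 ax) => nz; apply: (mulfI nz); first by rewrite -H1.
by apply: H3; rewrite eq_sym.
Qed.

Lemma derive_transverse x k : U x -> a x != 0 -> k != o ->
  [/\ D k la x = 0, D k mu x = 0 & D k a x = 0].
Proof.
move=> Ux ax ko; have G0 := curvature_line_geodesic Ux ax ko.
have E1 : D k la x = 0 by rewrite cod_lambda // G0 mulr0.
have E2 : D k mu x = 0 by rewrite cod_mu // G0 mulr0.
by split=> //; rewrite derive_a // E1 E2 mulr0 addr0.
Qed.

Lemma sum_transverse (f : 'I_n.+1 -> R) (c : R) : (forall i, f i = (i != o)%:R * c) ->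
  \sum_i f i = n%:R * c.
Proof.
move=> fE; rewrite big_ord_recl fE eqxx mul0r add0r.
rewrite (eq_bigr (fun=> c)); last by move=> i _; rewrite fE eq_sym neq_lift mul1r.
by rewrite sumr_const card_ord mulr_natl.
Qed.

Lemma derive_shape_eq0 x i : U x -> a x != 0 -> D i a x = 0.
Proof.
move=> Ux ax; have [->|io] := eqVneq i o; last by case: (derive_transverse Ux ax io).
(* The shape of the connection is known only where a is nonzero, and has to hold on an open set
   before it can be differentiated. *)
have oV := open_neq0 oU smooth_a.
set V := U `&` _ in oV.
have Vx : V x by [].
have VU y : V y -> U y by case.
have Va y : V y -> a y != 0 by case.
have sV (f : 'rV[R]_p -> R) : smooth_on U f -> smooth_on V f by apply: smooth_sub_set => y [].
have seV : smooth_on V (e o) by apply: smooth_sub_set (se o) => y [].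
pose b := Gam i1 o i1.
have GE y : V y -> forall j k, Gam j o k y = dl R j k * (j != o)%:R * b y.
  by move=> [Uy ay]; exact: Gam_scalar.
have S1 y : V y -> \sum_i Gam i o i y = n%:R * b y.
  by move=> Vy; apply: sum_transverse => j; rewrite GE // dl1 mul1r.
apply: (umbilical_ode (m := n) (eps := eps) (e := e o) n0 oV seV (sV _ smooth_a) (sV _ smu) (sV _ (sGam i1 o i1)) Va _ _ _ _ Vx).
(* The Codazzi equation, with la - 2 mu = a - (n + 2) mu. *)
- move=> y Vy; rewrite (cod_mu0 (VU y Vy) i1o) /a; ring.
(* The Gauss equation on the plane of e_1 and [e i1], of sectional curvature eps + la mu - mu^2. *)
- move=> y Vy; have Uy := VU y Vy.
  have := gauss Uy o i1 o i1.
  rewrite (dl0 R i1o) dl1 dl1 mul0r mul1r sub0r.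
  have D0 : D i1 (Gam o o i1) y = 0.
    apply: (derive_vanishing (e i1) oV _ Vy) => z Vz.
    by rewrite GE // eqxx mulr0 mul0r.
  rewrite D0.
  have -> : \sum_m (Gam i1 o m y * Gam o m i1 y - C i1 o m y * C o m i1 y) = - mu y ^+ 2.
    rewrite (bigD1 i1) //= GE // dl1 i1o !mul1r Gam_diag // mulr0 sub0r.
    rewrite big1 ?addr0 => [|m mi1].
      by rewrite (cubC12 _ _ o) cub_first !dl1 (dl0 R i1o); ring.
    rewrite GE // (dlC R i1) (dl0 R mi1) !mul0r cub_first (dl0 R i1o) (dlC R i1) (dl0 R mi1); ring.
  have -> : \sum_m (Gam o o m y * Gam i1 m i1 y - C o o m y * C i1 m i1 y) = - (la y * mu y).
    rewrite (bigD1 o) //= GE // eqxx mulr0 !mul0r sub0r.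
    rewrite big1 ?addr0 => [|m mo].
      by rewrite !cub_first !dl1 (dl0 R i1o); ring.
    rewrite GE // eqxx mulr0 !mul0r cub_first (dlC R o) (dl0 R mo); ring.
  have -> : \sum_m (Gam o i1 m y - Gam i1 o m y) * Gam m o i1 y = - b y ^+ 2.
    rewrite (bigD1 i1) //= !GE // dl1 i1o !mul1r Gam_diag // sub0r.
    rewrite big1 ?addr0 => [|m mi1]; first by ring.
    by rewrite [Gam m o i1 y]GE // (dl0 R mi1) !mul0r mulr0.
  by rewrite /b /a => H; move: H; move: (D o _ y) => d H; lra.
(* The component of the biharmonic equation on e_1, in which D la = D a - n D mu. *)
- move=> y Vy; have Uy := VU y Vy; have := biharmE_expanded o Uy.
  rewrite Gam_diag // S1 // dl1 derive_a // (cod_mu0 Uy i1o) -/b /a => H; lra.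
(* The component on [J e_1]. The second derivatives of a along the other directions vanish, but each
   of these n directions contributes b D a - a b^2 through the connection. *)
- move=> y Vy; have Uy := VU y Vy; have := biharmY_expanded Uy.
  have DD j : j != o -> D j (fun z => D j a z) y = 0.
    move=> jo; apply: (derive_vanishing (e j) oV _ Vy) => z [Uz az].
    by case: (derive_transverse Uz az jo).
  have G2 j : \sum_k Gam j o k y ^+ 2 = (j != o)%:R * b y ^+ 2.
    rewrite (bigD1 j) //= big1 ?addr0 => [|k kj].
      by rewrite GE // dl1; case: (j != o); rewrite ?mul1r ?mul0r ?expr0n.
    by rewrite GE // dlC (dl0 R kj) !mul0r expr0n.
  have GD j : \sum_m Gam j j m y * D m a y = - ((j != o)%:R * b y * D o a y).
    rewrite (bigD1 o) //= big1 ?addr0 => [|m mo].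
      by rewrite (anti Uy j j o) GE // dl1 mul1r mulNr.
    by case: (derive_transverse Uy (Va y Vy) mo) => _ _ ->; rewrite mulr0.
  pose c := b y * D o a y - a y * b y ^+ 2.
  have E : \sum_j (D j (fun z => D j a z) y - a y * \sum_k Gam j o k y ^+ 2
      - \sum_m Gam j j m y * D m a y) = D o (fun z => D o a z) y + n%:R * c.
    rewrite -(sum_dl (fun=> D o (fun z => D o a z) y) o).
    rewrite -(sum_transverse (f := fun j => (j != o)%:R * c)) //.
    rewrite -big_split; apply: eq_bigr => j _.
    rewrite (G2 j) (GD j); have [->|jo] := eqVneq j o.
      by rewrite dl1 mulr1 /= !mul0r mulr0 oppr0 !subr0 addr0.
    by rewrite (DD j jo) (dl0 R jo) /c /=; ring.
  rewrite E; have -> : a y - n%:R * mu y = la y by rewrite /a; ring.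
  rewrite /c -/b; move: (D o (fun z => D o a z) y) (D o a y) => d1 d2 H; lra.
Qed.

(** The square takes care of the zeros of a, where 2 a D a = 0 whatever D a is. *)
Theorem derive_shape_sqr x i : U x -> D i (fun y => a y ^+ 2) x = 0.
Proof.
move=> Ux; have [_ ->] := derivable_sqr (smooth_derivable (v := e i x) smooth_a Ux).
have [->|ax] := eqVneq (a x) 0; first by rewrite mulr0 mul0r.
by rewrite derive_shape_eq0 // mulr0.
Qed.
End umbilical_structure.

(** * The connection along a map *)

Section inner_product.
Variables (R : realType) (n : nat).
Implicit Types (G : 'M[R]_n) (u v w : 'rV[R]_n).

Lemma inner_mulmx G u v : inner G u v = (u *m G *m v^T) 0 0.
Proof. by []. Qed.

Lemma innerDl G u v w : inner G (u + v) w = inner G u w + inner G v w.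
Proof. by rewrite /inner !mulmxDl mxE. Qed.

Lemma innerDr G u v w : inner G w (u + v) = inner G w u + inner G w v.
Proof. by rewrite /inner linearD /= mulmxDr mxE. Qed.

Lemma innerZl G a u w : inner G (a *: u) w = a * inner G u w.
Proof. by rewrite /inner -!scalemxAl mxE. Qed.

Lemma innerZr G a u w : inner G w (a *: u) = a * inner G w u.
Proof. by rewrite /inner linearZ /= -scalemxAr mxE. Qed.

Lemma inner0l G w : inner G 0 w = 0.
Proof. by rewrite /inner !mul0mx mxE. Qed.

Lemma inner0r G w : inner G w 0 = 0.
Proof. by rewrite /inner linear0 mulmx0 mxE. Qed.

Lemma innerNl G u w : inner G (- u) w = - inner G u w.
Proof. by rewrite -scaleN1r innerZl mulN1r. Qed.

Lemma innerBl G u v w : inner G (u - v) w = inner G u w - inner G v w.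
Proof. by rewrite innerDl innerNl. Qed.

Lemma inner_suml G (I : Type) (r : seq I) (P : pred I) (f : I -> 'rV[R]_n) w :
  inner G (\sum_(i <- r | P i) f i) w = \sum_(i <- r | P i) inner G (f i) w.
Proof.
apply: (big_morph (fun u => inner G u w)); [move=> u v; exact: innerDl|exact: inner0l].
Qed.

Lemma inner_sumr G (I : Type) (r : seq I) (P : pred I) (f : I -> 'rV[R]_n) w :
  inner G w (\sum_(i <- r | P i) f i) = \sum_(i <- r | P i) inner G w (f i).
Proof.
apply: (big_morph (fun u => inner G w u)); [move=> u v; exact: innerDr|exact: inner0r].
Qed.

Lemma inner_sym G u v : G^T = G -> inner G u v = inner G v u.
Proof.
move=> GT; rewrite /inner; have -> : v *m G *m u^T = (u *m G *m v^T)^T.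
  by rewrite !trmx_mul trmxK GT mulmxA.
by rewrite [RHS]mxE.
Qed.

Lemma inner_Dmx G G' u v : inner (G + G') u v = inner G u v + inner G' u v.
Proof. by rewrite /inner mulmxDr mulmxDl mxE. Qed.

Lemma inner_Zmx a G u v : inner (a *: G) u v = a * inner G u v.
Proof. by rewrite /inner -scalemxAr -scalemxAl mxE. Qed.

Lemma inner_summx (I : Type) (r : seq I) (P : pred I) (A : I -> 'M[R]_n) u v :
  inner (\sum_(i <- r | P i) A i) u v = \sum_(i <- r | P i) inner (A i) u v.
Proof.
apply: (big_morph (fun B => inner B u v)); first by move=> B C; exact: inner_Dmx.
by rewrite /inner mulmx0 mul0mx mxE.
Qed.

Lemma posdef_eq0 G u : (forall v, v != 0 -> 0 < inner G v v) ->
  inner G u u = 0 -> u = 0.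
Proof.
move=> pG uu; apply/eqP; apply: contraTT isT => /pG; by rewrite uu ltxx.
Qed.

Lemma posdef_unit G : (forall v, v != 0 -> 0 < inner G v v) -> G \in unitmx.
Proof.
move=> pG; rewrite -row_free_unit; apply: inj_row_free => v vG.
by apply: (posdef_eq0 pG); rewrite /inner vG mul0mx mxE.
Qed.

Lemma posdef_inj G u v : (forall v, v != 0 -> 0 < inner G v v) ->
  (forall w, inner G u w = inner G v w) -> u = v.
Proof.
move=> pG uv; apply/eqP; rewrite -subr_eq0; apply/eqP/(posdef_eq0 pG).
by rewrite innerBl uv subrr.
Qed.

End inner_product.

Section derive_extra.
Variables (R : realType) (m : nat).

Lemma derive_sumf (W : normedModType R) k (f : 'I_k -> 'rV[R]_m -> W) (x v : 'rV[R]_m) :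
  (forall i, derivable (f i) x v) ->
  'D_v (fun y => \sum_i f i y) x = \sum_i 'D_v (f i) x.
Proof.
move=> df; rewrite -derive_sum //; congr ('D_v _ x).
by rewrite funeqE => y; rewrite fct_sumE.
Qed.

Lemma derivable_sumf (W : normedModType R) k (f : 'I_k -> 'rV[R]_m -> W) (x v : 'rV[R]_m) :
  (forall i, derivable (f i) x v) -> derivable (fun y => \sum_i f i y) x v.
Proof.
move=> df; rewrite (_ : (fun y => _) = \sum_i f i); first exact: derivable_sum.
by rewrite funeqE => y; rewrite fct_sumE.
Qed.

Lemma derive_addf (W : normedModType R) (f g : 'rV[R]_m -> W) (x v : 'rV[R]_m) :
  derivable f x v -> derivable g x v ->
  'D_v (fun y => f y + g y) x = 'D_v f x + 'D_v g x.
Proof. by move=> df dg; exact: deriveD df dg. Qed.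

(** Product rule for y |-> dF_y (Y y): the first term freezes Y at x, the second applies dF to the
    derivative of Y. *)
Lemma derive_dir_field p q (U : set 'rV[R]_m) (F : 'rV[R]_m -> 'M[R]_(p, q))
  (Y : 'rV[R]_m -> 'rV[R]_m) (x u : 'rV[R]_m) :
  open U -> smooth_on U F -> smooth_on U Y -> U x ->
  'D_u (fun y => 'D_(Y y) F y) x
  = 'D_u (fun y => 'D_(Y x) F y) x + 'D_('D_u Y x) F x.
Proof.
move=> oU sF sY Ux.
have E (Z : 'rV[R]_m -> 'rV[R]_m) y : U y ->
    'D_(Z y) F y = \sum_i Z y 0 i *: 'D_(delta_mx 0 i) F y.
  by move=> Uy; rewrite {1}[Z y]row_sum_delta derive_lincomb //; exact: smooth_differentiable Uy.
have dF i : derivable (fun y => 'D_(delta_mx 0 i) F y) x u.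
  exact: (smooth_derivable (smooth_derive _ sF)).
have dY i : derivable (fun y => Y y 0 i) x u.
  exact: (smooth_derivable ((smooth_mxP oU Y).1 sY 0 i)).
rewrite (derive_congr _ oU Ux (E Y)) (derive_congr _ oU Ux (E (fun=> Y x))).
rewrite derive_sumf; last first.
  move=> i; apply: smooth_derivable Ux; apply: smooth_scale => //.
    exact: (smooth_mxP oU Y).1.
  exact: smooth_derive.
rewrite derive_sumf; last first.
  move=> i; apply: smooth_derivable Ux; apply: smooth_scale => //.
    exact: smooth_cst.
  exact: smooth_derive.
have -> : 'D_('D_u Y x) F x = \sum_i ('D_u Y x) 0 i *: 'D_(delta_mx 0 i) F x.
  exact: (E (fun=> 'D_u Y x)).
rewrite -big_split; apply: eq_bigr => i _ /=.
rewrite (derive_scale (dY i) (dF i)) (derive_scale (derivable_cst _ _ _) (dF i)).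
rewrite derive_cst scale0r add0r addrC derive_coord //.
exact: smooth_derivable Ux.
Qed.

End derive_extra.

(** * The Levi-Civita connection from the Koszul formula *)

Section levi_civita_form.
Variables (R : realType) (n : nat) (V : set 'rV[R]_n) (G : 'rV[R]_n -> 'M[R]_n).
Hypotheses (oV : open V) (sG : smooth_on V G)
  (symG : forall y, V y -> (G y)^T = G y)
  (posG : forall y, V y -> forall u, u != 0 -> 0 < inner (G y) u u).

Lemma smooth_inner_cst u v : smooth_on V (fun y => inner (G y) u v).
Proof.
have H : smooth_on V (fun y => u *m G y *m v^T).
  by apply: smooth_mulmx => //; [apply: smooth_mulmx|]; rewrite //; exact: smooth_cst.
exact: ((smooth_mxP oV _).1 H 0 0).
Qed.

Lemma derive_inner_cst (y w u v : 'rV[R]_n) : V y ->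
  'D_w (fun z => inner (G z) u v) y = inner ('D_w G y) u v.
Proof.
move=> Vy; have dG := smooth_derivable (v := w) sG Vy.
have dU : derivable (fun z => u *m G z) y w.
  apply: smooth_derivable Vy; apply: smooth_mulmx => //; exact: smooth_cst.
have dUV : derivable (fun z => u *m G z *m v^T) y w.
  apply: smooth_derivable Vy; apply: smooth_mulmx => //; last exact: smooth_cst.
  by apply: smooth_mulmx => //; exact: smooth_cst.
by rewrite /inner (derive_coord 0 0 dUV) (derive_mulmxl _ dU) (derive_mulmxr _ dG).
Qed.

Lemma derive_metric_sym (y w : 'rV[R]_n) : V y -> ('D_w G y)^T = 'D_w G y.
Proof.
move=> Vy; rewrite -derive_trmx; last exact: smooth_derivable Vy.
exact: derive_congr oV Vy symG.
Qed.

Opaque inner derive.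

(** The definition prescribes the products with coordinate vectors only; both sides are linear in
    w. *)
Lemma christoffel_koszul (y u v w : 'rV[R]_n) : V y ->
  inner (G y) (christoffel G y u v) w
  = 2^-1 * (inner ('D_u G y) v w + inner ('D_v G y) u w - inner ('D_w G y) u v).
Proof.
move=> Vy; have uG := posdef_unit (posG Vy).
have E1 (A : 'M[R]_n) (x : 'rV[R]_n) :
    inner A x w = \sum_l w 0 l * inner A x (delta_mx 0 l).
  rewrite {1}[w]row_sum_delta inner_sumr; apply: eq_bigr => l _; exact: innerZr.
have E2 : inner ('D_w G y) u v = \sum_l w 0 l * inner ('D_(delta_mx 0 l) G y) u v.
  rewrite {1}[w]row_sum_delta derive_lincomb; last exact: smooth_differentiable Vy.
  by rewrite inner_summx; apply: eq_bigr => l _; exact: inner_Zmx.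
apply: (@etrans _ _ (2^-1 * \sum_l (inner ('D_u G y) v (delta_mx 0 l)
    + inner ('D_v G y) u (delta_mx 0 l) - inner ('D_(delta_mx 0 l) G y) u v) * w 0 l)).
  apply: etrans (inner_mulmx _ _ _) _.
  rewrite /christoffel mulmxKV // -scalemxAl mxE; congr (_ * _).
  rewrite mxE; apply: eq_bigr => l _; rewrite [w^T l 0]mxE; congr (_ * _); rewrite mxE.
  have F1 := derive_inner_cst u v (delta_mx 0 l) Vy.
  have F2 := derive_inner_cst v u (delta_mx 0 l) Vy.
  have F3 := derive_inner_cst (delta_mx 0 l) u v Vy.
  by rewrite F1 F2 F3.
congr (_ * _); rewrite E2.
move: ('D_u G y) ('D_v G y) => A B.
rewrite (E1 A) (E1 B) -big_split -sumrB; apply: eq_bigr => l _ /=.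
by rewrite [LHS]mulrC mulrBr mulrDr.
Qed.

Lemma christoffel_sym (y u v : 'rV[R]_n) : V y -> christoffel G y u v = christoffel G y v u.
Proof.
move=> Vy; apply: (posdef_inj (posG Vy)) => w.
apply: etrans (christoffel_koszul u v w Vy) _; apply: etrans _ (esym (christoffel_koszul v u w Vy)).
have := derive_metric_sym w Vy.
move: ('D_u G y) ('D_v G y) ('D_w G y) => A B C Q.
by rewrite (inner_sym u v Q) (addrC (inner A v w)).
Qed.

Lemma koszul_compat_algebra (A B C : 'M[R]_n) u v w : A^T = A -> B^T = B -> C^T = C ->
  inner A v w = 2^-1 * (inner A v w + inner B u w - inner C u v)
    + 2^-1 * (inner A w v + inner C u v - inner B u w).
Proof.
move=> hA hB hC; rewrite (inner_sym w v hA).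
by move: (inner A v w) (inner B u w) (inner C u v) => a b c; field.
Qed.

(** In the sum of the Koszul formulas for (u, v, w) and (u, w, v) only the derivative along u
    survives. *)
Lemma christoffel_compat (y u v w : 'rV[R]_n) : V y ->
  inner ('D_u G y) v w = inner (G y) (christoffel G y u v) w + inner (G y) v (christoffel G y u w).
Proof.
move=> Vy.
have E1 := christoffel_koszul u v w Vy; have E2 := christoffel_koszul u w v Vy.
rewrite (inner_sym v _ (symG Vy)) E1 E2.
apply: koszul_compat_algebra; exact: derive_metric_sym.
Qed.

Lemma christoffel_linr (y u v w : 'rV[R]_n) a : V y ->
  christoffel G y u (a *: v + w) = a *: christoffel G y u v + christoffel G y u w.
Proof.
move=> Vy; apply: (posdef_inj (posG Vy)) => z.
rewrite [RHS]innerDl innerZl; apply: etrans (christoffel_koszul _ _ _ Vy) _.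
have E1 := christoffel_koszul u v z Vy; have E2 := christoffel_koszul u w z Vy.
rewrite E1 E2 {E1 E2} (derive_is_linear (smooth_differentiable oV sG Vy)).
move: ('D_u G y) ('D_v G y) ('D_w G y) ('D_z G y) => A B C D.
by rewrite innerDl innerZl inner_Dmx inner_Zmx innerDr innerZr; ring.
Qed.

Lemma christoffel_linl (y u v w : 'rV[R]_n) a : V y ->
  christoffel G y (a *: v + w) u = a *: christoffel G y v u + christoffel G y w u.
Proof. by move=> Vy; rewrite -!(christoffel_sym u) // christoffel_linr. Qed.

Lemma christoffel0r (y u : 'rV[R]_n) : V y -> christoffel G y u 0 = 0.
Proof.
by move=> Vy; have := christoffel_linr u 0 0 (-1) Vy; rewrite scaler0 addr0 scaleN1r addNr.
Qed.

Lemma christoffel0l (y u : 'rV[R]_n) : V y -> christoffel G y 0 u = 0.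
Proof. by move=> Vy; rewrite christoffel_sym // christoffel0r. Qed.

Lemma christoffelDr (y u v w : 'rV[R]_n) : V y ->
  christoffel G y u (v + w) = christoffel G y u v + christoffel G y u w.
Proof. by move=> Vy; have := christoffel_linr u v w 1 Vy; rewrite !scale1r. Qed.

Lemma christoffelZr (y u v : 'rV[R]_n) a : V y ->
  christoffel G y u (a *: v) = a *: christoffel G y u v.
Proof. by move=> Vy; have := christoffel_linr u v 0 a Vy; rewrite (christoffel0r u Vy) !addr0. Qed.

Lemma christoffelDl (y u v w : 'rV[R]_n) : V y ->
  christoffel G y (v + w) u = christoffel G y v u + christoffel G y w u.
Proof. by move=> Vy; have := christoffel_linl u v w 1 Vy; rewrite !scale1r. Qed.

Lemma christoffelZl (y u v : 'rV[R]_n) a : V y ->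
  christoffel G y (a *: v) u = a *: christoffel G y v u.
Proof. by move=> Vy; have := christoffel_linl u v 0 a Vy; rewrite (christoffel0l u Vy) !addr0. Qed.

(** This expresses the symbol with arguments varying from point to point through finitely many fixed
    smooth functions; smoothness and derivatives along a map are obtained from it. *)
Lemma christoffel_coord (y u v : 'rV[R]_n) : V y ->
  christoffel G y u v
  = \sum_i \sum_j (u 0 i * v 0 j) *: christoffel G y (delta_mx 0 i) (delta_mx 0 j).
Proof.
move=> Vy; rewrite {1}[u]row_sum_delta {1}[v]row_sum_delta.
rewrite (big_morph (fun u => christoffel G y u _) (id1 := 0) (op1 := +%R)); first last.
- exact: christoffel0l.
- by move=> a b; rewrite christoffelDl.
apply: eq_bigr => i _; rewrite christoffelZl //.
rewrite (big_morph (fun v => christoffel G y _ v) (id1 := 0) (op1 := +%R)); first last.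
- exact: christoffel0r.
- by move=> a b; rewrite christoffelDr.
rewrite scaler_sumr; apply: eq_bigr => j _.
by rewrite christoffelZr // scalerA.
Qed.

Lemma smooth_christoffel (u v : 'rV[R]_n) : smooth_on V (fun y => christoffel G y u v).
Proof.
rewrite /christoffel; apply: smooth_mulmx => //; last first.
  by apply: smooth_invmx => // y /posG; exact: posdef_unit.
apply: smooth_scale => //; first exact: smooth_cst.
apply/smooth_mxP => // i j.
have H : smooth_on V (fun y => 'D_u (fun y => inner (G y) v (delta_mx 0 j)) y
     + 'D_v (fun y => inner (G y) u (delta_mx 0 j)) y
     - 'D_(delta_mx 0 j) (fun y => inner (G y) u v) y).
  by apply: smooth_sub => //; [apply: smooth_add => //|];
     apply: smooth_derive; exact: smooth_inner_cst.
by apply: smooth_congr H => // y _; rewrite mxE.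
Qed.
End levi_civita_form.

Opaque inner derive christoffel.

Lemma addr_reorder (W : zmodType) (a g p q r s : W) :
  a + (g + p + q) + (r + s) = a + g + (p + r) + (q + s).
Proof. by rewrite !addrA (addrAC _ q r). Qed.

Lemma addr_cancel_common (W : zmodType) (p q r s t : W) : p + (q + r) + s - (p + (r + q) + t) = s - t.
Proof. by rewrite (addrC r q) opprD addrACA subrr add0r. Qed.

(** * The induced connection along a map *)

Section along.
Variables (R : realType) (m n : nat) (V : set 'rV[R]_n) (G : 'rV[R]_n -> 'M[R]_n).
Hypotheses (oV : open V) (sG : smooth_on V G)
  (symG : forall y, V y -> (G y)^T = G y)
  (posG : forall y, V y -> forall u, u != 0 -> 0 < inner (G y) u u).
Variables (U : set 'rV[R]_m) (F : 'rV[R]_m -> 'rV[R]_n).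
Hypotheses (oU : open U) (sF : smooth_on U F) (FUV : forall x, U x -> V (F x)).
Implicit Types (A Z W : 'rV[R]_m -> 'rV[R]_n) (X Y : 'rV[R]_m -> 'rV[R]_m) (x u v : 'rV[R]_m).

Local Notation Gij i j := (fun z : 'rV[R]_n => christoffel G z (delta_mx 0 i) (delta_mx 0 j)).

Let smooth_coord k (A : 'rV[R]_m -> 'rV[R]_k) i : smooth_on U A -> smooth_on U (fun x => A x 0 i).
Proof. by move=> sA; exact: (smooth_mxP oU A).1. Qed.

Lemma smooth_christoffel_along A Z : smooth_on U A -> smooth_on U Z ->
  smooth_on U (fun x => christoffel G (F x) (A x) (Z x)).
Proof.
move=> sA sZ.
have H : smooth_on U (fun x => \sum_i \sum_j (A x 0 i * Z x 0 j) *: Gij i j (F x)).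
  apply: smooth_sum => // i _; apply: smooth_sum => // j _; apply: smooth_scale => //.
    by apply: smooth_mul => //; exact: smooth_coord.
  exact: (smooth_comp oU oV FUV sF (smooth_christoffel oV sG posG _ _)).
apply: smooth_congr H => // x Ux.
exact: (esym (christoffel_coord oV sG symG posG _ _ (FUV Ux))).
Qed.

Lemma derive_christoffel_fst (y a b w : 'rV[R]_n) : V y ->
  'D_w (fun z => christoffel G z a b) y = \sum_i \sum_j (a 0 i * b 0 j) *: 'D_w (Gij i j) y.
Proof.
move=> Vy.
have E := christoffel_coord oV sG symG posG a b.
have s i j := smooth_christoffel oV sG posG (delta_mx 0 i) (delta_mx 0 j).
have d i j : derivable (fun z => (a 0 i * b 0 j) *: Gij i j z) y w.
  by apply: derivableZ; exact: (smooth_derivable (s i j) Vy).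
rewrite (derive_congr w oV Vy E) derive_sumf; last by move=> i; apply: derivable_sumf => j; exact: d.
apply: eq_bigr => i _; rewrite derive_sumf; last by move=> j; exact: d.
by apply: eq_bigr => j _; apply: deriveZ; exact: (smooth_derivable (s i j) Vy).
Qed.

Lemma derive_christoffel_along A Z x u : smooth_on U A -> smooth_on U Z -> U x ->
  'D_u (fun y => christoffel G (F y) (A y) (Z y)) x
  = christoffel G (F x) ('D_u A x) (Z x) + christoffel G (F x) (A x) ('D_u Z x)
    + 'D_('D_u F x) (fun z => christoffel G z (A x) (Z x)) (F x).
Proof.
move=> sA sZ Ux.
have E y (Uy : U y) := christoffel_coord oV sG symG posG (A y) (Z y) (FUV Uy).
have sg i j := smooth_christoffel oV sG posG (delta_mx 0 i) (delta_mx 0 j).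
have sgF i j := smooth_comp oU oV FUV sF (sg i j).
have dgF i j := smooth_derivable (v := u) (sgF i j) Ux.
have dA i := smooth_derivable (v := u) (smooth_coord i sA) Ux.
have dZ i := smooth_derivable (v := u) (smooth_coord i sZ) Ux.
have dAZ i j : derivable (fun y => A y 0 i * Z y 0 j) x u := derivableM (dA i) (dZ j).
have d i j : derivable (fun y => (A y 0 i * Z y 0 j) *: Gij i j (F y)) x u.
  apply: smooth_derivable Ux; apply: smooth_scale => //.
  by apply: smooth_mul => //; exact: smooth_coord.
rewrite (derive_congr u oU Ux E) derive_sumf; last by move=> i; apply: derivable_sumf => j; exact: d.
rewrite (derive_christoffel_fst _ _ _ (FUV Ux)).
rewrite (christoffel_coord oV sG symG posG _ _ (FUV Ux)).
rewrite (christoffel_coord oV sG symG posG (A x) ('D_u Z x) (FUV Ux)).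
rewrite -!big_split; apply: eq_bigr => i _ /=; rewrite derive_sumf; last by move=> j; exact: d.
rewrite -!big_split; apply: eq_bigr => j _ /=.
rewrite (derive_scale (dAZ i j) (dgF i j)) -scalerDl; congr (_ *: _ + _ *: _).
  apply: etrans (deriveM (dA i) (dZ j)) _; rewrite addrC; congr (_ + _).
    by rewrite (derive_coord _ _ (smooth_derivable sA Ux)); exact: mulrC.
  by rewrite (derive_coord _ _ (smooth_derivable sZ Ux)).
exact: derive_comp (smooth_differentiable oU sF Ux) (smooth_differentiable oV (sg i j) (FUV Ux)).
Qed.

Lemma smooth_dF X : smooth_on U X -> smooth_on U (fun x => 'D_(X x) F x).
Proof. by move=> sX; exact: smooth_dir. Qed.

Lemma smooth_nabla X Z : smooth_on U X -> smooth_on U Z ->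
  smooth_on U (fun x => nabla_along G F (X x) Z x).
Proof.
move=> sX sZ; apply: smooth_add => //; first exact: smooth_dir.
exact: (smooth_christoffel_along (smooth_dF sX) sZ).
Qed.

Lemma nabla_linl a u v Z x : smooth_on U Z -> U x ->
  nabla_along G F (a *: u + v) Z x = a *: nabla_along G F u Z x + nabla_along G F v Z x.
Proof.
move=> sZ Ux; rewrite /nabla_along.
have -> := derive_is_linear (smooth_differentiable oU sZ Ux) a u v.
have -> := derive_is_linear (smooth_differentiable oU sF Ux) a u v.
rewrite (christoffel_linl oV sG symG posG _ _ _ _ (FUV Ux)).
by rewrite scalerDr addrACA.
Qed.

Lemma nabla0l Z x : smooth_on U Z -> U x -> nabla_along G F 0 Z x = 0.
Proof.
move=> sZ Ux; have := nabla_linl (-1) 0 0 sZ Ux.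
by rewrite scaler0 addr0 scaleN1r addNr.
Qed.

Lemma nabla_suml k (a : 'I_k -> R) (w : 'I_k -> 'rV[R]_m) Z x : smooth_on U Z -> U x ->
  nabla_along G F (\sum_i a i *: w i) Z x = \sum_i a i *: nabla_along G F (w i) Z x.
Proof.
move=> sZ Ux.
elim/big_rec2: _ => [|i y1 y2 _ <-]; first exact: nabla0l.
exact: nabla_linl.
Qed.

Lemma nablaD u Z W x : smooth_on U Z -> smooth_on U W -> U x ->
  nabla_along G F u (fun y => Z y + W y) x = nabla_along G F u Z x + nabla_along G F u W x.
Proof.
move=> sZ sW Ux; rewrite /nabla_along.
have -> := derive_addf (smooth_derivable (v := u) sZ Ux) (smooth_derivable (v := u) sW Ux).
rewrite (christoffelDr oV sG posG _ _ _ (FUV Ux)).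
by rewrite addrACA.
Qed.

Lemma nablaZ u (f : 'rV[R]_m -> R) Z x : smooth_on U f -> smooth_on U Z -> U x ->
  nabla_along G F u (fun y => f y *: Z y) x
  = 'D_u f x *: Z x + f x *: nabla_along G F u Z x.
Proof.
move=> sf sZ Ux; rewrite /nabla_along.
have -> := derive_scale (smooth_derivable (v := u) sf Ux) (smooth_derivable (v := u) sZ Ux).
rewrite (christoffelZr oV sG posG _ _ _ (FUV Ux)).
by rewrite scalerDr addrA.
Qed.

Lemma nabla_congr u Z W x : U x -> (forall y, U y -> Z y = W y) ->
  nabla_along G F u Z x = nabla_along G F u W x.
Proof.
move=> Ux ZW; rewrite /nabla_along (derive_congr u oU Ux ZW).
by rewrite ZW.
Qed.

Lemma nabla_sum k u (f : 'I_k -> 'rV[R]_m -> R) (Z : 'I_k -> 'rV[R]_m -> 'rV[R]_n) x :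
  (forall i, smooth_on U (f i)) -> (forall i, smooth_on U (Z i)) -> U x ->
  nabla_along G F u (fun y => \sum_i f i y *: Z i y) x
  = \sum_i ('D_u (f i) x *: Z i x + f i x *: nabla_along G F u (Z i) x).
Proof.
move=> sf sZ Ux.
have s i : smooth_on U (fun y => f i y *: Z i y) by exact: smooth_scale.
have H (r : seq 'I_k) : nabla_along G F u (fun y => \sum_(i <- r) f i y *: Z i y) x
  = \sum_(i <- r) ('D_u (f i) x *: Z i x + f i x *: nabla_along G F u (Z i) x).
  elim: r => [|i r IH].
    rewrite big_nil (_ : (fun y => _) = cst 0); last by rewrite funeqE => y; rewrite big_nil.
    by rewrite /nabla_along derive_cst add0r (christoffel0r oV sG posG _ (FUV Ux)).
  have ss : smooth_on U (fun y => \sum_(i <- r) f i y *: Z i y) by apply: smooth_sum.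
  rewrite big_cons -IH -(nablaZ u (sf i) (sZ i) Ux) -(nablaD u (s i) ss Ux).
  by apply: nabla_congr => // y _; rewrite big_cons.
exact: H.
Qed.

Lemma nabla_metric u Z W x : smooth_on U Z -> smooth_on U W -> U x ->
  'D_u (fun y => inner (G (F y)) (Z y) (W y)) x
  = inner (G (F x)) (nabla_along G F u Z x) (W x) + inner (G (F x)) (Z x) (nabla_along G F u W x).
Proof.
move=> sZ sW Ux.
have sGF : smooth_on U (fun y => G (F y)) := smooth_comp oU oV FUV sF sG.
have dZ := smooth_derivable (v := u) sZ Ux.
have dG := smooth_derivable (v := u) sGF Ux.
have dWT := smooth_derivable (v := u) (smooth_trmx oU sW) Ux.
have dZG := smooth_derivable (v := u) (smooth_mulmx oU sZ sGF) Ux.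
have dZGW := smooth_derivable (v := u) (smooth_mulmx oU (smooth_mulmx oU sZ sGF) (smooth_trmx oU sW)) Ux.
have E : 'D_u (fun y => inner (G (F y)) (Z y) (W y)) x
    = inner (G (F x)) ('D_u Z x) (W x) + inner ('D_('D_u F x) G (F x)) (Z x) (W x)
      + inner (G (F x)) (Z x) ('D_u W x).
  rewrite (_ : (fun y => _) = (fun y => (Z y *m G (F y) *m (W y)^T) 0 0)) //.
  rewrite (derive_coord 0 0 dZGW) (derive_mulmx dZG dWT) (derive_mulmx dZ dG).
  rewrite (derive_trmx (smooth_derivable (v := u) sW Ux)) mulmxDl.
  rewrite (derive_comp u (smooth_differentiable oU sF Ux) (smooth_differentiable oV sG (FUV Ux))).
  have mxD (A B : 'M[R]_1) : (A + B) 0 0 = A 0 0 + B 0 0 by rewrite mxE.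
  by rewrite mxD mxD !inner_mulmx.
rewrite E /nabla_along innerDl innerDr.
have -> := christoffel_compat oV sG symG posG ('D_u F x) (Z x) (W x) (FUV Ux).
by rewrite addrA !addrA; ring.
Qed.

Lemma nabla_dF_sym u v x : U x ->
  nabla_along G F u (fun y => 'D_v F y) x = nabla_along G F v (fun y => 'D_u F y) x.
Proof.
move=> Ux; rewrite /nabla_along (smooth_derive_comm u v oU sF Ux).
by rewrite (christoffel_sym oV sG symG posG _ _ (FUV Ux)).
Qed.

Lemma nabla_dF_field u Y x : smooth_on U Y -> U x ->
  nabla_along G F u (fun y => 'D_(Y y) F y) x
  = nabla_along G F u (fun y => 'D_(Y x) F y) x + 'D_('D_u Y x) F x.
Proof.
by move=> sY Ux; rewrite /nabla_along (derive_dir_field u oU sF sY Ux) addrAC.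
Qed.

Lemma nabla_field u Y Z x : smooth_on U Y -> smooth_on U Z -> U x ->
  nabla_along G F u (fun y => nabla_along G F (Y y) Z y) x
  = nabla_along G F u (fun y => nabla_along G F (Y x) Z y) x
    + nabla_along G F ('D_u Y x) Z x.
Proof.
move=> sY sZ Ux.
have E (W : 'rV[R]_m -> 'rV[R]_m) y : U y -> nabla_along G F (W y) Z y
    = \sum_i W y 0 i *: nabla_along G F (delta_mx 0 i) Z y.
  by move=> Uy; rewrite {1}[W y]row_sum_delta nabla_suml.
have sN i : smooth_on U (fun y => nabla_along G F (delta_mx 0 i) Z y).
  exact: (smooth_nabla (X := fun=> delta_mx 0 i) (smooth_cst _ _) sZ).
have sYi i : smooth_on U (fun y => Y y 0 i) by exact: smooth_coord.
have sYx i : smooth_on U (fun y => Y x 0 i) by exact: smooth_cst.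
have E2 := etrans (nabla_congr u Ux (E (fun=> Y x))) (nabla_sum u sYx sN Ux).
have E3 := E (fun=> 'D_u Y x) x Ux.
apply: etrans (nabla_congr u Ux (E Y)) _; apply: etrans (nabla_sum u sYi sN Ux) _.
apply: etrans _ (esym (congr2 +%R E2 E3)).
rewrite -big_split; apply: eq_bigr => i _ /=.
have -> : 'D_u (fun=> Y x 0 i) x = 0 by exact: derive_cst.
have -> : 'D_u (fun y => Y y 0 i) x = ('D_u Y x) 0 i.
  exact: derive_coord (smooth_derivable sY Ux).
by rewrite scale0r add0r; exact: addrC.
Qed.

Lemma curvatureE (y u v w : 'rV[R]_n) : V y -> curvature G y u v w
  = 'D_u (fun z => christoffel G z v w) y + christoffel G y u (christoffel G y v w)
  - ('D_v (fun z => christoffel G z u w) y + christoffel G y v (christoffel G y u w)).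
Proof.
move=> Vy; rewrite /curvature /curvature_fields.
have L a : levi_civita G (cst a) (cst w) = (fun z => christoffel G z a w).
  by rewrite funeqE => z; rewrite /levi_civita derive_cst add0r.
rewrite !L.
have -> : levi_civita G (lie_bracket (cst u) (cst v)) (cst w) y = 0.
  rewrite /levi_civita /lie_bracket derive_cst derive_cst derive_cst subrr add0r.
  exact: (christoffel0l oV sG symG posG _ Vy).
by rewrite subr0.
Qed.

(** The second derivatives of Z and of F are symmetric in u and v, and the terms with one derivative
    of Z are exchanged; only the expression of [curvatureE] at dF u and dF v is left. *)
Lemma nabla_commutator u v Z x : smooth_on U Z -> U x ->
  nabla_along G F u (fun y => nabla_along G F v Z y) x
  - nabla_along G F v (fun y => nabla_along G F u Z y) x
  = curvature G (F x) ('D_u F x) ('D_v F x) (Z x).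
Proof.
move=> sZ Ux.
have H a b : nabla_along G F a (fun y => nabla_along G F b Z y) x
  = 'D_a (fun y => 'D_b Z y) x + christoffel G (F x) ('D_a (fun y => 'D_b F y) x) (Z x)
    + (christoffel G (F x) ('D_b F x) ('D_a Z x) + christoffel G (F x) ('D_a F x) ('D_b Z x))
    + ('D_('D_a F x) (fun z => christoffel G z ('D_b F x) (Z x)) (F x)
       + christoffel G (F x) ('D_a F x) (christoffel G (F x) ('D_b F x) (Z x))).
  rewrite {1}/nabla_along {2}/nabla_along (christoffelDr oV sG posG _ _ _ (FUV Ux)).
  have sbZ := smooth_derive b sZ; have sbF := smooth_derive b sF.
  have -> := derive_addf (smooth_derivable (v := a) sbZ Ux)
     (smooth_derivable (v := a) (smooth_christoffel_along sbF sZ) Ux).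
  rewrite (derive_christoffel_along a sbF sZ Ux).
  exact: addr_reorder.
rewrite (H u v) (H v u) (curvatureE _ _ _ (FUV Ux)).
rewrite (smooth_derive_comm u v oU sZ Ux) (smooth_derive_comm u v oU sF Ux).
exact: addr_cancel_common.
Qed.

Lemma nabla_commutator_field X Y Z x : smooth_on U X -> smooth_on U Y -> smooth_on U Z -> U x ->
  nabla_along G F (X x) (fun y => nabla_along G F (Y y) Z y) x
  - nabla_along G F (Y x) (fun y => nabla_along G F (X y) Z y) x
  - nabla_along G F (lie_bracket X Y x) Z x
  = curvature G (F x) ('D_(X x) F x) ('D_(Y x) F x) (Z x).
Proof.
move=> sX sY sZ Ux; rewrite (nabla_field _ sY sZ Ux) (nabla_field _ sX sZ Ux).
rewrite -(nabla_commutator _ _ sZ Ux).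
have -> : lie_bracket X Y x = (-1) *: 'D_(Y x) X x + 'D_(X x) Y x.
  by rewrite scaleN1r addrC.
rewrite (nabla_linl _ _ _ sZ Ux) scaleN1r.
move: (nabla_along _ _ (X x) _ x) (nabla_along _ _ (Y x) _ x) => a b.
move: (nabla_along _ _ _ _ x) (nabla_along _ _ _ _ x) => c d.
by rewrite !opprD opprK; apply/rowP => i; rewrite !mxE; ring.
Qed.

Section complex_structure.
Variable J : 'rV[R]_n -> 'M[R]_n.
Hypotheses (sJ : smooth_on V J) (parJ : forall y, V y -> forall u w : 'rV[R]_n,
    levi_civita G (cst u) (fun z => w *m J z) y = levi_civita G (cst u) (cst w) y *m J y).

Lemma smooth_J Z : smooth_on U Z -> smooth_on U (fun y => Z y *m J (F y)).
Proof.
have sJF : smooth_on U (fun y => J (F y)) := smooth_comp oU oV FUV sF sJ.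
by move=> sZ; exact: smooth_mulmx.
Qed.

(** By the Leibniz rule it remains to differentiate J along dF u with the row Z x held constant,
    which is the case covered by [parJ]. *)
Lemma nabla_J u Z x : smooth_on U Z -> U x ->
  nabla_along G F u (fun y => Z y *m J (F y)) x = nabla_along G F u Z x *m J (F x).
Proof.
move=> sZ Ux; have Vx := FUV Ux.
have sJF : smooth_on U (fun y => J (F y)) := smooth_comp oU oV FUV sF sJ.
rewrite /nabla_along.
have -> := derive_mulmx (smooth_derivable (v := u) sZ Ux) (smooth_derivable (v := u) sJF Ux).
rewrite (derive_comp u (smooth_differentiable oU sF Ux) (smooth_differentiable oV sJ Vx)).
rewrite mulmxDl -addrA; congr (_ + _).
have := parJ Vx ('D_u F x) (Z x).
rewrite /levi_civita derive_cst add0r /cst => <-.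
by rewrite (derive_mulmxr _ (smooth_derivable sJ Vx)).
Qed.
End complex_structure.
End along.

(** * From the frame to the structure equations *)

Opaque inner derive christoffel nabla_along curvature.

(** With the frame as rows of a square matrix B, orthonormality reads B A B^T = 1. A one-sided
    inverse of a square matrix is two-sided, so A B^T B = 1, which is the expansion. *)
Lemma orthonormal_expansion (R : realType) n (A : 'M[R]_n) (b : 'I_n -> 'rV[R]_n) (u : 'rV[R]_n) :
  (forall i j, inner A (b i) (b j) = (i == j)%:R) ->
  u = \sum_k inner A u (b k) *: b k.
Proof.
move=> ob; pose B := \matrix_(i < n) b i.
have BA w i : (w *m (A *m B^T)) 0 i = inner A w (b i).
  rewrite inner_mulmx mulmxA !mxE; apply: eq_bigr => k _; by rewrite !mxE.
have B1 : B *m (A *m B^T) = 1%:M.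
  apply/row_matrixP => i; rewrite row_mul rowK; apply/rowP => j.
  by rewrite BA ob !mxE.
rewrite -[LHS]mulmx1 -(mulmx1C B1) mulmxA mulmx_sum_row.
by apply: eq_bigr => k _; rewrite BA rowK.
Qed.

Lemma derive0_locally_constant (R : realType) m (U : set 'rV[R]_m) (g : 'rV[R]_m -> R) (x : 'rV[R]_m) :
  open U -> smooth_on U g -> (forall (z v : 'rV[R]_m), U z -> 'D_v g z = 0) -> U x ->
  \forall y \near x, g y = g x.
Proof.
move=> oU sg g0 Ux; have /nbhs_ballP[r /= r0 xrU] : nbhs x U by exact: open_nbhs_nbhs.
apply/nbhs_ballP; exists r => //= y xry.
apply: (derive0_ball (f := g) (x := x) (r := r)) xry => z xrz v.
have Uz : U z by exact: xrU.
by split; [exact: smooth_derivable sg Uz|exact: g0].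
Qed.

Lemma derive0_orthonormal (R : realType) n (U : set 'rV[R]_n) (g : 'rV[R]_n -> R) (A : 'M[R]_n)
    (b : 'I_n -> 'rV[R]_n) (z v : 'rV[R]_n) :
  open U -> smooth_on U g -> U z -> (forall i j, inner A (b i) (b j) = (i == j)%:R) ->
  (forall i, 'D_(b i) g z = 0) -> 'D_v g z = 0.
Proof.
move=> oU sg Uz ob g0; have dg : differentiable g z := smooth_differentiableR oU sg Uz.
rewrite (orthonormal_expansion v ob) (derive_lincomb _ _ _ _ dg) big1 // => i _.
by rewrite g0 scaler0.
Qed.

Lemma scale_lincomb (R : realType) (W : lmodType R) m (E : 'I_m -> W) (p : 'I_m -> R)
  (g : 'I_m -> 'I_m -> R) :
  \sum_j p j *: (\sum_k g j k *: E k) = \sum_k (\sum_j p j * g j k) *: E k.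
Proof.
transitivity (\sum_j \sum_k (p j * g j k) *: E k).
  by apply: eq_bigr => j _; rewrite scaler_sumr; apply: eq_bigr => k _; rewrite scalerA.
by rewrite exchange_big; apply: eq_bigr => k _; rewrite scaler_suml.
Qed.

(** The connection matrix on the E_k and Y_k = J E_k has blocks (g, c) and (- c, g), because J is
    parallel and J^2 = -1. *)
Lemma frame_derivative (R : realType) (W : lmodType R) m (E Y : 'I_m -> W)
  (dp dq p q : 'I_m -> R) (g c : 'I_m -> 'I_m -> R) :
  \sum_j (dp j *: E j + p j *: (\sum_k g j k *: E k + \sum_k c j k *: Y k))
  + \sum_j (dq j *: Y j + q j *: (\sum_k (- c j k) *: E k + \sum_k g j k *: Y k))
  = \sum_k (dp k + \sum_j (p j * g j k - q j * c j k)) *: E k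
    + \sum_k (dq k + \sum_j (q j * g j k + p j * c j k)) *: Y k.
Proof.
have H (u : 'I_m -> R) (g1 g2 : 'I_m -> 'I_m -> R) (X : 'I_m -> W) (du : 'I_m -> R) :
    \sum_j (du j *: X j + u j *: (\sum_k g1 j k *: E k + \sum_k g2 j k *: Y k))
    = \sum_j du j *: X j + (\sum_k (\sum_j u j * g1 j k) *: E k
        + \sum_k (\sum_j u j * g2 j k) *: Y k).
  rewrite big_split /=; congr (_ + _); rewrite -!scale_lincomb -big_split /=.
  by apply: eq_bigr => j _; rewrite scalerDr.
have K (X : 'I_m -> W) (u v w : 'I_m -> R) :
    \sum_j (u j + (v j + w j)) *: X j
    = \sum_j u j *: X j + (\sum_j v j *: X j + \sum_j w j *: X j).
  by rewrite -!big_split; apply: eq_bigr => j _; rewrite !scalerDl.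
rewrite !H.
under [X in _ = X + _]eq_bigr do rewrite big_split /=.
under [X in _ = _ + X]eq_bigr do rewrite big_split /=.
rewrite !K.
have -> : \sum_k (\sum_j q j * - c j k) *: E k = \sum_k (\sum_j - (q j * c j k)) *: E k.
  by apply: eq_bigr => k _; congr (_ *: _); apply: eq_bigr => j _; rewrite mulrN.
by rewrite -!addrA; congr (_ + (_ + _)); rewrite addrC -!addrA addrCA.
Qed.

Lemma inner_scaled_diff (R : realType) d (c a b : R) (G : 'M[R]_d) (X Y Z : 'rV[R]_d) :
  inner G (c *: (a *: X - b *: Y)) Z = c * (a * inner G X Z - b * inner G Y Z).
Proof. by rewrite innerZl innerBl !innerZl. Qed.

Lemma inner_scaled_sum (R : realType) d (c b : R) (G : 'M[R]_d) (X Y Z : 'rV[R]_d) :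
  inner G (c *: (X + b *: Y)) Z = c * (inner G X Z + b * inner G Y Z).
Proof. by rewrite innerZl innerDl innerZl. Qed.

Lemma curvature_tangent (R : realType) d (eps a b : R) (G J : 'M[R]_d) (X Y Z : 'rV[R]_d) :
  inner G Y Z = a -> inner G X Z = b -> inner G (Y *m J) Z = 0 ->
  inner G (X *m J) Z = 0 -> inner G X (Y *m J) = 0 ->
  eps *: (inner G Y Z *: X - inner G X Z *: Y + inner G (Y *m J) Z *: (X *m J)
        - inner G (X *m J) Z *: (Y *m J) + (2 * inner G X (Y *m J)) *: (Z *m J))
  = eps *: (a *: X - b *: Y).
Proof. by move=> -> -> -> -> ->; rewrite mulr0 !scale0r !addr0 subr0. Qed.

(** This is R(tau, e_i) e_i for tau = a J X and Z = e_i. The 3 is made of one copy from the product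
    of J tau with Z and two from that of tau with J Z. *)
Lemma curvature_tension (R : realType) d (eps a c : R) (G J : 'M[R]_d) (X Z : 'rV[R]_d) :
  J *m J = - 1%:M ->
  inner G Z Z = 1 -> inner G (X *m J) Z = 0 -> inner G (Z *m J) Z = 0 ->
  inner G X Z = c -> inner G (X *m J) (Z *m J) = c ->
  eps *: (inner G Z Z *: (a *: (X *m J)) - inner G (a *: (X *m J)) Z *: Z
        + inner G (Z *m J) Z *: (a *: (X *m J) *m J)
        - inner G (a *: (X *m J) *m J) Z *: (Z *m J)
        + (2 * inner G (a *: (X *m J)) (Z *m J)) *: (Z *m J))
  = (eps * a) *: (X *m J + (3 * c) *: (Z *m J)).
Proof.
move=> JJ ZZ XJZ ZJZ XZ XJZJ.
have E : a *: (X *m J) *m J = - (a *: X) by rewrite -scalemxAl -mulmxA JJ mulmxN mulmx1 scalerN.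
rewrite E innerNl !innerZl ZZ XJZ ZJZ XZ XJZJ mulr0 !scale0r scale1r subr0 addr0 scaleNr opprK.
rewrite -addrA -scalerDl -[RHS]scalerA; congr (_ *: _).
by rewrite [RHS]scalerDr scalerA; congr (_ + _ *: _); ring.
Qed.

(** * The frame E_k = df(e_k), Y_k = J E_k along the immersion *)

Section frame.
Variables (R : realType) (n d : nat) (eps : R).
Variables (V : set 'rV[R]_d) (G J : 'rV[R]_d -> 'M[R]_d).
Hypotheses (oV : open V) (sG : smooth_on V G)
  (symG : forall y, V y -> (G y)^T = G y)
  (posG : forall y, V y -> forall u, u != 0 -> 0 < inner (G y) u u)
  (sJ : smooth_on V J)
  (parJ : forall y, V y -> forall u w : 'rV[R]_d,
    levi_civita G (cst u) (fun z => w *m J z) y = levi_civita G (cst u) (cst w) y *m J y)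
  (sqJ : forall y, V y -> J y *m J y = - 1%:M)
  (isoJ : forall y, V y -> forall u v : 'rV[R]_d,
    inner (G y) (u *m J y) (v *m J y) = inner (G y) u v)
  (curvG : forall y, V y -> forall X Y Z : 'rV[R]_d, curvature G y X Y Z
    = eps *: (inner (G y) Y Z *: X - inner (G y) X Z *: Y
        + inner (G y) (Y *m J y) Z *: (X *m J y) - inner (G y) (X *m J y) Z *: (Y *m J y)
        + (2 * inner (G y) X (Y *m J y)) *: (Z *m J y))).
Variables (U : set 'rV[R]_n.+1) (F : 'rV[R]_n.+1 -> 'rV[R]_d) (A : 'rV[R]_n.+1 -> 'M[R]_n.+1).
Hypotheses (oU : open U) (sF : smooth_on U F) (FUV : forall x, U x -> V (F x)).
Hypotheses (sA : smooth_on U A) (symA : forall x, U x -> (A x)^T = A x)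
  (posA : forall x, U x -> forall u, u != 0 -> 0 < inner (A x) u u).
Hypothesis isoF : forall x, U x -> forall u v : 'rV[R]_n.+1,
  inner (G (F x)) ('D_u F x) ('D_v F x) = inner (A x) u v.
Hypothesis lagF : forall x, U x -> forall u v : 'rV[R]_n.+1,
  inner (G (F x)) ('D_u F x *m J (F x)) ('D_v F x) = 0.
Variable e : 'I_n.+1 -> 'rV[R]_n.+1 -> 'rV[R]_n.+1.
Hypotheses (se : forall i, smooth_on U (e i))
  (oe : forall x, U x -> forall i j, inner (A x) (e i x) (e j x) = (i == j)%:R).
Variables (la mu : 'rV[R]_n.+1 -> R).
Local Notation nab := (nabla_along G F).
Local Notation o := (@ord0 n).
Local Notation C i j k := (fun x => cub (la x) (mu x) i j k).
Local Notation D i f x := ('D_(e i x) f x).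
Local Notation ip x := (inner (G (F x))).
Let E k x : 'rV[R]_d := 'D_(e k x) F x.
Let Y k x : 'rV[R]_d := E k x *m J (F x).
Hypothesis formF : forall x, U x -> forall i j,
  nab (e i x) (fun y => 'D_(e j x) F y) x - 'D_(christoffel A x (e i x) (e j x)) F x
  = \sum_k C i j k x *: Y k x.

Let a x := la x + n%:R * mu x.
Hypothesis bitens : forall x, U x ->
  \sum_i (nab (e i x) (fun y => nab (e i y) (fun z => a z *: Y o z) y) x
     - nab (levi_civita A (e i) (e i) x) (fun z => a z *: Y o z) x
     + curvature G (F x) (a x *: Y o x) (E i x) (E i x)) = 0.

Lemma smooth_E k : smooth_on U (E k).
Proof. exact: smooth_dF. Qed.

Lemma smooth_Y k : smooth_on U (Y k).
Proof. exact: (smooth_J oV oU sF FUV sJ (smooth_E k)). Qed.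

Lemma ipEE x i j : U x -> ip x (E i x) (E j x) = dl R i j.
Proof. by move=> Ux; rewrite isoF // oe. Qed.

Lemma ipYE x i j : U x -> ip x (Y i x) (E j x) = 0.
Proof. by move=> Ux; exact: lagF. Qed.

Lemma ipEY x i j : U x -> ip x (E i x) (Y j x) = 0.
Proof. by move=> Ux; rewrite inner_sym ?ipYE //; apply: symG; exact: FUV. Qed.

Lemma ipYY x i j : U x -> ip x (Y i x) (Y j x) = dl R i j.
Proof. by move=> Ux; rewrite isoJ ?ipEE //; exact: FUV. Qed.

(** Taken in the ambient space, so that skew-symmetry is metric compatibility along F;
    [levi_civita_frame] identifies these functions with the connection coefficients of M. *)
Definition Gam i j k x : R := ip x (nab (e i x) (E j) x) (E k x).

Lemma smooth_ip (Z W : 'rV[R]_n.+1 -> 'rV[R]_d) : smooth_on U Z -> smooth_on U W ->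
  smooth_on U (fun x => ip x (Z x) (W x)).
Proof.
move=> sZ sW.
have sGF : smooth_on U (fun y => G (F y)) := smooth_comp oU oV FUV sF sG.
have H := smooth_mulmx oU (smooth_mulmx oU sZ sGF) (smooth_trmx oU sW).
exact: ((smooth_mxP oU _).1 H 0 0).
Qed.

Lemma smooth_nab i Z : smooth_on U Z -> smooth_on U (fun x => nab (e i x) Z x).
Proof. by move=> sZ; exact: (smooth_nabla oV sG symG posG oU sF FUV (se i) sZ). Qed.

Lemma smooth_Gam i j k : smooth_on U (Gam i j k).
Proof. by apply: smooth_ip; [apply: smooth_nab; exact: smooth_E|exact: smooth_E]. Qed.

Lemma Gam_anti x : U x -> forall i j k, Gam i j k x = - Gam i k j x.
Proof.
move=> Ux i j k.
have := nabla_metric oV sG symG posG oU sF FUV (e i x) (smooth_E j) (smooth_E k) Ux.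
have D0 : D i (fun y => ip y (E j y) (E k y)) x = 0.
  rewrite (derive_congr (g := cst (dl R j k)) (e i x) oU Ux); first exact: derive_cst.
  by move=> y Uy; rewrite ipEE.
rewrite D0 (inner_sym (E j x)); last by apply: symG; exact: FUV.
by move=> /esym/eqP; rewrite addr_eq0 => /eqP.
Qed.

Lemma ip_sum (x : 'rV[R]_n.+1) (p q : 'I_n.+1 -> R) l : U x ->
  ip x (\sum_k p k *: E k x + \sum_k q k *: Y k x) (E l x) = p l
  /\ ip x (\sum_k p k *: E k x + \sum_k q k *: Y k x) (Y l x) = q l.
Proof.
move=> Ux; rewrite !innerDl !inner_suml; split.
  rewrite [X in _ + X]big1 ?addr0; last by move=> k _; rewrite innerZl ipYE // mulr0.
  by rewrite -[RHS]sum_dl; apply: eq_bigr => k _; rewrite innerZl ipEE.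
rewrite big1 ?add0r; last by move=> k _; rewrite innerZl ipEY // mulr0.
by rewrite -[RHS]sum_dl; apply: eq_bigr => k _; rewrite innerZl ipYY.
Qed.

Lemma dF_levi_civita x i j : U x ->
  nab (e i x) (E j) x = 'D_(levi_civita A (e i) (e j) x) F x + \sum_k C i j k x *: Y k x.
Proof.
move=> Ux; rewrite -(formF Ux i j).
have -> := nabla_dF_field G oU sF (e i x) (se j) Ux.
have -> : levi_civita A (e i) (e j) x
    = 1 *: 'D_(e i x) (e j) x + christoffel A x (e i x) (e j x) by rewrite scale1r.
rewrite (derive_is_linear (smooth_differentiable oU sF Ux)) scale1r.
by rewrite addrACA subrr addr0 addrC.
Qed.

Lemma levi_civita_frame x i j : U x ->
  levi_civita A (e i) (e j) x = \sum_k Gam i j k x *: e k x.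
Proof.
move=> Ux; rewrite {1}(orthonormal_expansion (levi_civita A (e i) (e j) x) (oe Ux)).
apply: eq_bigr => k _; congr (_ *: _).
rewrite /Gam dF_levi_civita // [RHS]innerDl inner_suml [X in _ + X]big1 ?addr0.
  by rewrite isoF.
by move=> l _; rewrite innerZl ipYE // mulr0.
Qed.

Lemma nab_E x i j : U x ->
  nab (e i x) (E j) x = \sum_k Gam i j k x *: E k x + \sum_k C i j k x *: Y k x.
Proof.
move=> Ux; rewrite dF_levi_civita // levi_civita_frame //.
by rewrite derive_lincomb //; exact: smooth_differentiable Ux.
Qed.

Lemma nab_Y x i j : U x ->
  nab (e i x) (Y j) x = \sum_k (- C i j k x) *: E k x + \sum_k Gam i j k x *: Y k x.
Proof.
move=> Ux; have -> := nabla_J oV oU sF FUV sJ parJ (e i x) (smooth_E j) Ux.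
rewrite nab_E // mulmxDl !mulmx_suml addrC; congr (_ + _); apply: eq_bigr => k _.
  by rewrite -scalemxAl /Y -mulmxA sqJ ?mulmxN ?mulmx1 ?scalerN ?scaleNr //; exact: FUV.
by rewrite -scalemxAl.
Qed.

Lemma lie_bracket_frame x i j : U x ->
  lie_bracket (e i) (e j) x = \sum_m (Gam i j m x - Gam j i m x) *: e m x.
Proof.
move=> Ux.
have -> : lie_bracket (e i) (e j) x = levi_civita A (e i) (e j) x - levi_civita A (e j) (e i) x.
  rewrite /levi_civita (christoffel_sym oU sA symA posA (e i x) (e j x) Ux).
  by rewrite opprD addrACA subrr addr0.
rewrite !levi_civita_frame // -sumrB; apply: eq_bigr => m _; by rewrite scalerBl.
Qed.

(** la, and likewise mu below, is the component on Y_1 of a covariant derivative of the frame; for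
    mu a second frame vector is used. *)
Lemma smooth_la : smooth_on U la.
Proof.
have H := smooth_ip (smooth_nab o (smooth_E o)) (smooth_Y o).
apply: smooth_congr H => // x Ux; rewrite nab_E //.
by rewrite (ip_sum _ _ _ Ux).2 /cub !dl1; ring.
Qed.

Lemma smooth_mu : (0 < n)%N -> smooth_on U mu.
Proof.
move=> n0; pose i1 : 'I_n.+1 := lift o (Ordinal n0).
have H := smooth_ip (smooth_nab i1 (smooth_E i1)) (smooth_Y o).
apply: smooth_congr H => // x Ux; rewrite nab_E //.
have i1o : i1 != o by rewrite eq_sym neq_lift.
by rewrite (ip_sum _ _ _ Ux).2 /cub !dl1 (dl0 R i1o); ring.
Qed.

Section combinations.
Hypothesis n0 : (0 < n)%N.
Let sla := smooth_la.
Let smu := smooth_mu n0.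

Definition comb (p q : 'I_n.+1 -> 'rV[R]_n.+1 -> R) x : 'rV[R]_d :=
  \sum_k p k x *: E k x + \sum_k q k x *: Y k x.

Definition nabE i (p q : 'I_n.+1 -> 'rV[R]_n.+1 -> R) k x : R :=
  D i (p k) x + \sum_j (p j x * Gam i j k x - q j x * C i j k x).
Definition nabY i (p q : 'I_n.+1 -> 'rV[R]_n.+1 -> R) k x : R :=
  D i (q k) x + \sum_j (q j x * Gam i j k x + p j x * C i j k x).

Lemma nab_comb p q x i : (forall k, smooth_on U (p k)) -> (forall k, smooth_on U (q k)) ->
  U x -> nab (e i x) (comb p q) x = comb (nabE i p q) (nabY i p q) x.
Proof.
move=> sp sq Ux.
have s1 : smooth_on U (fun x => \sum_k p k x *: E k x).
  by apply: smooth_sum => // k _; apply: smooth_scale => //; exact: smooth_E.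
have s2 : smooth_on U (fun x => \sum_k q k x *: Y k x).
  by apply: smooth_sum => // k _; apply: smooth_scale => //; exact: smooth_Y.
have -> := nablaD oV sG posG FUV (e i x) s1 s2 Ux.
have -> := nabla_sum oV sG posG oU FUV (e i x) sp smooth_E Ux.
have -> := nabla_sum oV sG posG oU FUV (e i x) sq smooth_Y Ux.
rewrite /comb /nabE /nabY -frame_derivative.
by congr (_ + _); apply: eq_bigr => j _; rewrite ?nab_E ?nab_Y.
Qed.

Lemma sC (i j k : 'I_n.+1) : smooth_on U (C i j k).
Proof.
apply: smooth_add => //.
  apply: smooth_mul => //; last exact: smooth_cst.
  by apply: smooth_sub => //; apply: smooth_mul => //; exact: smooth_cst.
by apply: smooth_mul => //; exact: smooth_cst.
Qed.

Lemma ip_comb p q x l : U x ->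
  ip x (comb p q x) (E l x) = p l x /\ ip x (comb p q x) (Y l x) = q l x.
Proof. by move=> Ux; exact: (ip_sum (fun k => p k x) (fun k => q k x) l Ux). Qed.

Lemma ip_sum_comb (c : 'I_n.+1 -> R) (p q : 'I_n.+1 -> 'I_n.+1 -> 'rV[R]_n.+1 -> R) x l : U x ->
  ip x (\sum_m c m *: comb (p m) (q m) x) (E l x) = \sum_m c m * p m l x
  /\ ip x (\sum_m c m *: comb (p m) (q m) x) (Y l x) = \sum_m c m * q m l x.
Proof.
move=> Ux; rewrite !inner_suml; split; apply: eq_bigr => m _; rewrite innerZl.
  by rewrite (ip_comb (p m) (q m) l Ux).1.
by rewrite (ip_comb (p m) (q m) l Ux).2.
Qed.

Lemma curvature_E x i j k : U x ->
  curvature G (F x) (E i x) (E j x) (E k x)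
  = eps *: (dl R j k *: E i x - dl R i k *: E j x).
Proof.
move=> Ux; rewrite curvG; last exact: FUV.
exact: (curvature_tangent eps (ipEE j k Ux) (ipEE i k Ux) (ipYE j k Ux) (ipYE i k Ux) (ipEY i j Ux)).
Qed.

(** The curvature identity for E_k written in the frame; its components on E_l and on Y_l are the
    Gauss and Codazzi equations. *)
Lemma commutator_comb x i j k : U x ->
  comb (nabE i (Gam j k) (fun l => C j k l)) (nabY i (Gam j k) (fun l => C j k l)) x
  - comb (nabE j (Gam i k) (fun l => C i k l)) (nabY j (Gam i k) (fun l => C i k l)) x
  - \sum_m (Gam i j m x - Gam j i m x) *: comb (Gam m k) (fun l => C m k l) x
  = eps *: (dl R j k *: E i x - dl R i k *: E j x).
Proof.
move=> Ux; rewrite -curvature_E //.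
have H i' j' : nab (e i' x) (fun y => nab (e j' y) (E k) y) x
    = comb (nabE i' (Gam j' k) (fun l => C j' k l)) (nabY i' (Gam j' k) (fun l => C j' k l)) x.
  apply: etrans (nab_comb i' (smooth_Gam j' k) (sC j' k) Ux).
  exact: (nabla_congr G F oU (e i' x) Ux (fun y Uy => nab_E j' k Uy)).
have H3 : nab (lie_bracket (e i) (e j) x) (E k) x
    = \sum_m (Gam i j m x - Gam j i m x) *: comb (Gam m k) (fun l => C m k l) x.
  rewrite lie_bracket_frame //.
  have -> := nabla_suml oV sG symG posG oU sF FUV (fun m => Gam i j m x - Gam j i m x)
    (fun m => e m x) (smooth_E k) Ux.
  by apply: eq_bigr => m _; rewrite nab_E.
rewrite -H -H -H3.
exact: (nabla_commutator_field oV sG symG posG oU sF FUV (se i) (se j) (smooth_E k) Ux).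
Qed.

Lemma frame_gauss x : U x -> forall i j k l : 'I_n.+1,
  D i (Gam j k l) x + \sum_m (Gam j k m x * Gam i m l x - C j k m x * C i m l x)
  - (D j (Gam i k l) x + \sum_m (Gam i k m x * Gam j m l x - C i k m x * C j m l x))
  - \sum_m (Gam i j m x - Gam j i m x) * Gam m k l x
  = eps * (dl R j k * dl R i l - dl R i k * dl R j l).
Proof.
move=> Ux i j k l; have := congr1 (fun w => ip x w (E l x)) (commutator_comb i j k Ux).
rewrite /= !innerBl !(ip_comb _ _ _ Ux).1.
have -> := (ip_sum_comb (fun m => Gam i j m x - Gam j i m x) (fun m => Gam m k)
  (fun m l => C m k l) l Ux).1.
by rewrite inner_scaled_diff (ipEE i l Ux) (ipEE j l Ux).
Qed.

Lemma frame_codazzi x : U x -> forall i j k l : 'I_n.+1,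
  D i (C j k l) x + \sum_m (Gam j k m x * C i m l x + C j k m x * Gam i m l x)
  - (D j (C i k l) x + \sum_m (Gam i k m x * C j m l x + C i k m x * Gam j m l x))
  - \sum_m (Gam i j m x - Gam j i m x) * C m k l x = 0.
Proof.
move=> Ux i j k l; have := congr1 (fun w => ip x w (Y l x)) (commutator_comb i j k Ux).
rewrite /= !innerBl !(ip_comb _ _ _ Ux).2.
have -> := (ip_sum_comb (fun m => Gam i j m x - Gam j i m x) (fun m => Gam m k)
  (fun m l => C m k l) l Ux).2.
rewrite inner_scaled_diff (ipEY i l Ux) (ipEY j l Ux) !mulr0 subrr mulr0 => H; apply: etrans _ H.
by congr (_ + _ - (_ + _) - _); apply: eq_bigr => m _; rewrite addrC.
Qed.

Local Notation cE := (dtauE la mu).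
Local Notation cY := (dtauY e la mu Gam).

Lemma nab_tension x i : U x -> nab (e i x) (fun z => a z *: Y o z) x = comb (cE i) (cY i) x.
Proof.
move=> Ux; pose q k y := a y * dl R k o.
have sa : smooth_on U a by apply: smooth_add => //; apply: smooth_mul => //; exact: smooth_cst.
have sq k : smooth_on U (q k) by apply: smooth_mul => //; exact: smooth_cst.
have s0 (k : 'I_n.+1) : smooth_on U (fun=> 0 : R) by exact: smooth_cst.
have E0 y : U y -> a y *: Y o y = comb (fun _ _ => 0) q y.
  move=> Uy; rewrite /comb big1 ?add0r; last by move=> k _; rewrite scale0r.
  rewrite (bigD1 o) //= big1 ?addr0; last by move=> k ko; rewrite /q dl0 // mulr0 scale0r.
  by rewrite /q dl1 mulr1.
rewrite (nabla_congr G F oU (e i x) Ux E0) (nab_comb i s0 sq Ux).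
rewrite /comb; congr (_ + _); apply: eq_bigr => k _; congr (_ *: _).
  rewrite /nabE derive_cst add0r /dtauE -/(a x).
  rewrite -(sum_dl (fun j => a x * cub (la x) (mu x) i j k) o) -sumrN.
  by apply: eq_bigr => j _; rewrite /q; ring.
rewrite /nabY /dtauY -/(a x) -(sum_dl (fun j => a x * Gam i j k x) o); congr (_ + _).
  have da := smooth_derivable (v := e i x) sa Ux.
  by rewrite (derive_mulR da (derivable_cst _ _ _)) derive_cst mulr0 addr0 mulrC.
by apply: eq_bigr => j _; rewrite /q; ring.
Qed.

Lemma sdtauE (i k : 'I_n.+1) : smooth_on U (cE i k).
Proof.
have sa : smooth_on U a by apply: smooth_add => //; apply: smooth_mul => //; exact: smooth_cst.
by apply: smooth_opp => //; apply: smooth_mul => //; exact: sC.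
Qed.

Lemma sdtauY (i k : 'I_n.+1) : smooth_on U (cY i k).
Proof.
have sa : smooth_on U a by apply: smooth_add => //; apply: smooth_mul => //; exact: smooth_cst.
apply: smooth_add => //; apply: smooth_mul => //; first exact: smooth_cst.
  exact: smooth_dirR.
exact: smooth_Gam.
Qed.

Lemma bitension_comb x : U x ->
  \sum_i (comb (nabE i (cE i) (cY i)) (nabY i (cE i) (cY i)) x
    - \sum_m Gam i i m x *: comb (cE m) (cY m) x
    + (eps * a x) *: (Y o x + (3 * dl R i o) *: Y i x)) = 0.
Proof.
move=> Ux; rewrite -[RHS](bitens Ux); apply: eq_bigr => i _; congr (_ - _ + _).
- apply: etrans (esym (nab_comb i (sdtauE i) (sdtauY i) Ux)) _.
  exact: (nabla_congr G F oU (e i x) Ux (fun y Uy => esym (nab_tension i Uy))).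
- have sa : smooth_on U a by apply: smooth_add => //; apply: smooth_mul => //; exact: smooth_cst.
  have sT : smooth_on U (fun z => a z *: Y o z) by apply: smooth_scale => //; exact: smooth_Y.
  rewrite levi_civita_frame //.
  have -> := nabla_suml oV sG symG posG oU sF FUV (fun m => Gam i i m x) (fun m => e m x) sT Ux.
  by apply: eq_bigr => m _; rewrite nab_tension.
rewrite curvG; last exact: FUV.
have ii : ip x (E i x) (E i x) = 1 by rewrite ipEE // dl1.
have oi : ip x (E o x) (E i x) = dl R i o by rewrite ipEE // dlC.
have oi' : ip x (Y o x) (Y i x) = dl R i o by rewrite ipYY // dlC.
exact: (esym (curvature_tension eps (a x) (sqJ (FUV Ux)) ii (ipYE o i Ux) (ipYE i i Ux) oi oi')).
Qed.

Lemma frame_biharmE x : U x -> forall k,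
  \sum_i (D i (cE i k) x
    + \sum_j (cE i j x * Gam i j k x - cY i j x * C i j k x)
    - \sum_m Gam i i m x * cE m k x) = 0.
Proof.
move=> Ux k; have := congr1 (fun w => ip x w (E k x)) (bitension_comb Ux).
rewrite /= inner_suml inner0l => H; apply: etrans _ H; apply: eq_bigr => i _.
rewrite innerDl innerBl (ip_comb _ _ _ Ux).1 (ip_sum_comb _ _ _ _ Ux).1.
rewrite inner_scaled_sum (ipYE o k Ux) (ipYE i k Ux).
by rewrite !(mulr0, addr0).
Qed.

Lemma frame_biharmY x : U x -> forall k,
  \sum_i (D i (cY i k) x
    + \sum_j (cY i j x * Gam i j k x + cE i j x * C i j k x)
    - \sum_m Gam i i m x * cY m k x) + eps * (n%:R + 4) * (la x + n%:R * mu x) * dl R k o = 0.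
Proof.
move=> Ux k; have := congr1 (fun w => ip x w (Y k x)) (bitension_comb Ux).
rewrite /= inner_suml inner0l => H; apply: etrans _ H; rewrite -/(a x).
have -> : eps * (n%:R + 4) * a x * dl R k o
    = \sum_(i < n.+1) (eps * a x * dl R k o + eps * a x * 3 * dl R i k * dl R i o).
  rewrite big_split /= (sum_dl (fun i => eps * a x * 3 * dl R i k)) sumr_const card_ord.
  by rewrite -[_ *+ n.+1]mulr_natl -natr1 (dlC R k o); ring.
rewrite -big_split; apply: eq_bigr => i _ /=.
rewrite innerDl innerBl (ip_comb _ _ _ Ux).2 (ip_sum_comb _ _ _ _ Ux).2.
rewrite inner_scaled_sum (ipYY o k Ux) (ipYY i k Ux).
by congr (_ - _ + _); rewrite (dlC R o k); ring.
Qed.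

Theorem frame_shape_constant x i : U x -> D i (fun y => (la y + n%:R * mu y) ^+ 2) x = 0.
Proof.
move=> Ux.
exact: (derive_shape_sqr n0 oU se sla smu smooth_Gam Gam_anti frame_codazzi frame_gauss
  frame_biharmE frame_biharmY).
Qed.

Theorem frame_shape_locally_constant (x : 'rV[R]_n.+1) : U x ->
  \forall y \near x, (la y + n%:R * mu y) ^+ 2 = (la x + n%:R * mu x) ^+ 2.
Proof.
move=> Ux; pose g y := (la y + n%:R * mu y) ^+ 2.
have sg : smooth_on U g.
  have sa : smooth_on U (fun y => la y + n%:R * mu y).
    by apply: smooth_add => //; apply: smooth_mul => //; exact: smooth_cst.
  have saa := smooth_mul oU sa sa.
  by apply: smooth_congr saa => // y _; rewrite /g expr2.
apply: (derive0_locally_constant oU sg _ Ux) => z v Uz.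
by apply: (derive0_orthonormal v oU sg Uz (oe Uz)) => i; exact: (frame_shape_constant i Uz).
Qed.
End combinations.
End frame.

(** * The second fundamental form *)

Lemma nabla_alongE (R : realType) (m d : nat) (G : 'rV[R]_d -> 'M[R]_d)
    (F : 'rV[R]_m -> 'rV[R]_d) (u : 'rV[R]_m) (Y : 'rV[R]_m -> 'rV[R]_d) x :
  nabla_along G F u Y x = 'D_u Y x + christoffel G (F x) ('D_u F x) (Y x).
Proof. by []. Qed.
Opaque inner derive christoffel nabla_along curvature.

Lemma lincomb_sub (R : realType) (W : lmodType R) (b : R) (p q r s : W) :
  b *: p + q - (b *: r + s) = b *: (p - r) + (q - s).
Proof. by rewrite scalerBr opprD addrACA. Qed.

Section second_fundamental_form.
Variables (R : realType) (m d : nat) (V : set 'rV[R]_d) (G : 'rV[R]_d -> 'M[R]_d).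
Hypotheses (oV : open V) (sG : smooth_on V G)
  (symG : forall y, V y -> (G y)^T = G y)
  (posG : forall y, V y -> forall u, u != 0 -> 0 < inner (G y) u u).
Variables (U : set 'rV[R]_m) (F : 'rV[R]_m -> 'rV[R]_d) (A : 'rV[R]_m -> 'M[R]_m).
Hypotheses (oU : open U) (sF : smooth_on U F) (FUV : forall x, U x -> V (F x)).
Hypotheses (sA : smooth_on U A) (symA : forall x, U x -> (A x)^T = A x)
  (posA : forall x, U x -> forall u, u != 0 -> 0 < inner (A x) u u).
Hypothesis isoF : forall x, U x -> forall u v : 'rV[R]_m,
  inner (G (F x)) ('D_u F x) ('D_v F x) = inner (A x) u v.

Definition sff (x u v : 'rV[R]_m) : 'rV[R]_d :=
  nabla_along G F u (fun y => 'D_v F y) x - 'D_(christoffel A x u v) F x.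

Lemma sff_sym (x u v : 'rV[R]_m) : U x -> sff x u v = sff x v u.
Proof.
move=> Ux; have E1 := nabla_dF_sym oV sG symG posG oU sF FUV u v Ux.
have E2 := christoffel_sym oU sA symA posA u v Ux.
exact: (congr2 (fun a b => a - 'D_b F x) E1 E2).
Qed.

Lemma sff_linl (x u v w : 'rV[R]_m) b : U x -> sff x (b *: u + v) w = b *: sff x u w + sff x v w.
Proof.
move=> Ux; rewrite /sff.
have -> := nabla_linl oV sG symG posG oU sF FUV b u v (smooth_derive w sF) Ux.
rewrite (christoffel_linl oU sA symA posA w u v b Ux).
rewrite (derive_is_linear (smooth_differentiable oU sF Ux)).
exact: lincomb_sub.
Qed.

(** The products S are symmetric in the first two arguments, and the isometry condition gives the
    derivative of <b, c> along a as S a b c + S a c b. The Koszul formula for the metric of M then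
    evaluates to S u v w, the term subtracted in [sff]. *)
Lemma sff_normal (x u v w : 'rV[R]_m) : U x -> inner (G (F x)) (sff x u v) ('D_w F x) = 0.
Proof.
move=> Ux.
pose S (a b c : 'rV[R]_m) := inner (G (F x)) (nabla_along G F a (fun y => 'D_b F y) x) ('D_c F x).
have Ssym (a b c : 'rV[R]_m) : S a b c = S b a c.
  by rewrite /S (nabla_dF_sym oV sG symG posG oU sF FUV).
have Sd (a b c : 'rV[R]_m) : inner ('D_a A x) b c = S a b c + S a c b.
  rewrite -(derive_inner_cst oU sA a b c Ux).
  rewrite (derive_congr (g := fun y => inner (G (F y)) ('D_b F y) ('D_c F y)) a oU Ux); last first.
    by move=> y Uy; rewrite isoF.
  have -> := nabla_metric oV sG symG posG oU sF FUV a (smooth_derive b sF) (smooth_derive c sF) Ux.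
  by congr (_ + _); rewrite inner_sym //; apply: symG; exact: FUV.
rewrite /sff innerBl isoF // (christoffel_koszul oU sA posA u v w Ux) !Sd.
rewrite -/(S u v w) (Ssym v u w) (Ssym w u v) (Ssym w v u).
by move: (S u v w) (S u w v) (S v w u) => p q r; field.
Qed.
Opaque sff.

Lemma sff0l (x w : 'rV[R]_m) : U x -> sff x 0 w = 0.
Proof. by move=> Ux; have := sff_linl 0 0 w (-1) Ux; rewrite scaler0 addr0 scaleN1r addNr. Qed.

Lemma sff_suml x k (c : 'I_k -> R) (b : 'I_k -> 'rV[R]_m) (w : 'rV[R]_m) : U x ->
  sff x (\sum_i c i *: b i) w = \sum_i c i *: sff x (b i) w.
Proof.
move=> Ux; elim/big_rec2: _ => [|i y1 y2 _ <-]; first exact: sff0l.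
exact: sff_linl.
Qed.

Lemma sff_sumr x k (c : 'I_k -> R) (b : 'I_k -> 'rV[R]_m) (w : 'rV[R]_m) : U x ->
  sff x w (\sum_i c i *: b i) = \sum_i c i *: sff x w (b i).
Proof.
move=> Ux; apply: etrans (sff_sym _ _ Ux) _; apply: etrans (sff_suml _ _ _ Ux) _.
by apply: eq_bigr => i _; exact: (congr1 (fun z => c i *: z) (sff_sym (b i) w Ux)).
Qed.

(** For an orthonormal basis the inverse metric is the sum of the matrices b_k^T b_k, as the
    expansion of [delta_mx 0 j *m invmx (A x)] shows. *)
Lemma sff_trace x (b : 'I_m -> 'rV[R]_m) : U x ->
  (forall i j, inner (A x) (b i) (b j) = (i == j)%:R) ->
  \sum_i \sum_j invmx (A x) i j *: sff x (delta_mx 0 i) (delta_mx 0 j)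
  = \sum_k sff x (b k) (b k).
Proof.
move=> Ux ob; have uA := posdef_unit (posA Ux).
have -> : \sum_k sff x (b k) (b k)
    = \sum_k \sum_i \sum_j (b k 0 i * b k 0 j) *: sff x (delta_mx 0 i) (delta_mx 0 j).
  apply: eq_bigr => k _; rewrite {1}[b k]row_sum_delta.
  apply: etrans (sff_suml _ _ _ Ux) _; apply: eq_bigr => i _.
  rewrite [X in sff x _ X]row_sum_delta.
  have -> := sff_sumr (fun j => b k 0 j) (fun j => delta_mx 0 j) (delta_mx 0 i) Ux.
  by rewrite scaler_sumr; apply: eq_bigr => j _; rewrite scalerA.
rewrite [RHS]exchange_big; apply: eq_bigr => i _; rewrite [RHS]exchange_big; apply: eq_bigr => j _ /=.
rewrite -scaler_suml; congr (_ *: _).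
have E : delta_mx 0 j *m invmx (A x) = \sum_k b k 0 j *: b k.
  rewrite {1}(orthonormal_expansion (delta_mx 0 j *m invmx (A x)) ob); apply: eq_bigr => k _.
  congr (_ *: _); rewrite inner_mulmx mulmxKV // mxE (bigD1 j) //= big1 ?addr0.
    by rewrite !mxE !eqxx mul1r.
  by move=> l lj; rewrite !mxE (negbTE lj) andbF mul0r.
have iA : (invmx (A x))^T = invmx (A x) by rewrite trmx_inv symA.
have := congr1 (fun w : 'rV[R]_m => w 0 i) E; rewrite -rowE summxE mxE => H.
by rewrite -iA mxE H; apply: eq_bigr => k _; rewrite mxE mulrC.
Qed.

End second_fundamental_form.

Lemma derive_dirDB (R : realType) (W W' : normedModType R) (F : W -> W') (x u v w : W) :
  differentiable F x -> 'D_(u + v - w) F x = 'D_u F x + 'D_v F x - 'D_w F x.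
Proof. by move=> dF; rewrite !deriveE // linearB linearD. Qed.

Lemma addr_insert (W : zmodType) (p q r s : W) : p + q - s = p - r + (q + r - s).
Proof. by rewrite [in RHS]addrA; congr (_ - _); rewrite addrACA addNr addr0. Qed.

Lemma derive_dir_comp (R : realType) m k p q (U0 : set 'rV[R]_k) (U : set 'rV[R]_m)
  (phi : 'rV[R]_k -> 'rV[R]_m) (F : 'rV[R]_m -> 'M[R]_(p, q))
  (Y : 'rV[R]_k -> 'rV[R]_m) (x u : 'rV[R]_k) :
  open U0 -> open U -> smooth_on U0 phi -> (forall x, U0 x -> U (phi x)) ->
  smooth_on U F -> smooth_on U0 Y -> U0 x ->
  'D_u (fun y => 'D_(Y y) F (phi y)) x
  = 'D_('D_u phi x) (fun z => 'D_(Y x) F z) (phi x) + 'D_('D_u Y x) F (phi x).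
Proof.
move=> oU0 oU sphi phiU sF sY Ux.
have E (w : 'rV[R]_m) z : U z -> 'D_w F z = \sum_i w 0 i *: 'D_(delta_mx 0 i) F z.
  by move=> Uz; rewrite {1}[w]row_sum_delta derive_lincomb //; exact: smooth_differentiable Uz.
have sFi i : smooth_on U (fun z => 'D_(delta_mx 0 i) F z) by exact: smooth_derive.
have dFi i := smooth_derivable (v := u) (smooth_comp oU0 oU phiU sphi (sFi i)) Ux.
have dY i := smooth_derivable (v := u) ((smooth_mxP oU0 Y).1 sY 0 i) Ux.
have dYF i : derivable (fun y => Y y 0 i *: 'D_(delta_mx 0 i) F (phi y)) x u.
  apply: smooth_derivable Ux; apply: smooth_scale => //; first exact: (smooth_mxP oU0 Y).1.
  exact: (smooth_comp oU0 oU phiU sphi (sFi i)).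
have E1 : 'D_u (fun y => 'D_(Y y) F (phi y)) x
    = 'D_u (fun y => \sum_i Y y 0 i *: 'D_(delta_mx 0 i) F (phi y)) x.
  by apply: (derive_congr u oU0 Ux) => y Uy; apply: E; exact: phiU.
have E2 : 'D_('D_u phi x) (fun z => 'D_(Y x) F z) (phi x)
    = \sum_i Y x 0 i *: 'D_('D_u phi x) (fun z => 'D_(delta_mx 0 i) F z) (phi x).
  rewrite (derive_congr ('D_u phi x) oU (phiU x Ux) (E (Y x))) derive_sumf.
    by apply: eq_bigr => i _; apply: deriveZ; exact: smooth_derivable (phiU x Ux).
  by move=> i; apply: derivableZ; exact: smooth_derivable (phiU x Ux).
rewrite E1 E2 (E ('D_u Y x) _ (phiU x Ux)) (derive_sumf dYF) -big_split.
apply: eq_bigr => i _ /=.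
rewrite (derive_scale (dY i) (dFi i)) (derive_coord _ _ (smooth_derivable sY Ux)) addrC.
have E3 := derive_comp u (smooth_differentiable oU0 sphi Ux)
  (smooth_differentiable oU (sFi i) (phiU x Ux)).
exact: (congr1 (fun w => ('D_u Y x) 0 i *: 'D_(delta_mx 0 i) F (phi x) + Y x 0 i *: w) E3).
Qed.

(** * Invariance under a change of chart of M *)

Section chart_change.
Variables (R : realType) (m d : nat) (V : set 'rV[R]_d) (G : 'rV[R]_d -> 'M[R]_d).
Hypotheses (oV : open V) (sG : smooth_on V G)
  (symG : forall y, V y -> (G y)^T = G y)
  (posG : forall y, V y -> forall u, u != 0 -> 0 < inner (G y) u u).
Variables (U : set 'rV[R]_m) (F : 'rV[R]_m -> 'rV[R]_d) (A : 'rV[R]_m -> 'M[R]_m).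
Hypotheses (oU : open U) (sF : smooth_on U F) (FUV : forall x, U x -> V (F x)).
Hypotheses (sA : smooth_on U A) (symA : forall x, U x -> (A x)^T = A x)
  (posA : forall x, U x -> forall u, u != 0 -> 0 < inner (A x) u u).
Hypothesis isoF : forall x, U x -> forall u v : 'rV[R]_m,
  inner (G (F x)) ('D_u F x) ('D_v F x) = inner (A x) u v.
Variables (U0 : set 'rV[R]_m) (F0 : 'rV[R]_m -> 'rV[R]_d) (A0 : 'rV[R]_m -> 'M[R]_m).
Hypotheses (oU0 : open U0) (sF0 : smooth_on U0 F0) (F0UV : forall x, U0 x -> V (F0 x)).
Hypotheses (sA0 : smooth_on U0 A0) (symA0 : forall x, U0 x -> (A0 x)^T = A0 x)
  (posA0 : forall x, U0 x -> forall u, u != 0 -> 0 < inner (A0 x) u u).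
Hypothesis isoF0 : forall x, U0 x -> forall u v : 'rV[R]_m,
  inner (G (F0 x)) ('D_u F0 x) ('D_v F0 x) = inner (A0 x) u v.
Variable phi : 'rV[R]_m -> 'rV[R]_m.
Hypotheses (sphi : smooth_on U0 phi) (phiU : forall x, U0 x -> U (phi x))
  (F0E : forall x, U0 x -> F0 x = F (phi x)).

Lemma derive_chart_change x u : U0 x -> 'D_u F0 x = 'D_('D_u phi x) F (phi x).
Proof.
move=> Ux; rewrite (derive_congr u oU0 Ux F0E).
exact: (derive_comp u (smooth_differentiable oU0 sphi Ux) (smooth_differentiable oU sF (phiU Ux))).
Qed.

(** In either chart the metric is induced by the immersion, and both sides are the ambient product
    of the same two vectors. *)
Lemma metric_chart_change x u v : U0 x ->
  inner (A (phi x)) ('D_u phi x) ('D_v phi x) = inner (A0 x) u v.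
Proof.
move=> Ux; rewrite -(isoF0 Ux) (derive_chart_change u Ux) (derive_chart_change v Ux) (F0E Ux).
by rewrite (isoF (phiU Ux)).
Qed.

(* By the chain rule the two sides differ by a tangent vector, and both are normal. *)
Lemma sff_chart_change x (b : 'I_m -> 'rV[R]_m) u v : U0 x ->
  (forall i j, inner (A0 x) (b i) (b j) = (i == j)%:R) ->
  sff G F0 A0 x u v = sff G F A (phi x) ('D_u phi x) ('D_v phi x).
Proof.
move=> Ux ob; have Upx := phiU Ux.
pose z := 'D_u (fun y => 'D_v phi y) x + christoffel A (phi x) ('D_u phi x) ('D_v phi x)
  - 'D_(christoffel A0 x u v) phi x.
have N : nabla_along G F0 u (fun y => 'D_v F0 y) x
    = nabla_along G F ('D_u phi x) (fun y => 'D_('D_v phi x) F y) (phi x)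
      + 'D_('D_u (fun y => 'D_v phi y) x) F (phi x).
  rewrite [LHS]nabla_alongE (derive_congr u oU0 Ux (fun y Uy => derive_chart_change v Uy)).
  have -> := derive_dir_comp u oU0 oU sphi phiU sF (smooth_derive v sphi) Ux.
  rewrite (derive_chart_change u Ux) (derive_chart_change v Ux) (F0E Ux).
  by rewrite [in RHS]nabla_alongE addrAC.
have D : sff G F0 A0 x u v
    = sff G F A (phi x) ('D_u phi x) ('D_v phi x) + 'D_z F (phi x).
  have Ez := derive_dirDB ('D_u (fun y => 'D_v phi y) x)
    (christoffel A (phi x) ('D_u phi x) ('D_v phi x)) ('D_(christoffel A0 x u v) phi x)
    (smooth_differentiable oU sF Upx).
  have EG := derive_chart_change (christoffel A0 x u v) Ux.
  apply: etrans (congr2 (fun a b => a - b) N EG) _; rewrite /z Ez.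
  exact: addr_insert.
have oc i j : inner (A (phi x)) ('D_(b i) phi x) ('D_(b j) phi x) = (i == j)%:R.
  by rewrite metric_chart_change.
(* The differential of phi maps an orthonormal basis to one, so it reaches z. The tangent vector by
   which the two sides differ is thus tangent in both charts and orthogonal to both second forms. *)
have [w zE] : exists w, z = 'D_w phi x.
  exists (\sum_k inner (A (phi x)) z ('D_(b k) phi x) *: b k).
  rewrite {1}(orthonormal_expansion z oc) derive_lincomb //.
  exact: (smooth_differentiable oU0 sphi Ux).
have DzF : 'D_z F (phi x) = 'D_w F0 x by rewrite (derive_chart_change w Ux) -zE.
have n0 := sff_normal oV sG symG posG oU0 sF0 F0UV sA0 posA0 isoF0 u v w Ux.
have n1 := sff_normal oV sG symG posG oU sF FUV sA posA isoF ('D_u phi x) ('D_v phi x) z Upx.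
rewrite -(F0E Ux) in n1; rewrite -DzF in n0.
suff Dz0 : 'D_z F (phi x) = 0 by rewrite D Dz0 addr0.
apply: (posdef_eq0 (posG (F0UV Ux))).
by move: n0; rewrite D innerDl n1 add0r.
Qed.
End chart_change.

(** * Charts *)

Opaque inner derive christoffel nabla_along curvature.

Transparent sff.
Local Notation coord := Defs.coord.

Section chart_topology.
Variables (R : realType) (T : topologicalType) (n : nat) (c : chart R T n).

Lemma open_coord_image (B : set T) : open B -> B `<=` dom c -> open (coord c @` B).
Proof.
move=> oB Bc; rewrite openE => _ [p Bp <-]; have cp := Bc p Bp.
have nB : nbhs (param c (coord c p)) B.
  by rewrite coordK //; exact: open_nbhs_nbhs.
have nc : nbhs (coord c p) (coord c @` dom c).
  by apply: open_nbhs_nbhs; split; [exact: image_open|exists p].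
have nI : nbhs (coord c p) ((param c @^-1` B) `&` (coord c @` dom c)).
  by apply: filterI => //; exact: (param_continuous cp).
by apply: filterS nI => y [By [q cq qy]]; exists q => //; move: By; rewrite -qy /= coordK.
Qed.

Lemma near_coord (P : 'rV[R]_n -> Prop) p : dom c p ->
  (\forall y \near coord c p, P y) -> \forall q \near p, P (coord c q).
Proof. by move=> cp; exact: (Defs.coord_continuous cp). Qed.

Lemma near_dom p : dom c p -> \forall q \near p, dom c q.
Proof. by move=> cp; apply: open_nbhs_nbhs; split=> //; exact: dom_open. Qed.
End chart_topology.

Section charts.
Variables (R : realType) (n : nat).
Variables (M : riemannian_manifold R n).

Lemma metric_sym_on c : atlas c -> forall x : 'rV[R]_n, (coord c @` dom c) x ->
  (metric (r := M) c x)^T = metric (r := M) c x.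
Proof. by move=> ac _ [p cp <-]; exact: (Defs.metric_sym (p := p)). Qed.

Lemma metric_pos_on c : atlas c -> forall x : 'rV[R]_n, (coord c @` dom c) x ->
  forall u : 'rV[R]_n, u != 0 -> 0 < inner (metric (r := M) c x) u u.
Proof. by move=> ac _ [p cp <-] u; exact: (Defs.metric_pos (p := p)). Qed.
End charts.

(** * The second form and the tension field in charts *)

Section immersion.
Variables (R : realType) (m n : nat).
Variables (M : riemannian_manifold R m) (N : riemannian_manifold R n) (f : M -> N).
Hypothesis hf : isometric_immersion f.
Implicit Types (c : chart R M m) (d : chart R N n) (p : M) (x u v : 'rV[R]_m).

Lemma open_local_dom_cap (B : set M) c d : open B -> B `<=` dom c ->
  open (coord c @` (B `&` f @^-1` dom d)).
Proof.
move=> oB Bc; apply: open_coord_image => [|p [/Bc]//].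
apply: openI => //; apply: open_comp; last exact: dom_open.
by move=> p _; exact: hf.1.1.
Qed.

Lemma open_local_dom c d : open (local_dom f c d).
Proof. by apply: open_local_dom_cap => //; exact: dom_open. Qed.

Lemma local_dom_sub c d : local_dom f c d `<=` coord c @` dom c.
Proof. by move=> _ [p [cp _] <-]; exists p. Qed.

Lemma local_map_coord c d p : dom c p -> local_map f c d (coord c p) = coord d (f p).
Proof. by move=> cp; rewrite /local_map coordK. Qed.

Lemma local_map_dom c d x : local_dom f c d x -> (coord d @` dom d) (local_map f c d x).
Proof. by move=> [p [cp dp] <-]; exists (f p) => //; rewrite local_map_coord. Qed.

Lemma metric_smooth_local c d : atlas c ->
  smooth_on (local_dom f c d) (metric (r := M) c).
Proof. by move=> ac; apply: smooth_sub_set (@local_dom_sub c d) (metric_smooth ac). Qed.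

Lemma metric_sym_local c d : atlas c -> forall x : 'rV[R]_m, local_dom f c d x ->
  (metric (r := M) c x)^T = metric (r := M) c x.
Proof. by move=> ac x Ux; apply: (metric_sym_on ac); exact: local_dom_sub Ux. Qed.

Lemma metric_pos_local c d : atlas c -> forall x : 'rV[R]_m, local_dom f c d x ->
  forall u : 'rV[R]_m, u != 0 -> 0 < inner (metric (r := M) c x) u u.
Proof. by move=> ac x Ux; apply: (metric_pos_on ac); exact: local_dom_sub Ux. Qed.

Lemma isometry_local c d : atlas c -> atlas d -> forall x : 'rV[R]_m, local_dom f c d x ->
  forall u v : 'rV[R]_m,
  inner (metric d (local_map f c d x)) ('D_u (local_map f c d) x) ('D_v (local_map f c d) x)
  = inner (metric c x) u v.
Proof.
move=> ac ad _ [p [cp dp] <-] u v; rewrite local_map_coord //.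
exact: (hf.2 p c d (conj ac cp) (conj ad dp)).
Qed.

Lemma second_form_sym c d x u v : atlas c -> atlas d -> local_dom f c d x ->
  second_form f c d x u v = second_form f c d x v u.
Proof.
move=> ac ad Ux.
exact: (sff_sym (@image_open _ _ _ d) (metric_smooth ad) (metric_sym_on ad) (metric_pos_on ad)
  (@open_local_dom c d) (hf.1.2 c d ac ad) (@local_map_dom c d) (@metric_smooth_local c d ac)
  (metric_sym_local ac) (metric_pos_local ac) u v Ux).
Qed.

Lemma tension_trace c d x (b : 'I_m -> 'rV[R]_m) : atlas c -> atlas d -> local_dom f c d x ->
  (forall i j, inner (metric c x) (b i) (b j) = (i == j)%:R) ->
  tension f c d x = \sum_k second_form f c d x (b k) (b k).
Proof.
move=> ac ad Ux ob.
exact: (sff_trace (@image_open _ _ _ d) (metric_smooth ad) (metric_sym_on ad) (metric_pos_on ad)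
  (@open_local_dom c d) (hf.1.2 c d ac ad) (@local_map_dom c d) (@metric_smooth_local c d ac)
  (metric_sym_local ac) (metric_pos_local ac) Ux ob).
Qed.

(** The chart d of the target is the same on both sides, so the two values are rows in the same
    coordinates; an orthonormal basis for c0 is carried by the transition to one for c. *)
Lemma tension_chart c0 c d p (b : 'I_m -> 'rV[R]_m) :
  charts_at p c0 -> charts_at p c -> charts_at (f p) d ->
  (forall i j, inner (metric c0 (coord c0 p)) (b i) (b j) = (i == j)%:R) ->
  tension f c d (coord c p) = tension f c0 d (coord c0 p).
Proof.
move=> [ac0 cp0] [ac cp] [ad dp] ob.
pose U0 := coord c0 @` ((dom c0 `&` dom c) `&` f @^-1` dom d).
have U0x : U0 (coord c0 p) by exists p.
have sub0 : U0 `<=` local_dom f c0 d by move=> _ [q [[c0q cq] dq] <-]; exists q.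
have oU0 : open U0.
  by apply: open_local_dom_cap => [|q []//]; apply: openI; exact: dom_open.
have sphi : smooth_on U0 (transition c0 c).
  apply: smooth_sub_set (atlas_compatible ac0 ac) => _ [q [[c0q cq] dq] <-].
  by exists q.
have phiU x : U0 x -> local_dom f c d (transition c0 c x).
  by move=> [q [[c0q cq] dq] <-]; exists q => //; rewrite /transition coordK.
have F0E x : U0 x -> local_map f c0 d x = local_map f c d (transition c0 c x).
  by move=> [q [[c0q cq] dq] <-]; rewrite /local_map /transition !coordK.
have phip : transition c0 c (coord c0 p) = coord c p by rewrite /transition coordK.
have iso0 x : U0 x -> forall u v : 'rV[R]_m,
    inner (metric d (local_map f c0 d x)) ('D_u (local_map f c0 d) x)
      ('D_v (local_map f c0 d) x) = inner (metric c0 x) u v.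
  by move=> /sub0; exact: isometry_local.
have sF0 := smooth_sub_set sub0 (hf.1.2 c0 d ac0 ad).
have sA0 := smooth_sub_set sub0 (@metric_smooth_local c0 d ac0).
have ob' i j : inner (metric c (coord c p)) ('D_(b i) (transition c0 c) (coord c0 p))
    ('D_(b j) (transition c0 c) (coord c0 p)) = (i == j)%:R.
  rewrite -phip -ob.
  exact: (metric_chart_change (@open_local_dom c d) (hf.1.2 c d ac ad) (isometry_local ac ad)
    oU0 iso0 sphi phiU F0E (b i) (b j) U0x).
have Up : local_dom f c d (coord c p) by exists p.
rewrite (tension_trace ac ad Up ob') (tension_trace ac0 ad (sub0 _ U0x) ob).
apply: eq_bigr => k _; apply: esym; rewrite -phip.
exact: (sff_chart_change (@image_open _ _ _ d) (metric_smooth ad) (metric_sym_on ad)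
  (metric_pos_on ad) (@open_local_dom c d) (hf.1.2 c d ac ad) (@local_map_dom c d)
  (@metric_smooth_local c d ac) (metric_pos_local ac) (isometry_local ac ad)
  oU0 sF0 (fun x Ux => local_map_dom (sub0 x Ux)) sA0
  (fun x Ux => metric_pos_local ac0 (sub0 x Ux)) iso0 sphi phiU F0E (b k) (b k) U0x ob).
Qed.
End immersion.

Lemma sum_umbilical (R : realType) (W : lmodType R) m (la mu : R) (h : 'I_m.+1 -> W) (y : W) :
  h ord0 = la *: y -> (forall j, j != ord0 -> h j = mu *: y) ->
  \sum_k h k = (la + m%:R * mu) *: y.
Proof.
move=> h0 h1; rewrite big_ord_recl h0 scalerDl; congr (_ + _).
rewrite (eq_bigr (fun _ => mu *: y)) => [|i _]; last exact: h1.
by rewrite sumr_const card_ord -scaler_nat scalerA.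
Qed.

Lemma sum_cub_scale (R : realType) (W : lmodType R) m (la mu : R) (Y : 'I_m.+1 -> W) i j :
  \sum_k cub la mu i j k *: Y k
  = ((la - 3 * mu) * (dl R i ord0 * dl R j ord0) + mu * dl R i j) *: Y ord0
    + (mu * dl R i ord0) *: Y j + (mu * dl R j ord0) *: Y i.
Proof.
have S (c : R) l : c *: Y l = \sum_k (c * dl R k l) *: Y k.
  rewrite (bigD1 l) //= dl1 mulr1 big1 ?addr0 // => k kl.
  by rewrite dl0 // mulr0 scale0r.
rewrite !S -!big_split; apply: eq_bigr => k _ /=; rewrite -!scalerDl /cub.
by congr (_ *: _); rewrite (dlC R j k) (dlC R i k); ring.
Qed.

Lemma umbilical_form (R : realType) (W : lmodType R) m (la mu : R) (Y : 'I_m.+1 -> W)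
    (h : 'I_m.+1 -> 'I_m.+1 -> W) :
  (forall i j, h i j = h j i) ->
  [/\ h ord0 ord0 = la *: Y ord0,
      forall j, j != ord0 -> h j j = mu *: Y ord0,
      forall j, j != ord0 -> h ord0 j = mu *: Y j &
      forall j k, j != ord0 -> k != ord0 -> j != k -> h j k = 0] ->
  forall i j, h i j = \sum_k cub la mu i j k *: Y k.
Proof.
move=> hC [h00 hjj h0j hjk] i j; rewrite sum_cub_scale.
have [-> {i}|i0] := eqVneq i ord0; have [-> {j}|j0] := eqVneq j ord0.
- rewrite h00 !dl1 !mulr1 -!scalerDl; congr (_ *: _); ring.
- rewrite (h0j j j0) !dl1 (dl0 R j0) (dlC R ord0 j) (dl0 R j0).
  by rewrite !mulr0 !mulr1 addr0 !scale0r add0r addr0.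
- rewrite hC (h0j i i0) !dl1 (dl0 R i0).
  by rewrite !(mulr0, mul0r) !mulr1 addr0 !scale0r !add0r.
- rewrite !(dl0 R i0, dl0 R j0) !(mulr0, mul0r) !scale0r add0r !addr0.
  have [<-|ij] := eqVneq i j; first by rewrite hjj // dl1 mulr1.
  by rewrite hjk // dl0 // mulr0 scale0r.
Qed.

(** * Local constancy of the mean curvature *)

Section umbilical.
Variables (R : realType) (n : nat) (eps : R).
Variables (M : riemannian_manifold R n.+1) (N : kaehler_manifold R n.+1) (f : M -> N).
Hypotheses (n0 : (0 < n)%N) (hN : complex_space_form eps N)
  (hf : lagrangian_H_umbilical f) (hbi : biharmonic f).
Implicit Types (c : chart R M n.+1) (d : chart R N (2 * n.+1)) (p q : M).

Let iso : isometric_immersion f.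
Proof. by case: hf. Qed.

Let lag : lagrangian f.
Proof. by case: hf. Qed.

Section frame_chart.
Variables (c : chart R M n.+1) (W : set M) (e : 'I_n.+1 -> 'rV[R]_n.+1 -> 'rV[R]_n.+1)
  (lam mu : M -> R).
Hypotheses (ac : atlas c) (oW : open W) (Wc : W `<=` dom c)
  (fe : orthonormal_frame c (coord c @` W) e).
Hypothesis he : forall q d, W q -> charts_at (f q) d ->
  let x := coord c q in
  let h := fun i j => second_form f c d x (e i x) (e j x) in
  let Je := fun i =>
    'D_(e i x) (local_map f c d) x *m cplx d (coord d (f q)) in
  forall i1 : 'I_n.+1, i1 = 0%N :> nat ->
  [/\ h i1 i1 = lam q *: Je i1,
      forall j, j != i1 -> h j j = mu q *: Je i1,
      forall j, j != i1 -> h i1 j = mu q *: Je j &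
      forall j k, j != i1 -> k != i1 -> j != k -> h j k = 0].

Let a q := lam q + n%:R * mu q.

Lemma tension_umbilical q d : W q -> charts_at (f q) d ->
  tension f c d (coord c q)
  = a q *: ('D_(e ord0 (coord c q)) (local_map f c d) (coord c q) *m cplx d (coord d (f q))).
Proof.
move=> Wq [ad dq]; have Ux : local_dom f c d (coord c q) by exists q => //; split=> //; exact: Wc.
have ox i j : inner (metric c (coord c q)) (e i (coord c q)) (e j (coord c q)) = (i == j)%:R.
  by apply: fe.2; exists q.
rewrite (tension_trace iso ac ad Ux ox).
have [h00 hjj _ _] := he Wq (conj ad dq) (erefl : (ord0 : 'I_n.+1) = 0%N :> nat).
exact: (sum_umbilical h00 hjj).
Qed.

(** J is isometric and e_1 a unit vector, so the tension a J e_1 has norm |a|, a quantity attached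
    to the point alone. *)
Lemma mean_curvature_umbilical q c' d : W q -> charts_at q c' -> charts_at (f q) d ->
  mean_curvature f c' d q = Num.sqrt (n.+1%:R^-1 ^+ 2 * a q ^+ 2).
Proof.
move=> Wq c'q dq; have cq : charts_at q c by split=> //; exact: Wc.
have ox i j : inner (metric c (coord c q)) (e i (coord c q)) (e j (coord c q)) = (i == j)%:R.
  by apply: fe.2; exists q.
rewrite /mean_curvature /mean_curvature_vector (tension_chart iso cq c'q dq ox).
rewrite (tension_umbilical Wq dq) scalerA innerZl innerZr.
rewrite (cplx_isometry dq) (iso.2 q c d cq dq) ox eqxx mulr1.
by congr Num.sqrt; ring.
Qed.

Lemma shape_sqr_locally_constant p : W p -> \forall q \near p, a q ^+ 2 = a p ^+ 2.
Proof.
move=> Wp; have [d ad dp] := atlas_cover (f p).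
pose U := coord c @` (W `&` f @^-1` dom d).
have oU : open U by exact: (open_local_dom_cap iso).
have sub : U `<=` local_dom f c d.
  by move=> _ [q [Wq dq] <-]; exists q => //; split=> //; exact: Wc.
have subW : U `<=` coord c @` W by move=> _ [q [Wq dq] <-]; exists q.
pose F : 'rV[R]_n.+1 -> 'rV[R]_(2 * n.+1) := local_map f c d.
pose la (x : 'rV[R]_n.+1) := lam (param c x); pose mu' (x : 'rV[R]_n.+1) := mu (param c x).
have se i : smooth_on U (e i) by exact: smooth_sub_set subW (fe.1 i).
have oe x : U x -> forall i j, inner (metric c x) (e i x) (e j x) = (i == j)%:R.
  by move=> /subW; exact: fe.2.
have Ux : U (coord c p) by exists p.
have parJ (y : 'rV[R]_(2 * n.+1)) : (coord d @` dom d) y -> forall u w : 'rV[R]_(2 * n.+1),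
    levi_civita (metric d) (cst u) (fun z => w *m cplx d z) y
    = levi_civita (metric d) (cst u) (cst w) y *m cplx d y.
  by move=> [q dq <-] u w; exact: (cplx_parallel (conj ad dq)).
have sqJ (y : 'rV[R]_(2 * n.+1)) : (coord d @` dom d) y -> cplx d y *m cplx d y = - 1%:M.
  by move=> [q dq <-]; exact: (cplx_square (conj ad dq)).
have isoJ (y : 'rV[R]_(2 * n.+1)) : (coord d @` dom d) y -> forall u v : 'rV[R]_(2 * n.+1),
    inner (metric d y) (u *m cplx d y) (v *m cplx d y) = inner (metric d y) u v.
  by move=> [q dq <-]; exact: (cplx_isometry (conj ad dq)).
have curvG (y : 'rV[R]_(2 * n.+1)) : (coord d @` dom d) y -> forall X Y Z : 'rV[R]_(2 * n.+1),
    curvature (metric d) y X Y Z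
    = eps *: (inner (metric d y) Y Z *: X - inner (metric d y) X Z *: Y
        + inner (metric d y) (Y *m cplx d y) Z *: (X *m cplx d y)
        - inner (metric d y) (X *m cplx d y) Z *: (Y *m cplx d y)
        + (2 * inner (metric d y) X (Y *m cplx d y)) *: (Z *m cplx d y)).
  by move=> [q dq <-] X Y Z; exact: (hN (conj ad dq)).
have lagF x : U x -> forall u v : 'rV[R]_n.+1,
    inner (metric d (F x)) ('D_u F x *m cplx d (F x)) ('D_v F x) = 0.
  move=> [q [Wq dq] <-] u v; rewrite /F local_map_coord; last exact: Wc.
  have [JT _] := lag (conj ac (Wc Wq)) (conj ad dq).
  have : Defs.normal_space f c d q ('D_u (local_map f c d) (coord c q) *m cplx d (coord d (f q))).
    by rewrite -JT; exists ('D_u (local_map f c d) (coord c q)) => //; exists u.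
  by apply; exists v.
have formF x : U x -> forall i j,
    nabla_along (metric d) F (e i x) (fun y => 'D_(e j x) F y) x
      - 'D_(christoffel (metric c) x (e i x) (e j x)) F x
    = \sum_k cub (la x) (mu' x) i j k *: ('D_(e k x) F x *m cplx d (F x)).
  move=> Ux0; have [q [Wq dq] xq] := Ux0.
  have hC i j : second_form f c d x (e i x) (e j x) = second_form f c d x (e j x) (e i x).
    exact: (second_form_sym iso _ _ ac ad (sub x Ux0)).
  have cq : param c x = q by rewrite -xq coordK //; exact: Wc.
  have Fx : F x = coord d (f q) by rewrite /F /local_map cq.
  have H := he Wq (conj ad dq) (erefl : (ord0 : 'I_n.+1) = 0%N :> nat).
  rewrite /= xq in H; rewrite /la /mu' cq Fx.
  exact: (umbilical_form hC H).
(* The tension field agrees with this expression on the open set [U] only; that is enough to replace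
   it under both covariant derivatives. *)
pose T (z : 'rV[R]_n.+1) := (la z + n%:R * mu' z) *: ('D_(e ord0 z) F z *m cplx d (F z)).
have tT z : U z -> tension f c d z = T z.
  move=> [q [Wq dq] zq]; rewrite -zq (tension_umbilical Wq (conj ad dq)) zq.
  have cq : param c z = q by rewrite -zq coordK //; exact: Wc.
  by rewrite /T /la /mu' /F /local_map cq.
have bitens x : U x ->
    \sum_i (nabla_along (metric d) F (e i x)
         (fun y => nabla_along (metric d) F (e i y) T y) x
       - nabla_along (metric d) F (levi_civita (metric c) (e i) (e i) x) T x
       + curvature (metric d) (F x) (T x) ('D_(e i x) F x) ('D_(e i x) F x)) = 0.
  move=> Ux0; have B := hbi.2 c d U e ac ad oU sub (conj se oe) x Ux0.
  apply: etrans B; apply: eq_bigr => i _.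
  have E1 (v : 'rV[R]_n.+1) y : U y -> nabla_along (metric d) F v T y
      = nabla_along (metric d) F v (tension f c d) y.
    by move=> Uy; apply: (nabla_congr _ _ oU v Uy) => z Uz; rewrite tT.
  have E2 : nabla_along (metric d) F (e i x) (fun y => nabla_along (metric d) F (e i y) T y) x
      = nabla_along (metric d) F (e i x)
          (fun y => nabla_along (metric d) F (e i y) (tension f c d) y) x.
    by apply: (nabla_congr _ _ oU _ Ux0) => y Uy; exact: E1.
  have E3 := congr1 (fun w => curvature (metric d) (F x) w ('D_(e i x) F x) ('D_(e i x) F x)) (tT x Ux0).
  exact: (congr2 +%R (congr2 (fun v w => v - w) E2 (E1 (levi_civita (metric c) (e i) (e i) x) x Ux0)) (esym E3)).
have key := frame_shape_locally_constant (@image_open _ _ _ d) (metric_smooth ad) (metric_sym_on ad)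
  (metric_pos_on ad) (cplx_smooth ad) parJ sqJ isoJ curvG oU (smooth_sub_set sub (iso.1.2 c d ac ad))
  (fun x Ux => local_map_dom (sub x Ux)) (smooth_sub_set sub (@metric_smooth_local _ _ _ _ _ f c d ac))
  (fun x Ux => metric_sym_local ac (sub x Ux)) (fun x Ux => metric_pos_local ac (sub x Ux))
  (fun x Ux => isometry_local iso ac ad (sub x Ux)) lagF se oe formF bitens n0 Ux.
have H := near_coord (Wc Wp) key; near=> q.
have cq : dom c q by near: q; exact: near_dom (Wc Wp).
have : (la (coord c q) + n%:R * mu' (coord c q)) ^+ 2
    = (la (coord c p) + n%:R * mu' (coord c p)) ^+ 2 by near: q; exact: H.
by rewrite /la /mu' !coordK //; exact: Wc.
Unshelve. all: by end_near. Qed.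
End frame_chart.

Lemma mean_curvature_locally_constant p : exists H0 : R, \forall q \near p,
  forall c d, charts_at q c -> charts_at (f q) d -> mean_curvature f c d q = H0.
Proof.
have [_ _ _ /(_ p) [c [W [e [lam [mu [[ac cp] oW Wp Wc [fe he]]]]]]]] := hf.
exists (Num.sqrt (n.+1%:R^-1 ^+ 2 * (lam p + n%:R * mu p) ^+ 2)).
have H := shape_sqr_locally_constant ac oW Wc fe he Wp.
near=> q => c' d c'q dq.
have Wq : W q by near: q; exact: open_nbhs_nbhs.
rewrite (mean_curvature_umbilical ac Wc fe he Wq c'q dq); congr (Num.sqrt (_ * _)).
by near: q; exact: H.
Unshelve. all: by end_near. Qed.
End umbilical.

(** [Q s p] means that s is the value at p; a relation avoids choosing charts. The set where a given
    value is taken is open, and so is its complement, by uniqueness of values; [s0] answers for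
    empty T. *)
Lemma connected_locally_constant (T : topologicalType) (S : Type) (s0 : S) (Q : S -> T -> Prop) :
  connected [set: T] -> (forall p : T, exists s, \forall q \near p, Q s q) ->
  (forall s t p, Q s p -> Q t p -> s = t) -> exists s, forall p, Q s p.
Proof.
move=> cT loc uniqQ; have [[p0 _]|T0] := pselect (exists p : T, True); last first.
  by exists s0 => p; case: T0; exists p.
have [s sp0] := loc p0; exists s => p; suff -> : Q s = setT by [].
apply: cT; first by exists p0; exact: nbhs_singleton sp0.
- exists (Q s); last by rewrite setTI.
  rewrite openE => q Qq; have [t tq] := loc q.
  by rewrite (uniqQ s t q) //; exact: nbhs_singleton tq.
- exists (Q s); last by rewrite setTI.
  rewrite -openC openE => q nQ; have [t tq] := loc q.
  apply: (filterS _ tq) => r Qtr Qsr; apply: nQ.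
  by rewrite (uniqQ s t r) //; exact: nbhs_singleton tq.
Qed.

Theorem proposition3p1 (R : realType) (n : nat) (hn : (2 <= n)%N) (eps : R)
  (M : riemannian_manifold R n) (N : kaehler_manifold R n) (f : M -> N)
  (hM : connected [set: M])
  (hN : complex_space_form eps N)
  (hf : lagrangian_H_umbilical f)
  (hbi : biharmonic f) :
  exists H0 : R, forall (p : M) c d, charts_at p c -> charts_at (f p) d ->
    mean_curvature f c d p = H0.
Proof.
(* The dimension becomes n + 1 with n positive, so that [ord0] is the index of e_1. *)
case: n hn M N f hM hN hf hbi => // n n0 M N f hM hN hf hbi.
apply: (connected_locally_constant (0 : R) hM) => [p|s t p Hs Ht].
  exact: (mean_curvature_locally_constant n0 hN hf hbi).
have [c ac cp] := atlas_cover p; have [d ad dp] := atlas_cover (f p).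
by rewrite -(Hs c d (conj ac cp) (conj ad dp)) (Ht c d (conj ac cp) (conj ad dp)).
Qed.
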